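(* (Birational invariance of a $g_n^r$.) Let $\Phi:C_1\leftrightsquigarrow C_2$ be a birational map between projective algebraic curves. Then, given a $g_n^r$ on $C_2$, there exists a canonically defined $g_n^r$ on $C_1$, depending only on the class $[\Phi]$ of the birational map. Conversely, given a $g_n^r$ on $C_1$, there exists a canonically defined $g_n^r$ on $C_2$, depending only on the class $[\Phi^{-1}]$ of the birational map. Moreover, these correspondences are inverse.
   Context: $L$ is an algebraically closed field of arbitrary characteristic. A (projective) algebraic curve is a closed irreducible subvariety $C\subset P^w$ of dimension $1$ over $L$, possibly singular. Branches: let $\nu:C^{ns}\to C$ be the non-singular model of $C$. The branches $\gamma$ of $C$ centred at $p\in C$ correspond to the points $q\in\nu^{-1}(p)$. For a form $\phi$ of degree $e$ on $P^w$ having finite intersection with $C$, $I_\gamma(C,\phi)$ is the intersection multiplicity of $C$ and $\phi$ at the branch $\gamma$, that is, the order in $t$ of $\phi$ (written in affine coordinates around $p$) evaluated along a power series parametrisation of the branch. A weighted set on $C$ is a finite formal sum $n_1\gamma_1+\dots+n_k\gamma_k$ of branches of $C$ with non-negative integer coefficients; its total multiplicity is $n_1+\dots+n_k$. If $\phi$ has finite intersection with $C$, then $C\sqcap\phi$ is the weighted set $\sum_\gamma I_\gamma(C,\phi)\gamma$, of total multiplicity $e\deg(C)$. A linear system $\Sigma$ of dimension $R$ is the projectivisation of an $(R+1)$-dimensional vector space of forms of a fixed degree $e$ on $P^w$. $Series(\Sigma)$ is the collection of the weighted sets $C\sqcap\phi$ for $\phi\in\Sigma$ having finite intersection with $C$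 (at least one such form is assumed to exist); its order is $e\deg(C)$, and its dimension is the least integer $r$ such that every weighted set of $Series(\Sigma)$ is of the form $C\sqcap\phi$ with $\phi$ in some fixed linear subsystem $\Sigma'\subset\Sigma$ of dimension $r$. A $g_n^r$ on $C$ is a collection of weighted sets (without repetitions) of the form $\{W-W_0:W\in Series(\Sigma)\}$, for some linear system $\Sigma$ with $r=dimension(Series(\Sigma))$ and some (possibly zero) weighted set $W_0$ contained in every $W\in Series(\Sigma)$ (a fixed branch contribution), where $n=order(Series(\Sigma))$ minus the total multiplicity of $W_0$. Birational maps: $[\Phi]$ denotes the equivalence class of the birational map $\Phi$, two birational maps being equivalent if they agree on a dense open set; $\Phi^{-1}$ is the inverse birational map. *)

(* Defs.v *)
From HB Require Import structures.
From mathcomp Require Import all_boot all_order all_algebra.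
From mathcomp Require Import finmap multiset.
From mathcomp.multinomials Require Export mpoly.

Set Implicit Arguments.
Unset Strict Implicit.
Unset Printing Implicit Defensive.

Import GRing.Theory.
Local Open Scope ring_scope.

(** * Projective space *)

(* A point of P^w(L) is stored through its unique vector of homogeneous
   coordinates whose first nonzero entry is 1, so that equality of points is
   Leibniz equality. *)
Definition normalized (L : fieldType) (n : nat) (v : {ffun 'I_n -> L}) : bool :=
  [exists i, (v i == 1) && [forall j : 'I_n, (j < i)%N ==> (v j == 0)]].

Record proj (L : fieldType) (w : nat) := Proj {
  coords :> {ffun 'I_w.+1 -> L};
  _ : normalized coords }.

HB.instance Definition _ (L : fieldType) (w : nat) :=
  [isSub for @coords L w].
HB.instance Definition _ (L : fieldType) (w : nat) :=
  [Choice of proj L w by <:].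

(* [u] is a system of homogeneous coordinates of the point with coordinates
   [v] (for [v <> 0]). *)
Definition same_point (L : fieldType) (n : nat) (u v : 'I_n -> L) : Prop :=
  exists c : L, c != 0 /\ forall i, u i = c * v i.

(* Forms of degree e on P^w, including 0: a vector space over L. *)
Definition hform (L : fieldType) (w e : nat) : vectType L := dhomog w.+1 L e.

Definition feval (L : fieldType) (w e : nat) (F : hform L w e)
    (v : 'I_w.+1 -> L) : L :=
  (mpoly_of_dhomog F).@[v].

Definition zclosed (L : fieldType) (w : nat) (A : proj L w -> Prop) : Prop :=
  exists S : (forall e, hform L w e -> Prop),
    forall p, A p <-> (forall e (F : hform L w e), S e F -> feval F p = 0).

Definition zirreducible (L : fieldType) (w : nat) (A : proj L w -> Prop) :
    Prop :=
  (exists p, A p) /\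
  forall B1 B2 : proj L w -> Prop, zclosed B1 -> zclosed B2 ->
    (forall p, A p -> B1 p \/ B2 p) ->
    (forall p, A p -> B1 p) \/ (forall p, A p -> B2 p).

(** * Dimension: transcendence degree of the function field *)

(* A rational function on an irreducible A is a quotient F/G of forms of equal
   degree with G not identically zero on A; it is identified with the function
   a |-> F(a)/G(a) on the dense open subset G <> 0 of A. *)
Record fraction_form (L : fieldType) (w : nat) := FractionForm {
  fr_deg : nat;
  fr_num : hform L w fr_deg;
  fr_den : hform L w fr_deg }.

Definition fr_val (L : fieldType) (w : nat) (f : fraction_form L w)
    (a : proj L w) : L :=
  feval (fr_num f) a / feval (fr_den f) a.

Definition fr_defined (L : fieldType) (w : nat) (A : proj L w -> Prop)
    (f : fraction_form L w) : Prop :=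
  exists a, A a /\ feval (fr_den f) a != 0.

Definition alg_independent (L : fieldType) (w : nat) (A : proj L w -> Prop)
    (n : nat) (f : 'I_n -> fraction_form L w) : Prop :=
  forall P : {mpoly L[n]},
    (forall a, A a -> (forall i, feval (fr_den (f i)) a != 0) ->
       P.@[fun i => fr_val (f i) a] = 0) ->
    P = 0.

Definition has_dim (L : fieldType) (w : nat) (A : proj L w -> Prop) (n : nat) :
    Prop :=
  (exists f : 'I_n -> fraction_form L w,
     (forall i, fr_defined A (f i)) /\ alg_independent A f) /\
  (forall f : 'I_n.+1 -> fraction_form L w,
     (forall i, fr_defined A (f i)) -> ~ alg_independent A f).

(** * Projective algebraic curves, rational maps *)

Record curve (L : fieldType) (w : nat) := Curve {
  cset :> pred (proj L w);
  curve_closed : zclosed cset;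
  curve_irreducible : zirreducible cset;
  curve_dim1 : has_dim cset 1 }.

Definition pt (L : fieldType) (w : nat) (C : curve L w) : choiceType :=
  {p : proj L w | cset C p}.

Definition pcoords (L : fieldType) (w : nat) (C : curve L w) (a : pt C) :
    'I_w.+1 -> L := coords (val a).

(* A nonempty open subset of C (equivalently, C being irreducible, a dense
   open subset). *)
Definition dense_open (L : fieldType) (w : nat) (C : curve L w)
    (U : pt C -> Prop) : Prop :=
  (exists a, U a) /\
  exists S : (forall e, hform L w e -> Prop),
    forall a, U a <->
      (exists e (F : hform L w e), S e F /\ feval F (pcoords a) <> 0).

(* The forms psi_0, .., psi_w2 of degree d describe f on the part of D where
   they do not vanish simultaneously. *)
Definition describes (L : fieldType) (w1 w2 : nat) (C1 : curve L w1)
    (C2 : curve L w2) (D : pt C1 -> Prop) (f : pt C1 -> pt C2) (d : nat)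
    (psi : 'I_w2.+1 -> hform L w1 d) : Prop :=
  forall a, D a -> (exists i, feval (psi i) (pcoords a) != 0) ->
    same_point (fun i => feval (psi i) (pcoords a)) (pcoords (f a)).

Definition regular_at (L : fieldType) (w1 w2 : nat) (C1 : curve L w1)
    (C2 : curve L w2) (D : pt C1 -> Prop) (f : pt C1 -> pt C2) (a : pt C1) :
    Prop :=
  exists d (psi : 'I_w2.+1 -> hform L w1 d),
    (exists i, feval (psi i) (pcoords a) != 0) /\ describes D f psi.

(* A rational map is a regular map on a dense open subset [dom]; the values of
   [rfun] outside [dom] are meaningless. *)
Record ratmap (L : fieldType) (w1 w2 : nat) (C1 : curve L w1)
    (C2 : curve L w2) := Ratmap {
  dom : pt C1 -> Prop;
  rfun :> pt C1 -> pt C2;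
  dom_open : dense_open dom;
  dom_regular : forall a, dom a -> regular_at dom rfun a }.

Definition everywhere_defined (L : fieldType) (w1 w2 : nat) (C1 : curve L w1)
    (C2 : curve L w2) (Phi : ratmap C1 C2) : Prop :=
  forall a, dom Phi a.

(* [Phi] = [Phi'] *)
Definition rat_equiv (L : fieldType) (w1 w2 : nat) (C1 : curve L w1)
    (C2 : curve L w2) (Phi Phi' : ratmap C1 C2) : Prop :=
  exists U, dense_open U /\
    forall a, U a -> [/\ dom Phi a, dom Phi' a & Phi a = Phi' a].

Definition left_inverse (L : fieldType) (w1 w2 : nat) (C1 : curve L w1)
    (C2 : curve L w2) (Phi : ratmap C1 C2) (Psi : ratmap C2 C1) : Prop :=
  exists U, dense_open U /\
    forall a, U a -> [/\ dom Phi a, dom Psi (Phi a) & Psi (Phi a) = a].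

(* Phi is birational and Psi represents [Phi^-1]. *)
Definition birational_inverse (L : fieldType) (w1 w2 : nat) (C1 : curve L w1)
    (C2 : curve L w2) (Phi : ratmap C1 C2) (Psi : ratmap C2 C1) : Prop :=
  left_inverse Phi Psi /\ left_inverse Psi Phi.

(** * Non-singular models and branches *)

(* The local ring O_q of C consists of the rational functions A/B with
   B(q) <> 0.  As dim C = 1, it is a regular local ring when its maximal ideal
   is generated by a single element F/G; the displayed identity is
   F'/G' = (A/B) (F/G) with denominators cleared. *)
Definition nonsingular_at (L : fieldType) (w : nat) (C : curve L w)
    (q : pt C) : Prop :=
  exists d (F G : hform L w d),
    [/\ feval F (pcoords q) = 0, feval G (pcoords q) != 0 &
     forall d' (F' G' : hform L w d'),
       feval F' (pcoords q) = 0 -> feval G' (pcoords q) != 0 ->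
       exists d'' (A B : hform L w d''),
         feval B (pcoords q) != 0 /\
         forall a : pt C,
           feval F' (pcoords a) * (feval B (pcoords a) * feval G (pcoords a)) =
           feval A (pcoords a) * feval F (pcoords a) * feval G' (pcoords a)].

Record ns_model (L : fieldType) (w : nat) (C : curve L w) := NsModel {
  ns_dim : nat;
  ns_curve : curve L ns_dim;
  ns_map : ratmap ns_curve C;
  ns_nonsingular : forall q : pt ns_curve, nonsingular_at q;
  ns_everywhere : everywhere_defined ns_map;
  ns_birational : exists mu : ratmap C ns_curve, birational_inverse ns_map mu }.

(* The branches of C centred at p are the points of the fibre of
   [ns_map M] over p. *)
Definition branch (L : fieldType) (w : nat) (C : curve L w) (M : ns_model C) :
    choiceType := pt (ns_curve M).

(** * Power series parametrisations *)

(* A power series over L is its sequence of coefficients.  [pseval F x] is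
   F(x_0(t), .., x_w(t)): its k-th coefficient only involves the truncations of
   the x_i at order k. *)
Definition pseval (L : fieldType) (w e : nat) (F : hform L w e)
    (x : 'I_w.+1 -> nat -> L) (k : nat) : L :=
  (mmap (@polyC L) (fun i => \poly_(j < k.+1) x i j) (mpoly_of_dhomog F))`_k.

Definition ps_order (L : fieldType) (s : nat -> L) (m : nat) : Prop :=
  s m != 0 /\ forall k, (k < m)%N -> s k = 0.

(* A parametrisation of C at a non-singular point q: formal homogeneous
   coordinates x(t), with x(0) representing q, satisfying all the equations of
   C and with nonzero velocity at t = 0 as an arc of P^w (so that t is a local
   parameter at q). *)
Definition parametrisation (L : fieldType) (w : nat) (C : curve L w)
    (q : pt C) (x : 'I_w.+1 -> nat -> L) : Prop :=
  [/\ same_point (fun i => x i 0%N) (pcoords q),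
      forall e (F : hform L w e),
        (forall a : pt C, feval F (pcoords a) = 0) ->
        forall k, pseval F x k = 0 &
      ~ exists c : L, forall i, x i 1%N = c * x i 0%N].

(* A parametrisation of a branch of C: the image under the map of the
   non-singular model of a parametrisation of that model.  Some y_i(0) is
   nonzero; dividing y by the unit y_i(t) gives the affine coordinates around
   the centre, and changes no order of vanishing of a form along y. *)
Definition branch_parametrisation (L : fieldType) (w : nat) (C : curve L w)
    (M : ns_model C) (g : branch M) (y : 'I_w.+1 -> nat -> L) : Prop :=
  exists x d (psi : 'I_w.+1 -> hform L (ns_dim M) d),
    [/\ parametrisation g x,
        exists i, feval (psi i) (pcoords g) != 0,
        describes (dom (ns_map M)) (ns_map M) psi &
        forall i k, y i k = pseval (psi i) x k].

(* I_g(C, phi) = m *)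
Definition int_mult (L : fieldType) (w : nat) (C : curve L w) (M : ns_model C)
    (g : branch M) (e : nat) (phi : hform L w e) (m : nat) : Prop :=
  exists y, branch_parametrisation g y /\ ps_order (pseval phi y) m.

(** * Weighted sets, linear systems and g_n^r *)

(* Weighted sets are finite multisets of branches. *)
Definition wset (L : fieldType) (w : nat) (C : curve L w) (M : ns_model C) :=
  multiset (branch M).

Definition total_mult (L : fieldType) (w : nat) (C : curve L w)
    (M : ns_model C) (W : wset M) : nat := size (enum_mset W).

Definition finite_intersection (L : fieldType) (w : nat) (C : curve L w)
    (e : nat) (phi : hform L w e) : Prop :=
  exists s : seq (pt C), forall a : pt C, feval phi (pcoords a) = 0 -> a \in s.

(* W is the weighted set cut out on C by phi. *)
Definition cut_by (L : fieldType) (w : nat) (C : curve L w) (M : ns_model C)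
    (e : nat) (phi : hform L w e) (W : wset M) : Prop :=
  finite_intersection C phi /\ forall g : branch M, int_mult g phi (W g).

(* The degree of C is its intersection number with a hyperplane. *)
Definition has_degree (L : fieldType) (w : nat) (C : curve L w)
    (M : ns_model C) (d : nat) : Prop :=
  exists (h : hform L w 1) (W : wset M), cut_by h W /\ total_mult W = d.

(* A linear system of dimension R is (the projectivisation of) a subspace of
   dimension R.+1 of the space of forms of degree e. *)
Definition series (L : fieldType) (w : nat) (C : curve L w) (M : ns_model C)
    (e : nat) (V : {vspace hform L w e}) (W : wset M) : Prop :=
  exists2 phi, phi \in V & cut_by phi W.

Definition series_spanned (L : fieldType) (w : nat) (C : curve L w)
    (M : ns_model C) (e : nat) (V V' : {vspace hform L w e}) (r : nat) : Prop :=
  [/\ (V' <= V)%VS, \dim V' = r.+1 &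
      forall W : wset M, series V W -> series V' W].

Definition series_dim (L : fieldType) (w : nat) (C : curve L w)
    (M : ns_model C) (e : nat) (V : {vspace hform L w e}) (r : nat) : Prop :=
  (exists V', series_spanned M V V' r) /\
  (forall r' V', series_spanned M V V' r' -> (r <= r')%N).

Definition is_gnr (L : fieldType) (w : nat) (C : curve L w) (M : ns_model C)
    (n r : nat) (G : wset M -> Prop) : Prop :=
  exists e (V : {vspace hform L w e}) (W0 : wset M) (d : nat),
    [/\ exists2 phi, phi \in V & finite_intersection C phi,
        series_dim M V r,
        forall W : wset M, series V W -> (W0 `<=` W)%mset,
        has_degree M d /\ (n + total_mult W0 = e * d)%N &
        forall W', G W' <->
          exists W : wset M, series V W /\ W' = (W `\` W0)%mset].

(** * Transport along a birational map *)

(* Theta is an isomorphism between the non-singular models which lifts Phi,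
   i.e. nu_2 o Theta = Phi o nu_1 on a dense open set. *)
Definition lifts (L : fieldType) (w1 w2 : nat) (C1 : curve L w1)
    (C2 : curve L w2) (M1 : ns_model C1) (M2 : ns_model C2)
    (Phi : ratmap C1 C2) (Theta : ratmap (ns_curve M1) (ns_curve M2)) : Prop :=
  [/\ everywhere_defined Theta,
      exists Theta' : ratmap (ns_curve M2) (ns_curve M1),
        [/\ everywhere_defined Theta', cancel Theta Theta' &
            cancel Theta' Theta] &
      exists U, dense_open U /\
        forall q, U q -> dom Phi (ns_map M1 q) /\
                         ns_map M2 (Theta q) = Phi (ns_map M1 q)].

(* W1 on C1 is the pullback of W2 on C2 by the bijection of branches
   induced by Phi. *)
Definition pullback_wset (L : fieldType) (w1 w2 : nat) (C1 : curve L w1)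
    (C2 : curve L w2) (M1 : ns_model C1) (M2 : ns_model C2)
    (Phi : ratmap C1 C2) (W2 : wset M2) (W1 : wset M1) : Prop :=
  exists Theta : ratmap (ns_curve M1) (ns_curve M2),
    lifts Phi Theta /\ forall g : branch M1, W1 g = W2 (Theta g).

Definition pullback (L : fieldType) (w1 w2 : nat) (C1 : curve L w1)
    (C2 : curve L w2) (M1 : ns_model C1) (M2 : ns_model C2)
    (Phi : ratmap C1 C2) (G : wset M2 -> Prop) (W1 : wset M1) : Prop :=
  exists2 W2, G W2 & pullback_wset Phi W2 W1.

(* Main.v *)
From HB Require Import structures.
Require Import Defs.
From mathcomp Require Import all_boot all_order all_algebra.
From mathcomp Require Import finmap multiset.
From mathcomp Require Import boolp.
From mathcomp Require classical_sets.
From mathcomp Require Import ring zify.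

(** A birational map lifts to an isomorphism Theta of the non-singular models.
    Branches are points of the models, so Theta is a bijection of branches; it is
    the only lift of its class ([generic_lift_unique]), and the lift of the inverse
    map is its inverse ([generic_lift_cancel]). Hence the pullback of weighted sets
    along Theta depends on the class of the map only, and pulling back both ways
    changes nothing. What remains is that the pullback of a g_n^r is again cut out
    by a linear system, with the same n and r.

    Let forms P_0, .., P_w2 of degree m describe Phi. A form phi of degree e on C2
    gives the form phi(P) of degree e m on C1, and its multiplicity at a branch g is
    that of phi at Theta(g) plus e B(g), where B(g) is the least order of a P_i
    along g ([transport_mult]). So the linear system V goes to its image under
    phi |-> phi(P), the fixed part W0 to its pullback plus e B, and the dimension is
    preserved. The order is right provided that deg C2 plus the total of B, which
    is the size of the weighted set cut by h(P) for a hyperplane h, equals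
    m deg C1 ([is_gnr_transport]).

    This is an instance of the theorem that forms of the same degree cut weighted
    sets of the same size on C1 ([cut_by_total]), proved on the non-singular model
    ([divisor_size]) by counting dimensions. Let F and G be forms of the same degree
    with N_F and N_G zeros. When the degree grows by deg G, the space of forms
    modulo those vanishing on the curve grows by at least N_G, because in large
    degree the zeros of G impose independent conditions. On the other hand the zeros
    of F^j impose at most j N_F conditions, and no nonzero form of degree less
    than j deg F satisfies them, since its quotient by F^j would be regular of
    negative degree ([ord_no_larger_degree]). Letting j grow gives N_G <= N_F, and
    equality by symmetry. The absence of such
    quotients rests on the projective Nullstellensatz
    ([projective_nullstellensatz]), for which a graded ideal maximal among those
    containing no full degree is shown to be the ideal of a point.

    The local theory is that of discrete valuation rings. The order of a form at a
    non-singular point is finite because two rational functions on a curve are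
    algebraically dependent ([val_exists]); parametrisations exist, by expansion in
    a uniformizer ([parametrisation_exists]), and all measure the same order
    ([ps_order_val]). Dividing the coordinates of a rational map by one of least
    order extends the map to all points of a non-singular curve
    ([extend_rational]), which gives Theta, and an isomorphism preserves orders
    ([ord_iso]). *)

Set Implicit Arguments.
Unset Strict Implicit.
Unset Printing Implicit Defensive.

Import GRing.Theory.
Local Open Scope ring_scope.

(** * Homogeneous polynomials *)

Section Homogeneous.
Variable L : fieldType.

Lemma homog_meval_scale n d (p : {mpoly L[n]}) (c : L) (v : 'I_n -> L) :
  p \is d.-homog -> p.@[fun i => c * v i] = c ^+ d * p.@[v].
Proof.
move=> /dhomogP hp; rewrite !mevalE mulr_sumr big_seq [RHS]big_seq.
apply: eq_bigr => m mp; rewrite mulrCA; congr (_ * _).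
have <- : mdeg m = d by exact: hp.
rewrite mdegE -prodrXr -big_split /=.
by apply: eq_bigr => i _; rewrite exprMn.
Qed.

Definition subst n k (p : {mpoly L[n]}) (al : 'I_n -> {mpoly L[k]}) :=
  p \mPo [tuple al i | i < n].

Lemma substE n k (p : {mpoly L[n]}) (al : 'I_n -> {mpoly L[k]}) v :
  (subst p al).@[v] = p.@[fun i => (al i).@[v]].
Proof.
by rewrite /subst comp_mpoly_meval; apply: meval_eq => i; rewrite tnth_mktuple.
Qed.

Lemma homog_prod I (r : seq I) (P : pred I) n (F : I -> {mpoly L[n]}) (d : I -> nat) :
  (forall i, P i -> F i \is (d i).-homog) ->
  \prod_(i <- r | P i) F i \is (\sum_(i <- r | P i) d i)%N.-homog.
Proof.
move=> hF; elim: r => [|i r IH]; first by rewrite !big_nil dhomog1.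
by rewrite !big_cons; case: ifP => // /hF hi; apply: dhomogM.
Qed.

Lemma homog_subst n k d e (p : {mpoly L[n]}) (al : 'I_n -> {mpoly L[k]}) :
  p \is e.-homog -> (forall i, al i \is d.-homog) -> subst p al \is (e * d)%N.-homog.
Proof.
move=> /dhomogP hp hal; rewrite /subst comp_mpolyEX big_seq.
apply: rpred_sum => m mp; apply: rpredZ.
have <- : mdeg m = e by exact: hp.
rewrite comp_mpolyX mdegE big_distrl /=.
apply: homog_prod => i _; rewrite tnth_mktuple mulnC.
exact: dhomogMn.
Qed.

Lemma homogX n i : ('X_i : {mpoly L[n]}) \is 1.-homog.
Proof. by rewrite dhomogX /= mdeg1. Qed.

Lemma homogXn n i k : ('X_i ^+ k : {mpoly L[n]}) \is k.-homog.
Proof. by have := dhomogMn k (homogX (n := n) i); rewrite mul1n. Qed.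

Lemma homogC n (c : L) : (c%:MP : {mpoly L[n]}) \is 0.-homog.
Proof. by rewrite -[c]mulr1 mpolyCM mpolyC1 mul_mpolyC dhomogZ ?dhomog1. Qed.

End Homogeneous.

(** * Points and vanishing of forms *)

Section ProjPoints.
Variables (L : fieldType) (w : nat).

Lemma same_point_sym n (u v : 'I_n -> L) : same_point u v -> same_point v u.
Proof.
move=> [c [c0 h]]; exists c^-1; split; first by rewrite invr_eq0.
by move=> i; rewrite h mulKf.
Qed.

Lemma same_point_trans n (u v x : 'I_n -> L) :
  same_point u v -> same_point v x -> same_point u x.
Proof.
move=> [c [c0 h]] [c' [c'0 h']]; exists (c * c'); split; first by rewrite mulf_neq0.
by move=> i; rewrite h h' mulrA.
Qed.

Lemma same_point_nz n (u v : 'I_n -> L) :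
  same_point u v -> (exists i, v i != 0) -> exists i, u i != 0.
Proof. by move=> [c [c0 h]] [i vi]; exists i; rewrite h mulf_neq0. Qed.

Lemma same_point_cross n (u v : 'I_n -> L) :
  (exists i, u i != 0) -> (exists i, v i != 0) ->
  (forall i j, u i * v j = u j * v i) -> same_point u v.
Proof.
move=> [i ui] [j vj] h.
have vi : v i != 0.
  apply/eqP => vi0; move: (h i j); rewrite vi0 mulr0 => /eqP.
  by rewrite mulf_eq0 (negbTE ui) (negbTE vj).
exists (u i / v i); split; first by rewrite mulf_neq0 ?invr_eq0.
by move=> k; apply: (mulIf vi); rewrite mulrAC divfK // -h.
Qed.

Lemma cross_same_point n (u v : 'I_n -> L) i j :
  same_point u v -> u i * v j = u j * v i.
Proof. by move=> [c [_ h]]; rewrite !h -!mulrA [v i * _]mulrC. Qed.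

Lemma same_point_homog d n (p : {mpoly L[n]}) (u v : 'I_n -> L) :
  p \is d.-homog -> same_point u v -> (p.@[u] == 0) = (p.@[v] == 0).
Proof.
move=> hp [c [c0 h]]; rewrite (meval_eq p h) (homog_meval_scale _ _ hp).
by rewrite mulf_eq0 expf_eq0 (negbTE c0) andbF.
Qed.

Lemma proj_coords_nz (p : proj L w) : exists i, coords p i != 0.
Proof.
case: p => v vP /=; have /existsP[i /andP[/eqP h _]] := vP.
by exists i; rewrite h oner_neq0.
Qed.

Lemma proj_inj (p q : proj L w) : same_point (coords p) (coords q) -> p = q.
Proof.
move=> [c [c0 h]]; apply: val_inj => /=.
suff c1 : c = 1 by apply/ffunP => i; rewrite h c1 mul1r.
case: p q h => [u uP] [v vP] /= h.
have /existsP[i /andP[/eqP ui /forallP hi]] := uP.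
have /existsP[j /andP[/eqP vj /forallP hj]] := vP.
have [ij|ji|/val_inj ij] := ltngtP i j.
- have /eqP vi0 := implyP (hj i) ij.
  by move: (h i); rewrite ui vi0 mulr0 => /eqP; rewrite oner_eq0.
- have /eqP uj0 := implyP (hi j) ji.
  by move: (h j); rewrite uj0 vj mulr1 => /esym/eqP; rewrite (negbTE c0).
- by move: (h i); rewrite ui ij vj mulr1.
Qed.

Lemma proj_of_vector (v : 'I_w.+1 -> L) :
  (exists i, v i != 0) -> exists p : proj L w, same_point v (coords p).
Proof.
move=> [i0 vi0].
case: (@arg_minnP _ i0 (fun i => v i != 0) (fun i => i) vi0) => i vi hi.
have nv : normalized [ffun j => v j / v i].
  apply/existsP; exists i; rewrite ffunE divff // eqxx /=.
  apply/forallP => j; apply/implyP => ji; rewrite ffunE.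
  have [->|vj] := eqVneq (v j) 0; first by rewrite mul0r.
  by have := hi _ vj; rewrite leqNgt ji.
exists (Proj nv), (v i); split=> // j.
by rewrite /= ffunE mulrC divfK.
Qed.

Variable C : curve L w.

Definition ev (p : {mpoly L[w.+1]}) (a : pt C) : L := p.@[pcoords a].

Definition vanish (p : {mpoly L[w.+1]}) : Prop := forall a, ev p a = 0.

Definition mkform d (p : {mpoly L[w.+1]}) (hp : p \is d.-homog) : hform L w d :=
  DHomog hp.

Lemma hform_homog d (F : hform L w d) : mpoly_of_dhomog F \is d.-homog.
Proof. exact: dhomog_is_dhomog. Qed.

Lemma evM p q a : ev (p * q) a = ev p a * ev q a. Proof. exact: mevalM. Qed.
Lemma evD p q a : ev (p + q) a = ev p a + ev q a. Proof. exact: mevalD. Qed.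
Lemma evB p q a : ev (p - q) a = ev p a - ev q a. Proof. exact: mevalB. Qed.
Lemma evZ c p a : ev (c *: p) a = c * ev p a. Proof. exact: mevalZ. Qed.
Lemma ev1 a : ev 1 a = 1. Proof. exact: meval1. Qed.
Lemma ev0 a : ev 0 a = 0. Proof. exact: meval0. Qed.
Lemma evC c a : ev c%:MP a = c. Proof. exact: mevalC. Qed.
Lemma evXU i a : ev 'X_i a = pcoords a i. Proof. exact: mevalXU. Qed.
Lemma evX p k a : ev (p ^+ k) a = ev p a ^+ k. Proof. exact: rmorphXn. Qed.
Lemma ev_sum I (r : seq I) (P : pred I) (F : I -> {mpoly L[w.+1]}) a :
  ev (\sum_(i <- r | P i) F i) a = \sum_(i <- r | P i) ev (F i) a.
Proof. exact: raddf_sum. Qed.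
Lemma ev_prod I (r : seq I) (P : pred I) (F : I -> {mpoly L[w.+1]}) a :
  ev (\prod_(i <- r | P i) F i) a = \prod_(i <- r | P i) ev (F i) a.
Proof. exact: rmorph_prod. Qed.
Definition evE := (evM, evB, evD, evZ, ev1, ev0, evC, evXU, evX).

Lemma pcoords_nz (a : pt C) : exists i, pcoords a i != 0.
Proof. exact: proj_coords_nz. Qed.

Lemma coord_nz (a : pt C) : exists i, ev 'X_i a != 0.
Proof. by have [i] := pcoords_nz a; exists i; rewrite evXU. Qed.

Lemma pt_inj (a b : pt C) : same_point (pcoords a) (pcoords b) -> a = b.
Proof. by move=> h; apply/val_inj/proj_inj. Qed.

Lemma pt_ex : exists a : pt C, True.
Proof. by have [[a Ca] _] := curve_irreducible C; exists (exist _ a Ca). Qed.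

(** The closedness of C, in the form in which it produces points of C: as the
    value of an extended map, or as a zero of an ideal. *)
Lemma pt_of_vector (v : 'I_w.+1 -> L) :
  (exists i, v i != 0) ->
  (forall d p, p \is d.-homog -> vanish p -> p.@[v] = 0) ->
  exists a : pt C, same_point v (pcoords a).
Proof.
move=> /proj_of_vector[q vq] hv.
have [S hS] := curve_closed C.
have Cq : cset C q.
  apply/(hS q) => e F SF; apply/eqP; rewrite -(same_point_homog (hform_homog F) vq).
  apply/eqP/(hv e) => [|a]; first exact: hform_homog.
  by have /hS/(_ e F SF) := valP a.
by exists (exist _ q Cq).
Qed.

(** Irreducibility: the forms, taken modulo those vanishing on C, have no zero
    divisors. *)
Lemma vanish_domain d e p q : p \is d.-homog -> q \is e.-homog ->
  (forall a, ev p a * ev q a = 0) -> vanish p \/ vanish q.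
Proof.
move=> hp hq h.
pose Z d (p : {mpoly L[w.+1]}) (hp : p \is d.-homog) (a : proj L w) : Prop := p.@[coords a] = 0.
have Zc d' p' (hp' : p' \is d'.-homog) : zclosed (Z d' p' hp').
  exists (fun e F => mpoly_of_dhomog F = p') => a; split=> [Za e' F|H].
    by rewrite /feval => ->.
  exact: (H d' (mkform hp')).
have [_ /(_ _ _ (Zc _ _ hp) (Zc _ _ hq)) H] := curve_irreducible C.
case: H => [a Ca|H|H].
- have /eqP := h (exist _ a Ca); rewrite mulf_eq0 => /orP[]/eqP; by [left|right].
- by left=> a; apply: H; apply: valP.
- by right=> a; apply: H; apply: valP.
Qed.

Lemma nvanish_ex p : ~ vanish p -> exists a, ev p a != 0.
Proof.
move=> h; apply: contrapT => k; apply: h => a; apply/eqP.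
by apply: contrapT => ha; apply: k; exists a; apply/negP.
Qed.

Lemma nvanish_at p a : ev p a != 0 -> ~ vanish p.
Proof. by move=> h /(_ a) k; rewrite k eqxx in h. Qed.

Lemma nvanishM d e p q : p \is d.-homog -> q \is e.-homog ->
  ~ vanish p -> ~ vanish q -> ~ vanish (p * q).
Proof.
move=> hp hq np nq h.
by case: (vanish_domain hp hq) => // a; rewrite -evM.
Qed.

Lemma nvanishX d p k : p \is d.-homog -> ~ vanish p -> ~ vanish (p ^+ k).
Proof.
move=> hp np h; apply: np => a; have := h a; rewrite evX => /eqP.
by rewrite expf_eq0 => /andP[_ /eqP].
Qed.

(** Identity principle: C would otherwise be the union of the zeros of r and of
    those of p - q. *)
Lemma ev_eq d e r p q : r \is e.-homog -> ~ vanish r ->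
  p \is d.-homog -> q \is d.-homog ->
  (forall a, ev r a != 0 -> ev p a = ev q a) -> forall a, ev p a = ev q a.
Proof.
move=> hr nr hp hq h a; apply/eqP; rewrite -subr_eq0 -evB; apply/eqP.
have hpq : p - q \is d.-homog by rewrite rpredB.
case: (vanish_domain hr hpq) => // b.
have [->|/h] := eqVneq (ev r b) 0; first by rewrite mul0r.
by rewrite evB => ->; rewrite subrr mulr0.
Qed.

Lemma ev_cancel d e r p q : r \is e.-homog -> ~ vanish r ->
  p \is d.-homog -> q \is d.-homog ->
  (forall a, ev r a * ev p a = ev r a * ev q a) -> forall a, ev p a = ev q a.
Proof.
move=> hr nr hp hq h; apply: (ev_eq hr nr hp hq) => a ra; exact: (mulfI ra).
Qed.

End ProjPoints.

Arguments ev {L w C}.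
Arguments vanish {L w} C.

Lemma finite_of_inj (T : eqType) (F : finType) (K : T -> Prop) (phi : T -> F) :
  (forall a b : T, K a -> K b -> phi a = phi b -> a = b) ->
  exists s : seq T, forall a : T, K a -> a \in s.
Proof.
move=> inj.
have /choice[g hg] (u : F) : exists o : option T,
    if o is Some a then K a /\ phi a = u else forall a : T, K a -> phi a <> u.
  have [[a aP]|H] := EM (exists a, K a /\ phi a = u).
    by exists (Some a).
  by exists None => a Ka h; apply: H; exists a.
exists (pmap g (enum F)) => a Ka; rewrite mem_pmap.
apply/mapP; exists (phi a); first by rewrite mem_enum.
have := hg (phi a); case: (g (phi a)) => [b [Kb hb]|/(_ _ Ka)//].
by congr Some; apply: inj.
Qed.

(** * Local rings as germs of functions *)

Section Germs.
Variables (L : closedFieldType) (w : nat) (C : curve L w).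
Implicit Types (p r : {mpoly L[w.+1]}) (q a b : pt C) (f g h : pt C -> L).

(** Neighbourhoods of a point, and dense open sets, are replaced by their bases:
    the sets where one form does not vanish. This makes finite intersections and
    preimages under maps given by forms immediate. *)
Definition near q (S : pt C -> Prop) : Prop :=
  exists d r, [/\ r \is d.-homog, ev r q != 0 & forall a, ev r a != 0 -> S a].

Definition generic (S : pt C -> Prop) : Prop :=
  exists d r, [/\ r \is d.-homog, ~ vanish C r & forall a, ev r a != 0 -> S a].

Lemma near_self q S : near q S -> S q.
Proof. by move=> [d [r [_ rq h]]]; apply: h. Qed.

Lemma near_generic q S : near q S -> generic S.
Proof. by move=> [d [r [hr rq h]]]; exists d, r; split=> //; apply: nvanish_at rq. Qed.

Lemma near_sub q (S T : pt C -> Prop) : (forall a, S a -> T a) -> near q S -> near q T.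
Proof. by move=> ST [d [r [hr rq h]]]; exists d, r; split=> // a /h /ST. Qed.

Lemma near_and q (S T : pt C -> Prop) : near q S -> near q T -> near q (fun a => S a /\ T a).
Proof.
move=> [d [r [hr rq h]]] [d' [r' [hr' rq' h']]]; exists (d + d')%N, (r * r').
split; [exact: dhomogM | by rewrite evM mulf_neq0 |].
by move=> a; rewrite evM mulf_eq0 negb_or => /andP[/h ? /h' ?].
Qed.

Lemma near_all q (S : pt C -> Prop) : (forall a, S a) -> near q S.
Proof.
move=> h; exists 0%N, 1; split=> //; first exact: dhomog1.
by rewrite ev1 oner_eq0.
Qed.

Lemma near_form q d r : r \is d.-homog -> ev r q != 0 -> near q (fun a => ev r a != 0).
Proof. by move=> hr rq; exists d, r; split. Qed.

Lemma generic_sub (S T : pt C -> Prop) : (forall a, S a -> T a) -> generic S -> generic T.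
Proof. by move=> ST [d [r [hr rq h]]]; exists d, r; split=> // a /h /ST. Qed.

Lemma generic_and (S T : pt C -> Prop) :
  generic S -> generic T -> generic (fun a => S a /\ T a).
Proof.
move=> [d [r [hr rq h]]] [d' [r' [hr' rq' h']]]; exists (d + d')%N, (r * r').
split; [exact: dhomogM | exact: nvanishM hr hr' _ _ |].
by move=> a; rewrite evM mulf_eq0 negb_or => /andP[/h ? /h' ?].
Qed.

Lemma generic_ex S : generic S -> exists a, S a.
Proof. by move=> [d [r [hr /nvanish_ex[a ra] h]]]; exists a; apply: h. Qed.

Lemma generic_form d r : r \is d.-homog -> ~ vanish C r -> generic (fun a => ev r a != 0).
Proof. by move=> hr rq; exists d, r; split. Qed.

Lemma generic_eq d p r : p \is d.-homog -> r \is d.-homog ->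
  generic (fun a => ev p a = ev r a) -> forall a : pt C, ev p a = ev r a.
Proof. by move=> hp hr [e [s [hs ns h]]]; apply: ev_eq hs ns hp hr h. Qed.

Lemma generic_vanish d p : p \is d.-homog -> generic (fun a => ev p a = 0) -> vanish C p.
Proof.
move=> hp h a; rewrite -(ev0 a); apply: (generic_eq hp) => //.
  exact: dhomog0.
by apply: generic_sub h => b ->; rewrite ev0.
Qed.

(** An element of the local ring at q is represented by a total function whose
    values are those of a fraction of forms near q. Identities between such
    functions are only ever claimed near q, so that no quotient has to be formed
    and the residue of f is simply its value f q. *)
Definition reg q f : Prop :=
  exists d p r, [/\ p \is d.-homog, r \is d.-homog, ev r q != 0 &
                   forall a, ev r a != 0 -> f a = ev p a / ev r a].

Lemma reg_near q f g : reg q f -> near q (fun a => g a = f a) -> reg q g.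
Proof.
move=> [d [p [r [hp hr rq h]]]] [d' [s [hs sq h']]].
exists (d + d')%N, (p * s), (r * s); split; try exact: dhomogM.
  by rewrite evM mulf_neq0.
move=> a; rewrite !evM mulf_eq0 negb_or => /andP[ra sa].
by rewrite h' // h // -mulf_div divff // mulr1.
Qed.

Lemma reg_frac q d p r : p \is d.-homog -> r \is d.-homog -> ev r q != 0 ->
  reg q (fun a => ev p a / ev r a).
Proof. by move=> hp hr rq; exists d, p, r. Qed.

Lemma reg_const q (c : L) : reg q (fun=> c).
Proof.
exists 0%N, c%:MP, 1; split; [exact: homogC | exact: dhomog1 | by rewrite ev1 oner_eq0 |].
by move=> a _; rewrite evC ev1 divr1.
Qed.

Lemma regD q f g : reg q f -> reg q g -> reg q (fun a => f a + g a).
Proof.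
move=> [d [p [r [hp hr rq h]]]] [d' [p' [r' [hp' hr' rq' h']]]].
exists (d + d')%N, (p * r' + p' * r), (r * r'); split.
- by apply: rpredD; [exact: dhomogM | rewrite addnC; exact: dhomogM].
- exact: dhomogM.
- by rewrite evM mulf_neq0.
- move=> a; rewrite evM mulf_eq0 negb_or => /andP[ra sa].
  by rewrite h // h' // addf_div // !evE.
Qed.

Lemma regM q f g : reg q f -> reg q g -> reg q (fun a => f a * g a).
Proof.
move=> [d [p [r [hp hr rq h]]]] [d' [p' [r' [hp' hr' rq' h']]]].
exists (d + d')%N, (p * p'), (r * r'); split; try exact: dhomogM.
- by rewrite evM mulf_neq0.
- move=> a; rewrite evM mulf_eq0 negb_or => /andP[ra sa].
  by rewrite h // h' // mulf_div // !evE.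
Qed.

Lemma regN q f : reg q f -> reg q (fun a => - f a).
Proof.
move=> hf; apply: (reg_near (regM (reg_const q (-1)) hf)).
by apply: near_all => a; rewrite mulN1r.
Qed.

Lemma regB q f g : reg q f -> reg q g -> reg q (fun a => f a - g a).
Proof. by move=> hf hg; apply: regD => //; apply: regN. Qed.

Lemma regX q f k : reg q f -> reg q (fun a => f a ^+ k).
Proof.
move=> hf; elim: k => [|k IH].
  by apply: (reg_near (reg_const q 1)); apply: near_all => a; rewrite expr0.
by apply: (reg_near (regM hf IH)); apply: near_all => a; rewrite exprS.
Qed.

Lemma regV q f : reg q f -> f q != 0 -> reg q (fun a => (f a)^-1).
Proof.
move=> [d [p [r [hp hr rq h]]]]; rewrite h // mulf_eq0 negb_or => /andP[pq _].
have H := reg_frac hr hp pq; apply: reg_near H _.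
apply: near_sub (near_and (near_form hr rq) (near_form hp pq)) => a [ra _].
by rewrite h // invf_div.
Qed.

Lemma reg_neq0 q f : reg q f -> f q != 0 -> near q (fun a => f a != 0).
Proof.
move=> [d [p [r [hp hr rq h]]]]; rewrite h // mulf_eq0 negb_or => /andP[pq _].
apply: near_sub (near_and (near_form hr rq) (near_form hp pq)) => a [ra pa].
by rewrite h // mulf_neq0 ?invr_eq0.
Qed.

Lemma reg_horner q f (c : {poly L}) : reg q f -> reg q (fun a => c.[f a]).
Proof.
move=> hf; elim/poly_ind: c => [|c x IH].
  by apply: (reg_near (reg_const q 0)); apply: near_all => a; rewrite horner0.
apply: (reg_near (regD (regM IH hf) (reg_const q x))); apply: near_all => a.
by rewrite hornerMXaddC.
Qed.

Lemma reg_horner2 q f g (c : {poly {poly L}}) : reg q f -> reg q g ->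
  reg q (fun a => c.[(f a)%:P].[g a]).
Proof.
move=> hf hg; elim/poly_ind: c => [|c x IH].
  by apply: (reg_near (reg_const q 0)); apply: near_all => a; rewrite !horner0.
apply: (reg_near (regD (regM IH hf) (reg_horner x hg))); apply: near_all => a.
by rewrite hornerMXaddC hornerD hornerM hornerC.
Qed.

(** Irreducibility again, with the denominators cleared. *)
Lemma reg_domain q f g : reg q f -> reg q g -> near q (fun a => f a * g a = 0) ->
  near q (fun a => f a = 0) \/ near q (fun a => g a = 0).
Proof.
move=> [d [p [r [hp hr rq h]]]] [d' [p' [r' [hp' hr' rq' h']]]] [e [s [hs sq k]]].
have hrr := dhomogM hr (dhomogM hr' hs).
have hpp := dhomogM hp hp'.
have V : vanish C (r * (r' * s)) \/ vanish C (p * p').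
  apply: vanish_domain hrr hpp _ => a; apply/eqP; rewrite mulf_eq0.
  case: eqP => //= /eqP; rewrite !evM !mulf_eq0 !negb_or => /and3P[ra r'a sa].
  have /eqP := k _ sa; rewrite h // h' // !mulf_eq0 !invr_eq0.
  by rewrite (negbTE ra) (negbTE r'a) !orbF.
case: V => [/(_ q)/eqP|V]; first by rewrite !evM !mulf_eq0 (negbTE rq) (negbTE rq') (negbTE sq).
have {V}[V|V] : vanish C p \/ vanish C p'.
  by apply: vanish_domain hp hp' _ => a; rewrite -evM.
- by left; exists d, r; split=> // a ra; rewrite h // V mul0r.
- by right; exists d', r'; split=> // a ra; rewrite h' // V mul0r.
Qed.

Lemma frac_near0 q d p r : p \is d.-homog -> r \is d.-homog -> ev r q != 0 ->
  near q (fun a => ev p a / ev r a = 0) -> vanish C p.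
Proof.
move=> hp hr rq /near_generic hn; apply: (generic_vanish hp).
apply: generic_sub (generic_and hn (generic_form hr (nvanish_at rq))) => a [/eqP].
by rewrite mulf_eq0 invr_eq0 => /orP[/eqP//|/eqP->]; rewrite eqxx.
Qed.

(** * Consequences of dimension one *)

(** On a finite set a rational function f is killed by the product of the
    T - f(b), hence is algebraic over L. *)
Lemma curve_infinite (s : seq (pt C)) : exists a, a \notin s.
Proof.
have [[f [hf hind]] _] := curve_dim1 C.
pose x a := fr_val (f ord0) (val a).
pose P : {mpoly L[1]} := \prod_(b <- s) ('X_ord0 - (x b)%:MP).
have PE a : P.@[fun i => fr_val (f i) (val a)] = \prod_(b <- s) (x a - x b).
  rewrite rmorph_prod /=; apply: eq_bigr => b _.
  by rewrite mevalB mevalXU mevalC.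
have P0 : P != 0.
  rewrite prodf_seq_neq0; apply/allP => b _ /=.
  apply/eqP => /(congr1 (fun p : {mpoly L[1]} => p.@[fun=> x b + 1])).
  by rewrite mevalB mevalXU mevalC meval0 addrAC subrr add0r => /eqP; rewrite oner_eq0.
apply: contrapT => H; move/eqP: P0; apply; apply: hind => a Ca _.
rewrite (PE (exist _ a Ca)); apply/eqP; rewrite prodf_seq_eq0.
apply/hasP; exists (exist _ a Ca); last by rewrite subrr eqxx.
by apply: contrapT => k; apply: H; exists (exist _ a Ca); apply/negP.
Qed.

Lemma separating_form a b : a <> b ->
  exists p, [/\ p \is 1.-homog, ev p a = 0 & ev p b != 0].
Proof.
move=> ab; apply: contrapT => H; apply: ab; apply: pt_inj.
apply: same_point_cross; try exact: pcoords_nz.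
move=> i j; apply/eqP; rewrite -subr_eq0; apply: contrapT => /negP k; apply: H.
exists (pcoords a i *: 'X_j - pcoords a j *: 'X_i); split.
- by rewrite rpredB // rpredZ // homogX.
- by rewrite !evE mulrC subrr.
- by rewrite !evE.
Qed.

(** The relation is rewritten as a polynomial in the first variable over the
    polynomials in the second, where powers of the first variable can be divided
    out. *)
Lemma bivariate_of_mpoly (Q : {mpoly L[2]}) : Q != 0 ->
  exists2 c : {poly {poly L}}, c != 0 &
    forall x y, Q.@[fun i => if i == ord0 then x else y] = c.[x%:P].[y].
Proof.
move=> Q0.
(* The outer variable stands for the variable of index 0. *)
exists (\sum_(m <- msupp Q) (Q@_m *: 'X^(m ord_max))%:P * 'X^(m ord0)).
  have [m mQ] : exists m, m \in msupp Q.
    case: (msupp Q) (msupp_eq0 Q) => [|m s _]; first by rewrite eqxx (negbTE Q0).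
    by exists m; rewrite inE eqxx.
  apply/eqP => /(congr1 (fun c : {poly {poly L}} => c`_(m ord0)`_(m ord_max))).
  rewrite !coef_sum !coef0 (bigD1_seq m) ?msupp_uniq //= big1_seq.
    rewrite addr0 coefCM coefXn eqxx mulr1 coefZ coefXn eqxx mulr1 => /eqP.
    by rewrite mcoeff_eq0 mQ.
  move=> m' /andP[m'm _]; rewrite coefCM coefXn.
  have [h0|] := eqVneq (m ord0) (m' ord0); last by rewrite mulr0 coef0.
  rewrite mulr1 coefZ coefXn; have [h1|] := eqVneq (m ord_max) (m' ord_max); last by rewrite mulr0.
  case/eqP: m'm; apply/mnmP => i; case: (unliftP ord0 i) => [j ->|-> //].
  by rewrite (_ : lift _ _ = ord_max) //; apply/val_inj; rewrite /= (ord1 j).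
move=> x y; rewrite mevalE horner_sum horner_sum; apply: eq_bigr => m _.
rewrite big_ord_recl big_ord1 /= hornerM hornerC hornerXn -polyC_exp hornerM hornerC.
rewrite hornerZ hornerXn -mulrA [x ^+ _ * _]mulrC; congr (_ * (y ^+ m _ * _)).
exact/val_inj.
Qed.

Lemma algebraic_dependence d p r d' p' r' :
  p \is d.-homog -> r \is d.-homog -> ~ vanish C r ->
  p' \is d'.-homog -> r' \is d'.-homog -> ~ vanish C r' ->
  exists2 c : {poly {poly L}}, c != 0 &
    forall a : pt C, ev r a != 0 -> ev r' a != 0 ->
      c.[(ev p a / ev r a)%:P].[ev p' a / ev r' a] = 0.
Proof.
move=> hp hr nr hp' hr' nr'.
have [_ H] := curve_dim1 C.
pose f (i : 'I_2) := if i == ord0 then FractionForm (mkform hp) (mkform hr)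
                     else FractionForm (mkform hp') (mkform hr').
have hf i : fr_defined (cset C) (f i).
  have [[a ra] [b rb]] := (nvanish_ex nr, nvanish_ex nr').
  rewrite /f; case: ifP => _.
    by exists (val a); split; [exact: valP | exact: ra].
  by exists (val b); split; [exact: valP | exact: rb].
have {H hf} H := H f hf.
have [Q [Q0 hQ]] : exists Q : {mpoly L[2]}, Q != 0 /\
    forall x : proj L w, cset C x -> (forall i, feval (fr_den (f i)) x != 0) ->
       Q.@[fun i => fr_val (f i) x] = 0.
  apply: contrapT => K; apply: H => Q hQ; apply: contrapT => /eqP Q0.
  by apply: K; exists Q.
have [c c0 hc] := bivariate_of_mpoly Q0; exists c => // a ra ra'.
rewrite -hc -[RHS](hQ (val a)); last 2 first.
- exact: valP.
- by move=> i; rewrite /f; case: ifP.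
by apply: meval_eq => i; rewrite /fr_val /f; case: ifP.
Qed.

(** A relation c(f,g) = 0 with f <> 0 can be divided by f until its constant
    term in f survives. That term e depends on c only, which is what makes the
    result usable at all points of C simultaneously. *)
Lemma dependence_constant_term (c : {poly {poly L}}) : c != 0 ->
  exists2 e : {poly L}, e != 0 & forall q f g, reg q f -> reg q g ->
    ~ near q (fun a => f a = 0) -> near q (fun a => c.[(f a)%:P].[g a] = 0) ->
    exists2 h, reg q h & near q (fun a => e.[g a] = f a * h a).
Proof.
elim/poly_ind: c => [|c e IH]; first by rewrite eqxx.
have [->|e0] := eqVneq e 0; last first.
  move=> _; exists e => // q f g hf hg nf H.
  exists (fun a => - c.[(f a)%:P].[g a]); first by apply: regN; apply: reg_horner2.
  apply: near_sub H => a; rewrite hornerMXaddC hornerD hornerM hornerC => /eqP.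
  by rewrite addr_eq0 => /eqP; rewrite mulrN mulrC => ->; rewrite opprK.
have [->|c0 _] := eqVneq c 0; first by rewrite mul0r addr0 eqxx.
have [e' e'0 H] := IH c0; exists e' => // q f g hf hg nf K.
apply: H => //; case: (reg_domain hf (reg_horner2 c hf hg)) => //.
by apply: near_sub K => a; rewrite addr0 hornerMX hornerM hornerC mulrC.
Qed.

(** In the chart where X_i <> 0, each ratio X_j / X_i is algebraically dependent
    on p / X_i^d. The constant term of the relation is a nonzero polynomial that
    kills the ratio at every zero of p, so the ratios take finitely many values
    there. *)
Lemma finite_zeros d p : p \is d.-homog -> ~ vanish C p ->
  exists s : seq (pt C), forall a, ev p a = 0 -> a \in s.
Proof.
move=> hp np.
have chart i : exists s : seq (pt C), forall a, ev 'X_i a != 0 /\ ev p a = 0 -> a \in s.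
  have [V|nV] := EM (vanish C 'X_i).
    by exists [::] => a []; rewrite V eqxx.
  have /choice[r hr] j : exists r : seq L, forall a, ev 'X_i a != 0 -> ev p a = 0 ->
      ev 'X_j a / ev 'X_i a \in r.
    have [c c0 hc] := algebraic_dependence hp (homogXn L i d) (nvanishX (homogX L i) nV)
                         (homogX L j) (homogX L i) nV.
    have [e e0 he] := dependence_constant_term c0.
    have [r hr] := closed_field_poly_normal e.
    exists r => a xa pa; rewrite -root_prod_XsubC.
    suff : root e (ev 'X_j a / ev 'X_i a).
      by rewrite {1}hr rootZ ?lead_coef_eq0.
    have xda : ev ('X_i ^+ d) a != 0 by rewrite evX expf_neq0.
    have [||||h hh /near_self H] := he a (fun b => ev p b / ev ('X_i ^+ d) b)
         (fun b => ev 'X_j b / ev 'X_i b).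
    - by apply: (reg_frac hp) => //; apply: homogXn.
    - by apply: (reg_frac (homogX L j)) => //; apply: homogX.
    - by move/(frac_near0 hp (homogXn L i d) xda).
    - apply: near_sub (near_and (near_form (homogXn L i d) xda) (near_form (homogX L i) xa)) => b [? ?].
      exact: hc.
    by rewrite /root H pa !mul0r.
  pose R := flatten [seq r j | j <- enum 'I_w.+1].
  have memR a j : ev 'X_i a != 0 -> ev p a = 0 -> ev 'X_j a / ev 'X_i a \in R.
    by move=> xa pa; apply/flatten_mapP; exists j; [rewrite mem_enum | exact: hr].
  pose phi a : {ffun 'I_w.+1 -> 'I_(size R).+1} :=
    [ffun j => inord (index (ev 'X_j a / ev 'X_i a) R)].
  apply: (finite_of_inj (phi := phi)) => a b [xa pa] [xb pb] /ffunP h.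
  have E j : ev 'X_j a / ev 'X_i a = ev 'X_j b / ev 'X_i b.
    have := h j; rewrite !ffunE => /(congr1 val) /=.
    have [ma mb] := (memR a j xa pa, memR b j xb pb).
    rewrite !inordK ?ltnS ?index_size // => /(congr1 (nth 0 R)).
    by rewrite !nth_index.
  apply: pt_inj; exists (ev 'X_i a / ev 'X_i b); split.
    by rewrite mulf_neq0 ?invr_eq0.
  move=> j; rewrite -!evXU mulrAC -mulrA -E mulrC divfK //.
have [s hs] := choice chart.
exists (flatten [seq s i | i <- enum 'I_w.+1]) => a pa.
have [i xi] := coord_nz a; apply/flatten_mapP; exists i; first by rewrite mem_enum.
exact: hs.
Qed.

(** * Uniformizers *)

(** A generator of the maximal ideal of the local ring at q; its existence is
    the non-singularity of q. The third clause makes t cancellable. *)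
Definition uniformizer q (t : pt C -> L) : Prop :=
  [/\ reg q t, t q = 0, ~ near q (fun a => t a = 0) &
      forall f, reg q f -> f q = 0 ->
        exists2 g, reg q g & near q (fun a => f a = t a * g a)].

(** The form p cannot vanish on C: the maximal ideal would be zero, although a
    linear form separates q from another point. *)
Lemma uniformizer_exists q : nonsingular_at q -> exists d p r,
  [/\ p \is d.-homog, r \is d.-homog, ev p q = 0, ev r q != 0 &
      uniformizer q (fun a => ev p a / ev r a)].
Proof.
move=> [d [F [G [Fq Gq H]]]].
pose p := mpoly_of_dhomog F; pose r := mpoly_of_dhomog G.
have hp : p \is d.-homog := hform_homog F.
have hr : r \is d.-homog := hform_homog G.
have div d' p' r' : p' \is d'.-homog -> r' \is d'.-homog -> ev p' q = 0 -> ev r' q != 0 ->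
    exists e u v, [/\ u \is e.-homog, v \is e.-homog, ev v q != 0 &
      forall a : pt C, ev p' a * (ev v a * ev r a) = ev u a * ev p a * ev r' a].
  move=> hp' hr' p'q r'q.
  have [e [A [B [Bq AB]]]] := H d' (mkform hp') (mkform hr') p'q r'q.
  by exists e, (mpoly_of_dhomog A), (mpoly_of_dhomog B); split=> //; apply: hform_homog.
exists d, p, r; split=> //; split.
- exact: reg_frac hp hr Gq.
- by rewrite [ev p q]Fq mul0r.
- move/(frac_near0 hp hr Gq) => Vp.
  have [b] := curve_infinite [:: q]; rewrite inE => /eqP bq.
  have [l [hl lq lb]] := separating_form (nesym bq).
  have [i xq] := coord_nz q.
  have [e [u [v [hu hv vq E]]]] := div _ _ _ hl (homogX L i) lq xq.
  have [V|V] : vanish C l \/ vanish C (v * r).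
    apply: vanish_domain hl (dhomogM hv hr) _ => a.
    by rewrite evM E Vp mulr0 mul0r.
  + by rewrite V eqxx in lb.
  + have /eqP := V q; rewrite evM mulf_eq0 (negbTE vq) /= => /eqP h.
    by move: Gq; rewrite /feval -/r -/(ev r q) h eqxx.
- move=> f [e [p' [r' [hp' hr' r'q hf]]]].
  rewrite hf // => /eqP; rewrite mulf_eq0 invr_eq0 (negbTE r'q) orbF => /eqP p'q.
  have [e' [u [v [hu hv vq E]]]] := div _ _ _ hp' hr' p'q r'q.
  exists (fun a => ev u a / ev v a); first exact: reg_frac hu hv vq.
  apply: near_sub (near_and (near_form hr' r'q) (near_and (near_form hv vq) (near_form hr Gq))).
  move=> a [r'a [va ra]]; rewrite hf // mulf_div; apply/eqP.
  by rewrite eqr_div ?mulf_neq0 // [ev r a * _]mulrC E [ev u a * _]mulrC.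
Qed.

Section Valuation.
Variables (q : pt C) (t : pt C -> L) (ht : uniformizer q t).

(** Evaluating at q, where t vanishes, isolates the constant term; then one
    factor t is cancelled. *)
Lemma uniformizer_poly_coef k (p : {poly L}) g : reg q g ->
  near q (fun a => p.[t a] + t a ^+ k * g a = 0) -> forall j, (j < k)%N -> p`_j = 0.
Proof.
case: ht => rt tq nt _ rg; elim: k p => [//|k IH] p H j.
pose p' := \poly_(i < size p) p`_i.+1.
have Ep : p = p' * 'X + (p`_0)%:P.
  apply/polyP => -[|i]; rewrite coefD coefMX coefC /= ?add0r // addr0 coef_poly.
  by case: ltnP => // h; rewrite nth_default // leqW.
have p0 : p`_0 = 0.
  by have := near_self H; rewrite tq expr0n /= mul0r addr0 horner_coef0.
rewrite p0 addr0 in Ep.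
case: j => [//|j] jk; rewrite Ep coefMX /=; apply: IH => //.
have R : reg q (fun a => p'.[t a] + t a ^+ k * g a).
  by apply: regD; [apply: reg_horner | apply: regM => //; apply: regX].
case: (reg_domain rt R) => //; apply: near_sub H => a.
by rewrite {1}Ep hornerMX exprS -mulrA mulrDr [t a * p'.[_]]mulrC.
Qed.

Definition val_decomposition f m : Prop :=
  exists g, [/\ reg q g, g q != 0 & near q (fun a => f a = t a ^+ m * g a)].

(** Krull's intersection theorem is replaced by algebraic dependence: f divides
    a nonzero polynomial e(t), so f cannot be divisible by all powers of t. *)
Lemma val_exists f : reg q f -> ~ near q (fun a => f a = 0) -> exists m, val_decomposition f m.
Proof.
move=> rf nf; apply: contrapT => H.
have [rt tq nt div] := ht.
have {H} H k : exists2 g, reg q g & near q (fun a => f a = t a ^+ k * g a).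
  elim: k => [|k [g rg hg]].
    by exists f => //; apply: near_all => a; rewrite expr0 mul1r.
  have [gq|gq] := eqVneq (g q) 0; last by case: H; exists k, g.
  have [g' rg' hg'] := div g rg gq; exists g' => //.
  by apply: near_sub (near_and hg hg') => a [-> ->]; rewrite exprSr mulrA.
have [d [p [r [hp hr rq hf]]]] := rf; have [d' [p' [r' [hp' hr' rq' ht']]]] := rt.
have [c c0 hc] := algebraic_dependence hp hr (nvanish_at rq) hp' hr' (nvanish_at rq').
have [e e0 he] := dependence_constant_term c0.
have [||||h rh hh] := he q f t => //.
  apply: near_sub (near_and (near_form hr rq) (near_form hr' rq')) => a [ra ra'].
  by rewrite hf // ht' // hc.
have [g rg hg] := H (size e).
have K : forall j, (j < size e)%N -> e`_j = 0.
  apply: (uniformizer_poly_coef (g := fun a => - (g a * h a))); first by apply: regN; apply: regM.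
  by apply: near_sub (near_and hg hh) => a [fE ->]; rewrite fE mulrN -mulrA subrr.
have se : (0 < size e)%N by rewrite lt0n size_poly_eq0.
by move: e0; rewrite -lead_coef_eq0 lead_coefE K ?eqxx // prednK.
Qed.

End Valuation.

End Germs.

(** * Formal power series *)

Section PowerSeries.
Variables (L : fieldType).

Definition eq_mod k (p r : {poly L}) := forall j, (j < k)%N -> p`_j = r`_j.

Lemma eq_modM k p p' r r' : eq_mod k p p' -> eq_mod k r r' -> eq_mod k (p * r) (p' * r').
Proof.
move=> hp hr j jk; rewrite !coefM; apply: eq_bigr => i _.
rewrite hp ?hr //; first by apply: leq_ltn_trans jk; apply: leq_subr.
by apply: leq_ltn_trans jk; rewrite -ltnS.
Qed.

Lemma eq_modX k p p' n : eq_mod k p p' -> eq_mod k (p ^+ n) (p' ^+ n).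
Proof. by move=> hp; elim: n => [//|n IH]; rewrite !exprS; apply: eq_modM. Qed.

Lemma eq_mod_mmap n k (h h' : 'I_n -> {poly L}) (p : {mpoly L[n]}) :
  (forall i, eq_mod k (h i) (h' i)) -> eq_mod k (mmap (@polyC L) h p) (mmap (@polyC L) h' p).
Proof.
move=> hh j jk; rewrite /mmap !coef_sum; apply: eq_bigr => m _.
apply: (@eq_modM k) => //; rewrite /mmap1.
by elim/big_ind2: _ => // [p1 p2 r1 r2|i _]; [exact: eq_modM | exact: eq_modX].
Qed.

Lemma horner_mmap n (h : 'I_n -> {poly L}) (p : {mpoly L[n]}) c :
  (mmap (@polyC L) h p).[c] = p.@[fun i => (h i).[c]].
Proof.
rewrite mevalE /mmap horner_sum; apply: eq_bigr => m _.
rewrite hornerM hornerC /mmap1 horner_prod; congr (_ * _).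
by apply: eq_bigr => i _; rewrite horner_exp.
Qed.

Definition trunc n (x : 'I_n -> nat -> L) k i : {poly L} := \poly_(j < k.+1) x i j.

(** The k-th coefficient of p(x(t)) only depends on the truncations at order k.
    The truncation grows with the coefficient that is read off, so that p(x(t)) is
    an infinite sequence although only polynomials are ever evaluated. *)
Definition ps_eval n (p : {mpoly L[n]}) (x : 'I_n -> nat -> L) (k : nat) : L :=
  (mmap (@polyC L) (trunc x k) p)`_k.

Definition ps_mul (a b : nat -> L) (k : nat) : L := \sum_(i < k.+1) a i * b (k - i)%N.

(** Truncating further than needed changes nothing; this makes the coefficients
    of different orders comparable. *)
Lemma ps_eval_trunc n (p : {mpoly L[n]}) x j k : (j <= k)%N ->
  (mmap (@polyC L) (trunc x k) p)`_j = ps_eval p x j.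
Proof.
move=> jk; apply: (@eq_mod_mmap _ j.+1); last exact: ltnSn.
move=> i l lj; rewrite !coef_poly lj (leq_trans lj) //.
Qed.

Lemma ps_evalM n (p r : {mpoly L[n]}) x : ps_eval (p * r) x =1 ps_mul (ps_eval p x) (ps_eval r x).
Proof.
move=> k; rewrite /ps_eval rmorphM coefM; apply: eq_bigr => i _.
by rewrite !ps_eval_trunc ?leq_subr // -ltnS.
Qed.

Lemma ps_evalD n (p r : {mpoly L[n]}) x k : ps_eval (p + r) x k = ps_eval p x k + ps_eval r x k.
Proof. by rewrite /ps_eval rmorphD coefD. Qed.

Lemma ps_evalB n (p r : {mpoly L[n]}) x k : ps_eval (p - r) x k = ps_eval p x k - ps_eval r x k.
Proof. by rewrite /ps_eval rmorphB coefB. Qed.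

Lemma ps_evalZ n c (p : {mpoly L[n]}) x k : ps_eval (c *: p) x k = c * ps_eval p x k.
Proof. by rewrite /ps_eval mmapZ coefCM. Qed.

Lemma ps_evalXU n i (x : 'I_n -> nat -> L) k : ps_eval 'X_i x k = x i k.
Proof. by rewrite /ps_eval mmapX mmap1U coef_poly ltnSn. Qed.

Lemma ps_eval0 n (p : {mpoly L[n]}) x : ps_eval p x 0 = p.@[fun i => x i 0%N].
Proof.
rewrite /ps_eval -horner_coef0 horner_mmap; apply: meval_eq => i.
by rewrite horner_coef0 coef_poly.
Qed.

Lemma ps_eval_subst n k (p : {mpoly L[n]}) (al : 'I_n -> {mpoly L[k]}) x :
  ps_eval (subst p al) x =1 ps_eval p (fun i => ps_eval (al i) x).
Proof.
move=> l; rewrite /ps_eval /subst.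
have -> : mmap (@polyC L) (trunc x l) (p \mPo [tuple al i | i < n])
   = mmap (@polyC L) (fun i => mmap (@polyC L) (trunc x l) (al i)) p.
  rewrite comp_mpolyEX raddf_sum; apply: eq_bigr => m _ /=.
  rewrite mmapZ comp_mpolyX rmorph_prod; congr (_ * _).
  by apply: eq_bigr => i _; rewrite rmorphXn tnth_mktuple.
apply: (@eq_mod_mmap _ l.+1 _ (trunc (fun i => ps_eval (al i) x) l)) (ltnSn l) => i j jl.
by rewrite [RHS]coef_poly jl ps_eval_trunc.
Qed.

Lemma ps_order_ext (a b : nat -> L) m : a =1 b -> ps_order a m -> ps_order b m.
Proof. by move=> ab [h k]; split=> [|i im]; rewrite -ab // k. Qed.

Lemma ps_order_uniq (a : nat -> L) m m' : ps_order a m -> ps_order a m' -> m = m'.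
Proof.
move=> [h k] [h' k']; case: (ltngtP m m') => // [/k'|/k] E.
  by rewrite E eqxx in h.
by rewrite E eqxx in h'.
Qed.

Lemma ps_order_mul (a b : nat -> L) m m' :
  ps_order a m -> ps_order b m' -> ps_order (ps_mul a b) (m + m').
Proof.
move=> [h k] [h' k']; split.
  have mm : (m < (m + m').+1)%N by rewrite ltnS leq_addr.
  rewrite /ps_mul (bigD1 (Ordinal mm)) //= big1 ?addr0 ?addKn ?mulf_neq0 //.
  move=> i; rewrite -val_eqE neq_ltn /= => /orP[/k->|mi]; first by rewrite mul0r.
  by rewrite k' ?mulr0 // ltn_subLR ?ltn_add2r // -ltnS.
move=> j jm; rewrite /ps_mul big1 // => i _.
case: (ltnP i m) => [/k->|mi]; first by rewrite mul0r.
rewrite k' ?mulr0 // ltn_subLR; last by rewrite -ltnS.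
by apply: leq_trans jm _; rewrite leq_add2r.
Qed.

Definition ps_ge (a : nat -> L) m := forall k, (k < m)%N -> a k = 0.

(** A sequence of coefficients may vanish identically, so its order is only
    searched below a given bound. *)
Lemma ps_ge_or (a : nat -> L) m : ps_ge a m \/ exists2 m', (m' < m)%N & ps_order a m'.
Proof.
elim: m => [|m [IH|[m' mm h]]]; first by left.
  have [am|am] := eqVneq (a m) 0; last by right; exists m.
  by left=> k; rewrite ltnS leq_eqVlt => /orP[/eqP->|/IH].
by right; exists m' => //; apply: ltnW.
Qed.

Lemma ps_ge_mull (a b : nat -> L) m : ps_ge a m -> ps_ge (ps_mul a b) m.
Proof.
move=> h k km; rewrite /ps_mul big1 // => i _.
by rewrite h ?mul0r //; apply: leq_ltn_trans km; rewrite -ltnS.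
Qed.

Lemma ps_ge_div (a b : nat -> L) m : ps_order b 0 -> ps_ge (ps_mul a b) m -> ps_ge a m.
Proof.
move=> hb h; case: (ps_ge_or a m) => // -[m' mm /ps_order_mul/(_ hb)].
by rewrite addn0 => -[]; rewrite h // eqxx.
Qed.

Lemma ps_order_div (a b : nat -> L) m :
  ps_order b 0 -> ps_order (ps_mul a b) m -> ps_order a m.
Proof.
move=> hb h; case: (ps_ge_or a m.+1) => [ha|[m' _ hm]].
  by case: h; rewrite (ps_ge_mull b ha) ?ltnS // eqxx.
by have := ps_order_mul hm hb; rewrite addn0 => /ps_order_uniq/(_ h) <-.
Qed.

End PowerSeries.

(** * Parametrisations at non-singular points *)

Section Parametrisations.
Variables (L : closedFieldType) (w : nat) (C : curve L w).
Implicit Types (p r : {mpoly L[w.+1]}) (q a b : pt C).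

Section OneParametrisation.
Variables (q : pt C) (x : 'I_w.+1 -> nat -> L) (hx : parametrisation q x).

Lemma ps_eval_vanish d p : p \is d.-homog -> vanish C p -> forall k, ps_eval p x k = 0.
Proof. by case: hx => _ h _ hp vp k; have := h d (mkform hp) vp k. Qed.

Lemma ps_eval_eq d p r : p \is d.-homog -> r \is d.-homog ->
  (forall a : pt C, ev p a = ev r a) -> ps_eval p x =1 ps_eval r x.
Proof.
move=> hp hr h k; apply/eqP; rewrite -subr_eq0 -ps_evalB; apply/eqP.
apply: (@ps_eval_vanish d); first by rewrite rpredB.
by move=> a; rewrite evB h subrr.
Qed.

Lemma ps_eval_at d p : p \is d.-homog -> (ps_eval p x 0 == 0) = (ev p q == 0).
Proof. by case: hx => h _ _ hp; rewrite ps_eval0 (same_point_homog hp h). Qed.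

Lemma ps_order_unit d p : p \is d.-homog -> ev p q != 0 -> ps_order (ps_eval p x) 0.
Proof. by move=> hp pq; split=> //; rewrite (ps_eval_at hp). Qed.

Lemma ps_order_exp p m k : ps_order (ps_eval p x) m -> ps_order (ps_eval (p ^+ k) x) (k * m).
Proof.
move=> h; elim: k => [|k IH].
  split=> //; rewrite ps_eval0 expr0 meval1 oner_neq0 //.
rewrite exprS mulSn; apply: (ps_order_ext (fun i => esym (ps_evalM _ _ _ i))).
exact: ps_order_mul.
Qed.

(** If p had order at least 2 along x, so would every linear form vanishing at q,
    being a multiple of p in the local ring; the velocity of x would then be
    proportional to its position. *)
Lemma ps_order_uniformizer d p r : p \is d.-homog -> r \is d.-homog ->
  ev p q = 0 -> ev r q != 0 -> uniformizer q (fun a => ev p a / ev r a) ->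
  ps_order (ps_eval p x) 1.
Proof.
move=> hp hr pq rq [rt tq nt div]; split; last first.
  by move=> [|//] _; apply/eqP; rewrite (ps_eval_at hp) pq.
apply/eqP => p1; have [hq _ hv] := hx; apply: hv.
have gep : ps_ge (ps_eval p x) 2.
  move=> [|[|//]] _ //; apply/eqP; rewrite (ps_eval_at hp) pq //.
have [i0 xi0] := coord_nz q; rewrite evXU in xi0.
have vel i : pcoords q i0 * x i 1%N = pcoords q i * x i0 1%N.
  pose l : {mpoly L[w.+1]} := pcoords q i0 *: 'X_i - pcoords q i *: 'X_i0.
  have hl : l \is 1.-homog by rewrite rpredB // rpredZ // homogX.
  have lq : ev l q = 0 by rewrite !evE mulrC subrr.
  have x0q : ev 'X_i0 q != 0 by rewrite evXU.
  have [||g [e [u [v [hu hv' vq gE]]]] tg] := div (fun a => ev l a / ev 'X_i0 a).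
  - by apply: reg_frac hl (homogX _ _) x0q.
  - by rewrite lq mul0r.
  have h1 : l * (r * v) \is (1 + (d + e)).-homog by do 2?apply: dhomogM.
  have h2 : p * (u * 'X_i0) \is (1 + (d + e)).-homog.
    rewrite addnC -addnA; do 2?[apply: dhomogM => //]; exact: homogX.
  have E : ps_eval (l * (r * v)) x =1 ps_eval (p * (u * 'X_i0)) x.
    apply: (ps_eval_eq h1 h2).
    apply: (generic_eq h1 h2); apply: (@near_generic _ _ _ q).
    apply: near_sub (near_and tg (near_and (near_form hv' vq)
                      (near_and (near_form hr rq) (near_form (homogX L i0) x0q)))).
    move=> a [ta [va [ra xa]]]; rewrite gE // mulf_div in ta.
    move/eqP: ta; rewrite eqr_div ?mulf_neq0 // -!evM => /eqP ->.
    by rewrite !evM mulrA.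
  have : ps_ge (ps_eval l x) 2.
    apply: (@ps_ge_div _ _ (ps_eval (r * v) x)).
      by apply: (ps_order_unit (dhomogM hr hv')); rewrite evM mulf_neq0.
    move=> k k2; rewrite -ps_evalM E ps_evalM; exact: (ps_ge_mull _ gep k2).
  move/(_ 1%N isT); rewrite ps_evalB !ps_evalZ !ps_evalXU => /eqP; rewrite subr_eq0 => /eqP.
  by [].
have [c [c0 hc]] := hq.
exists (x i0 1%N / (pcoords q i0 * c)) => i.
rewrite hc; apply: (mulfI xi0); rewrite vel.
by field; rewrite c0 xi0.
Qed.

(** The order along a parametrisation is the exponent of the uniformizer, for
    every parametrisation: the factorisation of p in the local ring becomes an
    identity of power series once denominators are cleared. *)
Lemma ps_order_val d p e u v i m : p \is d.-homog ->
  u \is e.-homog -> v \is e.-homog -> ev u q = 0 -> ev v q != 0 ->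
  uniformizer q (fun a => ev u a / ev v a) -> ev 'X_i q != 0 ->
  val_decomposition q (fun a => ev u a / ev v a) (fun a => ev p a / ev ('X_i ^+ d) a) m ->
  ps_order (ps_eval p x) m.
Proof.
move=> hp hu hv uq vq ht xq [g [[c [a1 [b1 [ha hb bq gE]]]] gq H]].
have aq : ev a1 q != 0 by move: gq; rewrite gE // mulf_eq0 negb_or => /andP[].
have h1 : p * (v ^+ m * b1) \is (d + (e * m + c)).-homog.
  by do 2?[apply: dhomogM => //]; apply: dhomogMn.
have h2 : u ^+ m * ('X_i ^+ d * a1) \is (d + (e * m + c)).-homog.
  rewrite addnCA; do 2?[apply: dhomogM => //]; [exact: dhomogMn | exact: homogXn].
have hxd := homogXn L i d.
have xdq : ev ('X_i ^+ d) q != 0 by rewrite evX expf_neq0.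
have E : ps_eval (p * (v ^+ m * b1)) x =1 ps_eval (u ^+ m * ('X_i ^+ d * a1)) x.
  apply: (ps_eval_eq h1 h2); apply: (generic_eq h1 h2); apply: (@near_generic _ _ _ q).
  apply: near_sub (near_and H (near_and (near_form hv vq) (near_and (near_form hb bq) (near_form hxd xdq)))).
  move=> a [pa [va [ba xa]]]; rewrite gE // expr_div_n mulf_div in pa.
  move/eqP: pa; rewrite eqr_div ?mulf_neq0 ?expf_neq0 // => /eqP pa.
  by rewrite !evM !(evX _ m) pa mulrAC mulrA.
apply: (@ps_order_div _ _ (ps_eval (v ^+ m * b1) x)).
  apply: (ps_order_unit (dhomogM (dhomogMn m hv) hb)).
  by rewrite evM evX mulf_neq0 ?expf_neq0.
apply: (@ps_order_ext _ (ps_eval (u ^+ m * ('X_i ^+ d * a1)) x)).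
  by move=> k; rewrite -ps_evalM E.
apply: (ps_order_ext (fun i => esym (ps_evalM _ _ _ i))).
rewrite -[X in ps_order _ X]addn0 -[X in (X + 0)%N]muln1; apply: ps_order_mul.
  by apply: ps_order_exp; apply: ps_order_uniformizer hu hv uq vq ht.
by apply: (ps_order_unit (dhomogM hxd ha)); rewrite evM mulf_neq0.
Qed.

End OneParametrisation.

(** The ratios X_i / X_i0 are expanded in powers of a uniformizer t. The
    expansion turns substitution of functions into substitution of power series
    modulo every power of t, so a form vanishing on C vanishes along it. *)
Lemma parametrisation_exists q : nonsingular_at q -> exists x, parametrisation q x.
Proof.
move=> /uniformizer_exists[d [F [G [hF hG Fq Gq]]]].
set t := (fun a => _) => ht; have [rt tq nt div] := ht.
(* nx f is the quotient of f - f(q) by t. *)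
have /choice[nx hnx] (f : pt C -> L) : exists g : pt C -> L,
    reg q f -> reg q g /\ near q (fun a => f a = f q + t a * g a).
  have [rf|nf] := EM (reg q f); last by exists f.
  have [||g rg hg] := div (fun a => f a - f q).
  - exact: regB rf (reg_const q _).
  - by rewrite subrr.
  exists g => _; split=> //; apply: near_sub hg => a <-.
  by rewrite addrC subrK.
pose it (f : pt C -> L) j := iter j nx f.
have reg_it f j : reg q f -> reg q (it f j).
  by move=> rf; elim: j => [//|j IH]; have [] := hnx _ IH.
have [i0 xi0] := coord_nz q.
pose f (i : 'I_w.+1) a := ev 'X_i a / ev 'X_i0 a.
have rf i : reg q (f i) by apply: reg_frac (homogX _ _) (homogX _ _) xi0.
pose x (i : 'I_w.+1) j := it (f i) j q.
have expand i k : near q (fun a => f i a = (\poly_(j < k) x i j).[t a] + t a ^+ k * it (f i) k a).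
  elim: k => [|k IH].
    by apply: near_all => a; rewrite poly_def big_ord0 horner0 expr0 mul1r add0r.
  have [_ H] := hnx _ (reg_it _ k (rf i)).
  apply: near_sub (near_and IH H) => a [-> ->].
  rewrite !poly_def big_ord_recr /= hornerD hornerZ hornerXn -addrA; congr (_ + _).
  by rewrite mulrDr exprSr mulrA mulrC.
have subst_expand (p : {mpoly L[w.+1]}) k : exists2 g, reg q g &
    near q (fun a => p.@[fun i => f i a] = (mmap (@polyC L) (trunc x k) p).[t a] + t a ^+ k.+1 * g a).
  pose Pr (p : {mpoly L[w.+1]}) := exists2 g, reg q g &
    near q (fun a => p.@[fun i => f i a] = (mmap (@polyC L) (trunc x k) p).[t a] + t a ^+ k.+1 * g a).
  have PC c : Pr c%:MP.
    exists (fun=> 0); first exact: reg_const.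
    by apply: near_all => a; rewrite mevalC mmapC hornerC mulr0 addr0.
  have PD p1 p2 : Pr p1 -> Pr p2 -> Pr (p1 + p2).
    move=> [g1 r1 h1] [g2 r2 h2]; exists (fun a => g1 a + g2 a); first exact: regD.
    apply: near_sub (near_and h1 h2) => a [E1 E2].
    by rewrite mevalD E1 E2 rmorphD hornerD mulrDr addrACA.
  have PM p1 p2 : Pr p1 -> Pr p2 -> Pr (p1 * p2).
    move=> [g1 r1 h1] [g2 r2 h2].
    pose z1 a := (mmap (@polyC L) (trunc x k) p1).[t a].
    pose z2 a := (mmap (@polyC L) (trunc x k) p2).[t a].
    exists (fun a => z1 a * g2 a + g1 a * z2 a + t a ^+ k.+1 * g1 a * g2 a).
      have rz1 := reg_horner (mmap (@polyC L) (trunc x k) p1) rt.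
      have rz2 := reg_horner (mmap (@polyC L) (trunc x k) p2) rt.
      apply: regD; first by apply: regD; apply: regM.
      by do 2?[apply: regM => //]; apply: regX.
    apply: near_sub (near_and h1 h2) => a [E1 E2].
    rewrite mevalM E1 E2 rmorphM hornerM -/(z1 a) -/(z2 a).
    by move: (t a ^+ k.+1) => T; ring.
  have PX i : Pr 'X_i.
    exists (it (f i) k.+1); first exact: reg_it.
    by apply: (near_sub _ (expand i k.+1)) => b Eb; rewrite mevalXU mmapX mmap1U.
  rewrite -/(Pr p); elim/mpolyind: p => [|c m p _ _ IH]; first by have := PC 0; rewrite mpolyC0.
  apply: (PD _ _ _ IH); rewrite -mul_mpolyC; apply: (PM) => //.
  rewrite mpolyXE_id; apply: (big_ind Pr) => [||i _]; [by have := PC 1; rewrite mpolyC1 | exact: PM |].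
  elim: (m i) => [|n IHn]; first by have := PC 1; rewrite mpolyC1.
  by rewrite exprS; apply: PM.
exists x; split.
- exists (ev 'X_i0 q)^-1; split; first by rewrite invr_eq0.
  by move=> i; rewrite /x /it /= /f evXU mulrC.
- move=> e P vP k; rewrite /pseval -/(trunc x k).
  have [g rg hg] := subst_expand (mpoly_of_dhomog P) k.
  apply: (uniformizer_poly_coef ht rg _ (ltnSn k)).
  apply: near_sub (near_and hg (near_form (homogX L i0) xi0)) => a [<- xa].
  rewrite (meval_eq _ (v2 := fun i => (ev 'X_i0 a)^-1 * pcoords a i)).
    rewrite (homog_meval_scale _ _ (hform_homog P)).
    by have := vP a; rewrite /feval => ->; rewrite mulr0.
  by move=> i; rewrite /f evXU mulrC.
- move=> [c hc].
  have c0 : c = 0.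
    have [rg hg] := hnx _ (rf i0).
    have fq : f i0 q = 1 by rewrite /f divff.
    have := hc i0; rewrite /x /it /= fq mulr1 => <-.
    case: (reg_domain rt rg) => // [|/near_self //].
    apply: near_sub (near_and hg (near_form (homogX L i0) xi0)) => a [].
    by rewrite fq {1}/f => + xa; rewrite divff // => /eqP; rewrite addrC -subr_eq subrr => /eqP <-.
  have [g rg hg] := subst_expand F 1%N.
  have tr i : trunc x 1 i = (x i 0%N)%:P.
    apply/polyP => -[|[|j]]; rewrite coef_poly coefC //=.
    by rewrite hc c0 mul0r.
  have xdq : ev ('X_i0 ^+ d) q != 0 by rewrite evX expf_neq0.
  have rh : reg q (fun a => ev G a / ev ('X_i0 ^+ d) a - t a * g a).
    by apply: regB; [apply: reg_frac (homogXn _ _ _) xdq | apply: regM].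
  case: (reg_domain rt rh) => [||/near_self] //; last first.
    rewrite tq mul0r subr0 => /eqP.
    by rewrite mulf_eq0 invr_eq0 (negbTE Gq) (negbTE xdq).
  apply: near_sub (near_and hg (near_and (near_form (homogX L i0) xi0) (near_form hG Gq))) => a [+ [xa Ga]].
  have -> : mmap (@polyC L) (trunc x 1) F = 0.
    have -> : mmap (@polyC L) (trunc x 1) F = (F.@[fun i => x i 0%N])%:P.
      rewrite /mmap mevalE rmorph_sum; apply: eq_bigr => m _.
      rewrite rmorphM rmorph_prod; congr (_ * _); apply: eq_bigr => i _.
      by rewrite tr rmorphXn.
    rewrite (meval_eq _ (v2 := fun i => (ev 'X_i0 q)^-1 * pcoords q i)).
      by rewrite (homog_meval_scale _ _ hF) -/(ev F q) Fq mulr0.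
    by move=> i; rewrite /x /it /= /f evXU mulrC.
  rewrite horner0 add0r (meval_eq _ (v2 := fun i => (ev 'X_i0 a)^-1 * pcoords a i)); last first.
    by move=> i; rewrite /f evXU mulrC.
  rewrite (homog_meval_scale _ _ hF) -/(ev F a) => E.
  rewrite mulrBr [t a * (t a * g a)]mulrA -[t a * t a]expr2 -E evX exprVn {1}/t.
  by rewrite mulrA divfK // mulrC subrr.
Qed.

End Parametrisations.

(** * Orders of forms at the points of a non-singular curve *)

Section Orders.
Variables (L : closedFieldType) (w : nat) (C : curve L w).
Implicit Types (p r : {mpoly L[w.+1]}) (q a b : pt C).

Definition has_ord q p m : Prop :=
  forall x, parametrisation q x -> ps_order (ps_eval p x) m.

(** The order along one, equivalently every, parametrisation at q. Forms
    vanishing on the whole curve, which have no order, get the value 0. *)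
Definition ord q p : nat :=
  if pselect (exists m, has_ord q p m) is left h then projT1 (cid h) else 0%N.

Lemma nvanish_near q d p r : p \is d.-homog -> r \is d.-homog -> ev r q != 0 ->
  ~ vanish C p -> ~ near q (fun a => ev p a / ev r a = 0).
Proof. by move=> hp hr rq np /(frac_near0 hp hr rq). Qed.

Hypothesis smooth : forall q : pt C, nonsingular_at q.

Lemma has_ord_exists q d p : p \is d.-homog -> ~ vanish C p -> exists m, has_ord q p m.
Proof.
move=> hp np; have [e [u [v [hu hv uq vq ht]]]] := uniformizer_exists (smooth q).
have [i xq] := coord_nz q.
have xdq : ev ('X_i ^+ d) q != 0 by rewrite evX expf_neq0.
have hxd := homogXn L i d.
have [m hm] := val_exists ht (reg_frac hp hxd xdq) (nvanish_near hp hxd xdq np).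
by exists m => x hx; apply: (ps_order_val hx hp hu hv uq vq ht xq hm).
Qed.

Lemma ord_spec q d p x : p \is d.-homog -> ~ vanish C p -> parametrisation q x ->
  ps_order (ps_eval p x) (ord q p).
Proof.
move=> hp np hx; rewrite /ord; case: pselect => [h|/(_ (has_ord_exists q hp np))//].
by case: (cid h) => m hm; apply: hm.
Qed.

Lemma ord_eqP q d p m : p \is d.-homog -> ~ vanish C p -> has_ord q p m -> ord q p = m.
Proof.
move=> hp np hm; have [x hx] := parametrisation_exists (smooth q).
exact: ps_order_uniq (ord_spec hp np hx) (hm x hx).
Qed.

(** The valuative form of divisibility in the local ring: an element of smaller
    order divides one of larger order, with denominators cleared. *)
Lemma ord_quotient q d p e r : p \is d.-homog -> r \is e.-homog ->
  ~ vanish C p -> ~ vanish C r -> (ord q r <= ord q p)%N ->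
  exists c u v, [/\ u \is (c + d)%N.-homog, v \is (c + e)%N.-homog, ev v q != 0 &
    forall a : pt C, ev p a * ev v a = ev u a * ev r a].
Proof.
move=> hp hr np nr.
have [e' [u' [v' [hu' hv' uq' vq' ht]]]] := uniformizer_exists (smooth q).
have [i xq] := coord_nz q.
have xkq k : ev ('X_i ^+ k) q != 0 by rewrite evX expf_neq0.
have hxk k := homogXn L i k.
have [m hm] := val_exists ht (reg_frac hp (hxk d) (xkq d)) (nvanish_near hp (hxk d) (xkq d) np).
have [n hn] := val_exists ht (reg_frac hr (hxk e) (xkq e)) (nvanish_near hr (hxk e) (xkq e) nr).
have -> : ord q p = m.
  by apply: (ord_eqP hp np) => y hy; apply: (ps_order_val hy hp hu' hv' uq' vq' ht xq hm).
have -> : ord q r = n.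
  by apply: (ord_eqP hr nr) => y hy; apply: (ps_order_val hy hr hu' hv' uq' vq' ht xq hn).
move=> nm; have [g [rg gq pE]] := hm; have [h [rh hq rE]] := hn.
pose t := fun a => ev u' a / ev v' a.
have rt : reg q t by apply: reg_frac hu' hv' vq'.
have [c [u [v [hu hv vq fE]]]] : reg q (fun a => t a ^+ (m - n) * g a * (h a)^-1).
  by apply: regM; [apply: regM => //; apply: regX | apply: regV].
have hu2 : u * 'X_i ^+ d \is (c + d).-homog by apply: dhomogM.
have hv2 : v * 'X_i ^+ e \is (c + e).-homog by apply: dhomogM.
exists c, (u * 'X_i ^+ d), (v * 'X_i ^+ e); split=> //; first by rewrite evM mulf_neq0.
have h1 : p * (v * 'X_i ^+ e) \is (d + (c + e)).-homog by apply: dhomogM.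
have h2 : (u * 'X_i ^+ d) * r \is (d + (c + e)).-homog by rewrite addnCA addnA; apply: dhomogM.
suff H : forall a : pt C, ev (p * (v * 'X_i ^+ e)) a = ev (u * 'X_i ^+ d * r) a.
  by move=> a; move: (H a); rewrite evM [ev (_ * r) a]evM.
apply: (generic_eq h1 h2); apply: (@near_generic _ _ _ q).
apply: near_sub (near_and pE (near_and rE (near_and (near_form hv vq)
                  (near_and (reg_neq0 rh hq) (near_form (homogX L i) xq))))).
move=> a [pa [ra [va [ha xa]]]]; rewrite -/(t a) in pa ra.
have xak k : ev ('X_i ^+ k) a != 0 by rewrite evX expf_neq0.
rewrite !evM.
have -> : ev p a = t a ^+ m * g a * ev ('X_i ^+ d) a by rewrite -pa divfK.
have -> : ev r a = t a ^+ n * h a * ev ('X_i ^+ e) a by rewrite -ra divfK.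
have -> : ev u a = t a ^+ (m - n) * g a * (h a)^-1 * ev v a by rewrite fE // divfK.
rewrite -{1}(subnK nm) exprD.
move: (t a ^+ _) (t a ^+ _) (ev ('X_i ^+ d) a) (ev ('X_i ^+ e) a) => T1 T2 X1 X2.
by field.
Qed.

Lemma ordM q d p e r : p \is d.-homog -> r \is e.-homog ->
  ~ vanish C p -> ~ vanish C r -> ord q (p * r) = (ord q p + ord q r)%N.
Proof.
move=> hp hr np nr.
apply: (ord_eqP (dhomogM hp hr) (nvanishM hp hr np nr)) => x hx.
apply: (ps_order_ext (fun k => esym (ps_evalM _ _ _ k))).
by apply: ps_order_mul; [exact: ord_spec hp np hx | exact: ord_spec hr nr hx].
Qed.

Lemma ord_one q : ord q 1 = 0%N.
Proof.
have n1 : ~ vanish C 1 by apply: (@nvanish_at _ _ _ _ q); rewrite ev1 oner_eq0.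
have h1 : (1 : {mpoly L[w.+1]}) \is 0.-homog by exact: dhomog1.
apply: (ord_eqP h1 n1) => x hx.
by apply: (ps_order_unit hx h1); rewrite ev1 oner_eq0.
Qed.

Lemma ordX q d p k : p \is d.-homog -> ~ vanish C p -> ord q (p ^+ k) = (k * ord q p)%N.
Proof.
move=> hp np; elim: k => [|k IH]; first by rewrite expr0 ord_one.
by rewrite exprS (ordM q hp (dhomogMn k hp)) ?IH ?mulSn //; apply: nvanishX hp np.
Qed.

Lemma ord_eq0 q d p : p \is d.-homog -> ~ vanish C p -> (ord q p == 0%N) = (ev p q != 0).
Proof.
move=> hp np; have [x hx] := parametrisation_exists (smooth q).
have H := ord_spec hp np hx; apply/idP/idP => [/eqP E|pq].
  by move: H; rewrite E -(ps_eval_at hx hp) => -[].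
by rewrite (ps_order_uniq H (ps_order_unit hx hp pq)).
Qed.

Lemma ord_unit q d p : p \is d.-homog -> ev p q != 0 -> ord q p = 0%N.
Proof. by move=> hp pq; apply/eqP; rewrite (ord_eq0 q hp) //; apply: nvanish_at pq. Qed.

Lemma eq_ord q d p r : p \is d.-homog -> r \is d.-homog -> ~ vanish C p ->
  (forall a : pt C, ev p a = ev r a) -> ord q p = ord q r.
Proof.
move=> hp hr np E; have nr : ~ vanish C r by move=> h; apply: np => a; rewrite E.
apply: (ord_eqP hp np) => x hx.
apply: (ps_order_ext (ps_eval_eq hx hr hp (fun a => esym (E a)))).
exact: ord_spec hr nr hx.
Qed.

Lemma ord_one_form q : exists d p, [/\ p \is d.-homog, ~ vanish C p & ord q p = 1%N].
Proof.
have [d [p [r [hp hr pq rq ht]]]] := uniformizer_exists (smooth q).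
have np : ~ vanish C p.
  by have [_ _ nt _] := ht; move=> V; apply: nt; apply: near_all => a; rewrite V mul0r.
exists d, p; split=> //; apply: (ord_eqP hp np) => x hx.
exact: (ps_order_uniformizer hx hp hr pq rq ht).
Qed.

Lemma ps_ge_ord q d p x m : p \is d.-homog -> ~ vanish C p -> parametrisation q x ->
  ps_ge (ps_eval p x) m <-> (m <= ord q p)%N.
Proof.
move=> hp np hx; have [h k] := ord_spec hp np hx; split=> [H|H i im]; last first.
  by apply: k; apply: leq_trans H.
by rewrite leqNgt; apply/negP => /H E; rewrite E eqxx in h.
Qed.

End Orders.

(** * The projective Nullstellensatz *)

Section Nullstellensatz.
Variables (L : closedFieldType) (w : nat).
Local Notation S := {mpoly L[w.+1]}.
Implicit Types (A B J M : nat * S -> Prop) (p r s : S).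

(** Elements carry their degree because the zero polynomial is homogeneous of
    every degree, which matters when the ideal is enlarged by multiples of a form. *)
Record graded_ideal A : Prop := GradedIdeal {
  gi_homog : forall d p, A (d, p) -> p \is d.-homog;
  gi_zero : forall d, A (d, 0);
  gi_add : forall d p r, A (d, p) -> A (d, r) -> A (d, p + r);
  gi_mul : forall d e p r, A (d, p) -> r \is e.-homog -> A ((e + d)%N, r * p) }.

Definition full A N : Prop := forall p, p \is N.-homog -> A (N, p).

Lemma gi_scale A d p c : graded_ideal A -> A (d, p) -> A (d, c *: p).
Proof. by move=> hA /(gi_mul hA)/(_ (homogC _ c)); rewrite mul_mpolyC. Qed.

Lemma gi_opp A d p : graded_ideal A -> A (d, p) -> A (d, - p).
Proof. by move=> hA /(gi_scale (-1) hA); rewrite scaleN1r. Qed.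

Lemma gi_sub A d p r : graded_ideal A -> A (d, p) -> A (d, r) -> A (d, p - r).
Proof. by move=> hA hp hr; apply: gi_add => //; apply: gi_opp. Qed.

Lemma gi_sum A d (I : eqType) (l : seq I) (F : I -> S) : graded_ideal A ->
  (forall i, i \in l -> A (d, F i)) -> A (d, \sum_(i <- l) F i).
Proof.
move=> hA hF; rewrite big_seq; elim/big_ind: _ => //; first exact: gi_zero.
exact: gi_add.
Qed.

Lemma full_monomials A N : graded_ideal A ->
  (forall m : 'X_{1..w.+1}, mdeg m = N -> A (N, 'X_[m])) -> full A N.
Proof.
move=> hA h p /dhomogP hp; rewrite (mpolyE p); apply: gi_sum => // m /hp mN.
by apply: gi_scale => //; apply: h.
Qed.

Lemma mnm_split (m : 'X_{1..w.+1}) N1 N2 : mdeg m = (N1 + N2)%N ->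
  exists m1 m2, [/\ m = (m1 + m2)%MM, mdeg m1 = N1 & mdeg m2 = N2].
Proof.
elim: N1 m => [|N1 IH] m hm.
  by exists 0%MM, m; rewrite add0m mdeg0.
have [i mi] : exists i, (0 < m i)%N.
  apply: contrapT => H; move: hm; rewrite mdegE big1 // => i _.
  by apply/eqP; rewrite -leqn0 leqNgt; apply/negP => k; apply: H; exists i.
have E : (m = U_(i) + (m - U_(i)))%MM by rewrite addmC submK // lep1mP -lt0n.
have [|m1 [m2 [E2 h1 h2]]] := IH (m - U_(i))%MM.
  by move: hm; rewrite {1}E mdegD mdeg1 addSn => -[].
by exists (U_(i) + m1)%MM, m2; rewrite -addmA -E2 -E mdegD mdeg1 h1.
Qed.

Lemma full_mul A N1 N2 : graded_ideal A ->
  (forall p r, p \is N1.-homog -> r \is N2.-homog -> A ((N1 + N2)%N, p * r)) ->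
  full A (N1 + N2).
Proof.
move=> hA h; apply: full_monomials => // m /mnm_split[m1 [m2 [-> h1 h2]]].
by rewrite mpolyXD; apply: h; rewrite dhomogX; apply/eqP.
Qed.

(** The forms of degree N generate all forms of higher degree. *)
Lemma full_leq A N N' : graded_ideal A -> full A N -> (N <= N')%N -> full A N'.
Proof.
move=> hA fA NN'; rewrite -(subnK NN'); apply: full_mul => // p r hp hr.
by apply: gi_mul => //; apply: fA.
Qed.

Definition adjoin_form A k (F : S) (z : nat * S) : Prop :=
  exists m r, [/\ A (z.1, m), z.2 = m + r * F &
    r = 0 \/ exists2 e, z.1 = (e + k)%N & (r \is e.-homog)].

Lemma adjoin_form_sub A k F z : A z -> adjoin_form A k F z.
Proof.
case: z => d p hp; exists p, 0; split=> //=; last by left.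
by rewrite mul0r addr0.
Qed.

Lemma adjoin_form_gen A k F : graded_ideal A -> adjoin_form A k F (k, F).
Proof.
move=> hA; exists 0, 1; split; [exact: gi_zero | by rewrite /= mul1r add0r |].
by right; exists 0%N => //; apply: dhomog1.
Qed.

Lemma adjoin_form_graded_ideal A k F : graded_ideal A -> F \is k.-homog -> graded_ideal (adjoin_form A k F).
Proof.
move=> hA hF; split.
- move=> d p [m [r [/= hm -> [->|[e Ed hr]]]]].
    by rewrite mul0r addr0; apply: gi_homog hm.
  by apply: rpredD; [exact: (gi_homog hA hm) | rewrite Ed; exact: dhomogM].
- by move=> d; apply: adjoin_form_sub; apply: gi_zero.
- move=> d p r [m1 [r1 [/= hm1 -> h1]]] [m2 [r2 [/= hm2 -> h2]]].
  exists (m1 + m2), (r1 + r2); split=> /=; first exact: gi_add.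
    by rewrite mulrDl addrACA.
  case: h1 => [->|[e1 E1 h1]]; first by rewrite add0r.
  case: h2 => [->|[e2 E2 h2]]; first by rewrite addr0; right; exists e1.
  right; exists e1 => //; apply: rpredD => //.
  by have /eqP := E2; rewrite E1 eqn_add2r => /eqP->.
- move=> d e p r [m1 [r1 [/= hm1 -> h1]]] hr.
  exists (r * m1), (r * r1); split=> /=; first exact: gi_mul.
    by rewrite mulrDr mulrA.
  case: h1 => [->|[e1 -> h1]]; first by left; rewrite mulr0.
  by right; exists (e + e1)%N; [rewrite addnA | exact: dhomogM].
Qed.

Definition proper_graded_ideal J A : Prop :=
  [/\ graded_ideal A, forall N, ~ full A N & forall z, J z -> A z].

(** The property of containing no full degree passes to unions of chains because
    the forms of degree N are spanned by finitely many monomials. The empty set is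
    admitted in the application of Zorn's lemma so that the union of the empty
    chain qualifies. *)
Lemma maximal_graded_ideal J : graded_ideal J -> (forall N, ~ full J N) ->
  exists M, proper_graded_ideal J M /\
    (forall B, proper_graded_ideal J B -> (forall z, M z -> B z) -> forall z, B z -> M z).
Proof.
move=> gJ nJ.
have pJ : proper_graded_ideal J J by [].
pose P (B : classical_sets.set (nat * S)) : Prop := (forall z, ~ B z) \/ proper_graded_ideal J B.
have [F FP Ftot|M [PM Mmax]] := @classical_sets.Zorn_bigcup _ P.
  have [[X FX [z0 Xz0]]|H] := EM (exists2 X, F X & exists z, X z); last first.
    by left=> z [X FX Xz]; apply: H; exists X => //; exists z.
  have good Y z : F Y -> Y z -> proper_graded_ideal J Y.
    by move=> /FP[h|//] /h.
  have gX := good _ _ FX Xz0.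
  have common Y1 Y2 : F Y1 -> F Y2 -> exists2 Y, F Y & (forall z, Y1 z -> Y z) /\ (forall z, Y2 z -> Y z).
    by move=> h1 h2; case: (Ftot _ _ h1 h2) => h; [exists Y2 | exists Y1].
  right; split.
  - split.
    + by move=> d p [Y FY Yz]; have [gY _ _] := good _ _ FY Yz; apply: (gi_homog gY).
    + by move=> d; exists X => //; have [gX' _ _] := gX; apply: gi_zero.
    + move=> d p r [Y1 FY1 Yz1] [Y2 FY2 Yz2].
      have [Y FY [h1 h2]] := common _ _ FY1 FY2; exists Y => //.
      have [gY _ _] := good _ _ FY (h1 _ Yz1).
      by apply: gi_add; [| exact: h1 | exact: h2].
    + move=> d e p r [Y FY Yz] hr; exists Y => //.
      by have [gY _ _] := good _ _ FY Yz; apply: gi_mul.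
  - move=> N fN.
    have [Y FY hY] : exists2 Y, F Y & forall m : 'X_{1..w.+1 < N.+1}, mdeg m = N -> Y (N, 'X_[m]).
      suff H (s : seq 'X_{1..w.+1 < N.+1}) : exists2 Y, F Y & forall m : 'X_{1..w.+1 < N.+1},
           m \in s -> mdeg m = N -> Y (N, 'X_[m]).
        have [Y FY hY] := H (enum {: 'X_{1..w.+1 < N.+1}}).
        by exists Y => // m; apply: hY; rewrite mem_enum.
      elim: s => [|m s [Y FY hY]]; first by exists X.
      have [mN|mN] := EM (mdeg m = N); last first.
        by exists Y => // m'; rewrite inE => /orP[/eqP->//|]; apply: hY.
      have hm : ('X_[m] : S) \is N.-homog by rewrite dhomogX; apply/eqP.
      have [Y' FY' Ym] := fN 'X_[m] hm.
      have [Z FZ [h1 h2]] := common _ _ FY FY'; exists Z => // m'.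
      rewrite inE => /orP[/eqP-> _|m's m'N]; first exact: h2.
      by apply: h1; apply: hY.
    have [[z Yz]|nY] := EM (exists z, Y z).
      have [gY nfY _] := good _ _ FY Yz; apply: (nfY N); apply: full_monomials => // m mN.
      have mN' : (mdeg m < N.+1)%N by rewrite mN.
      exact: (hY (BMultinom mN')).
    have [gX' _ _] := gX.
    apply: nY; exists (N, 'X_0 ^+ N).
    have mN : mdeg (U_(ord0) *+ N : 'X_{1..w.+1})%MM = N by rewrite mdegMn mdeg1 mul1n.
    have mN' : (mdeg (U_(ord0) *+ N : 'X_{1..w.+1})%MM < N.+1)%N by rewrite mN.
    by have := hY (BMultinom mN') mN; rewrite /= mpolyXn.
  - by move=> z Jz; exists X => //; have [_ _ h] := gX; apply: h.
have gM : proper_graded_ideal J M.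
  case: PM => // h; case: (Mmax J); last by right.
  split; first by move=> z /h.
  by move=> h'; apply: (h (0%N, 0)); apply: h'; apply: gi_zero.
exists M; split=> // B pB MB z Bz; apply: contrapT => Mz.
apply: (Mmax B); last by right.
by split=> // h; apply: Mz; apply: h.
Qed.

Lemma linear_dependence (V : vectType L) (v : nat -> V) :
  exists2 c : {poly L}, c != 0 & (size c <= (\dim {:V}).+1)%N /\
    \sum_(i < (\dim {:V}).+1) c`_i *: v i = 0.
Proof.
set D := \dim _.
pose X := [tuple v i | i < D.+1].
have /freeP nf : ~~ free X.
  apply/negP => /eqP E; have := dimvS (subvf <<X>>%VS).
  by rewrite E size_tuple ltnn.
have [k [hk nk]] : exists k : 'I_D.+1 -> L, \sum_i k i *: X`_i = 0 /\ ~ (forall i, k i = 0).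
  by apply: contrapT => H; apply: nf => k hk; apply: contrapT => h; apply: H; exists k.
exists (\poly_(i < D.+1) k (inord i)).
  apply/eqP => E; apply: nk => i; have := congr1 (fun c : {poly L} => c`_i) E.
  by rewrite coef_poly ltn_ord coef0 inord_val.
split; first exact: size_poly.
rewrite -[RHS]hk; apply: eq_bigr => i _.
by rewrite coef_poly ltn_ord inord_val -tnth_nth tnth_mktuple.
Qed.

Section Maximal.
Variables (J M : nat * S -> Prop) (gM : graded_ideal M) (nM : forall N, ~ full M N).
Hypothesis JM : forall z, J z -> M z.
Hypothesis maxM : forall B, proper_graded_ideal J B -> (forall z, M z -> B z) -> forall z, B z -> M z.

Lemma maximal_full k F : F \is k.-homog -> ~ M (k, F) -> exists N, full (adjoin_form M k F) N.
Proof.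
move=> hF nF; apply: contrapT => H; apply: nF; apply: (maxM (B := adjoin_form M k F)).
- split; first exact: adjoin_form_graded_ideal.
  + by move=> N fN; apply: H; exists N.
  + by move=> z /JM; apply: adjoin_form_sub.
- by move=> z; apply: adjoin_form_sub.
- exact: adjoin_form_gen.
Qed.

(** If neither factor lies in M, adjoining either one gives all forms of some
    degree; multiplying the two expressions gives a full degree of M itself. *)
Lemma maximal_prime k b F G : F \is k.-homog -> G \is b.-homog ->
  M ((k + b)%N, F * G) -> M (k, F) \/ M (b, G).
Proof.
move=> hF hG hFG; have [?|nF] := EM (M (k, F)); first by left.
have [?|nG] := EM (M (b, G)); first by right.
have [[N1 f1] [N2 f2]] := (maximal_full hF nF, maximal_full hG nG).
case: (nM (N := N1 + N2)); apply: full_mul => // p r hp hr.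
have [m1 [r1 [/= hm1 Ep h1]]] := f1 _ hp; have [m2 [r2 [/= hm2 Er h2]]] := f2 _ hr.
have -> : p * r = (r * m1 + (r1 * F) * m2) + (r1 * r2) * (F * G).
  by rewrite Er {1}Ep; ring.
have hrF : r1 * F \is N1.-homog.
  by case: h1 => [->|[e -> h]]; [rewrite mul0r; exact: dhomog0 | exact: dhomogM].
apply: gi_add => //; first apply: gi_add => //.
- by rewrite addnC; apply: gi_mul.
- exact: gi_mul.
case: h1 => [->|[e1 E1 h1]]; first by rewrite !mul0r; apply: gi_zero.
case: h2 => [->|[e2 E2 h2]]; first by rewrite mulr0 !mul0r; apply: gi_zero.
by rewrite E1 E2 addnACA; apply: gi_mul => //; apply: dhomogM.
Qed.

Lemma maximal_one : ~ M (0%N, 1).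
Proof.
move=> h; apply: (nM (N := 0)); apply: full_monomials => // m /eqP.
by rewrite mdeg_eq0 => /eqP->; rewrite mpolyX0.
Qed.

Lemma maximal_exp F k : F \is 1.-homog -> M (k, F ^+ k) -> M (1%N, F).
Proof.
move=> hF; elim: k => [/maximal_one //|k IH]; rewrite exprS => h.
have hFk : F ^+ k \is k.-homog by have := dhomogMn k hF; rewrite mul1n.
by case: (maximal_prime (k := 1) hF hFk h).
Qed.

Variables (l y : S) (hl : l \is 1.-homog) (nl : ~ M (1%N, l)) (hy : y \is 1.-homog).

(** The homogenisation of c in the linear forms l and y, of degree D. *)
Definition binary D (c : {poly L}) : S := \sum_(k < D.+1) c`_k *: (l ^+ (D - k) * y ^+ k).

Lemma binary_lift D (c : {poly L}) : (size c <= D.+1)%N -> binary D.+1 c = l * binary D c.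
Proof.
move=> sc; rewrite /binary big_ord_recr /= nth_default // scale0r addr0 mulr_sumr.
by apply: eq_bigr => k _; rewrite -scalerAr mulrA -exprS subSn // -ltnS.
Qed.

Lemma binary_mulX D c : binary D.+1 ('X * c) = y * binary D c.
Proof.
rewrite /binary big_ord_recl coefXM /= scale0r add0r mulr_sumr.
apply: eq_bigr => k _; rewrite coefXM /= subSS -scalerAr exprS.
by rewrite mulrCA.
Qed.

Lemma binary_sub D c c' : binary D (c - c') = binary D c - binary D c'.
Proof.
by rewrite /binary -sumrB; apply: eq_bigr => k _; rewrite coefB scalerBl.
Qed.

Lemma binary_scale D x c : binary D (x *: c) = x *: binary D c.
Proof.
by rewrite /binary scaler_sumr; apply: eq_bigr => k _; rewrite coefZ scalerA.
Qed.

Lemma homog_pow (F : S) k : F \is 1.-homog -> F ^+ k \is k.-homog.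
Proof. by move=> /(dhomogMn k); rewrite mul1n. Qed.

Lemma binary_homog D c : binary D c \is D.-homog.
Proof.
apply: rpred_sum => k _; apply: rpredZ.
have kD : (k <= D)%N by rewrite -ltnS.
by have := dhomogM (homog_pow (D - k) hl) (homog_pow k hy); rewrite subnK.
Qed.

(** Over an algebraically closed field a binary form is a product of linear
    forms, and one of them lies in the prime M. *)
Lemma binary_factor D (c : {poly L}) : c != 0 -> (size c <= D.+1)%N -> M (D, binary D c) ->
  exists x, M (1%N, y - x *: l).
Proof.
elim: D c => [|D IH] c c0 sc.
  rewrite /binary big_ord1 /= !expr0 mulr1 => /(gi_scale (c`_0)^-1 gM).
  rewrite scalerA mulVf ?scale1r => [/maximal_one//|].
  by move: c0; rewrite (size1_polyC sc) polyC_eq0 coefC eqxx.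
have [s1|/closed_rootP[x /factor_theorem[c' Ec]]] := eqVneq (size c) 1.
  have sc' : (size c <= D.+1)%N by rewrite s1.
  rewrite binary_lift // => h; apply: (IH c) => //.
  by case: (maximal_prime (k := 1) hl (binary_homog D c) h).
have c'0 : c' != 0 by apply: contraNneq c0 => E; rewrite Ec E mul0r.
have sc' : (size c' <= D.+1)%N.
  by move: sc; rewrite Ec size_Mmonic ?monicXsubC // size_XsubC addn2.
have -> : binary D.+1 c = (y - x *: l) * binary D c'.
  rewrite Ec mulrBr binary_sub -[c' * 'X]mulrC binary_mulX [c' * _]mulrC mul_polyC.
  by rewrite binary_scale binary_lift // mulrBl scalerAl.
have hyx : y - x *: l \is 1.-homog by rewrite rpredB // rpredZ.
move=> h; case: (maximal_prime (k := 1) hyx (binary_homog D c') h) => [h'|]; last exact: IH.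
by exists x.
Qed.

(** Modulo M, multiplication by l is onto in large degrees, so y / l acts on the
    forms of degree N. That space is finite-dimensional, so the iterates of a form
    t outside M satisfy a linear relation, that is, a binary form in l and y
    times t lies in M. *)
Lemma maximal_eigenvalue : exists x, M (1%N, y - x *: l).
Proof.
have [N fN] := maximal_full hl nl.
have fN1 := full_leq (adjoin_form_graded_ideal gM hl) fN (leqnSn N).
have [t0 [ht0 nt0]] : exists t0 : S, t0 \is N.-homog /\ ~ M (N, t0).
  apply: contrapT => H; apply: (nM (N := N)) => p hp; apply: contrapT => k.
  by apply: H; exists p.
have /choice[nx hnx] (t : S) : exists t' : S, t \is N.-homog ->
    t' \is N.-homog /\ M (N.+1, y * t - l * t').
  have [ht|nt] := EM (t \is N.-homog : Prop); last by exists t.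
  have hyt : y * t \is N.+1.-homog by apply: (dhomogM (d := 1)).
  have [m [r [/= hm E h]]] := fN1 _ hyt; exists r => _; split.
    case: h => [->|[e]]; first exact: dhomog0.
    by rewrite addn1 => -[->].
  by rewrite E [l * r]mulrC addrK.
pose t k := iter k nx t0.
have ht k : t k \is N.-homog.
  by elim: k => [//|k IH]; have [] := hnx _ IH.
have tM k : M ((k + N)%N, l ^+ k * t k - y ^+ k * t0).
  elim: k => [|k IH]; first by rewrite !expr0 !mul1r subrr; apply: gi_zero.
  have [_ h] := hnx _ (ht k); rewrite -/(t k.+1) in h.
  have -> : l ^+ k.+1 * t k.+1 - y ^+ k.+1 * t0 =
            y * (l ^+ k * t k - y ^+ k * t0) - l ^+ k * (y * t k - l * t k.+1).
    by rewrite !exprS; move: (l ^+ k) (y ^+ k) => lk yk; ring.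
  apply: gi_sub => //; first exact: (gi_mul (e := 1) gM).
  by rewrite addSnnS; apply: gi_mul => //; apply: homog_pow.
have [c c0 [sc Ec]] := linear_dependence (fun k => mkform (ht k)).
move: sc Ec; set D := \dim _ => sc Ec.
have {}Ec : \sum_(i < D.+1) c`_i *: t i = 0.
  have E := congr1 (@mpoly_of_dhomog _ _ _) Ec; rewrite raddf_sum raddf0 in E.
  rewrite -[RHS]E; apply: eq_bigr => i _; exact: (esym (linearZ_LR (@mpoly_of_dhomog _ _ _) (c`_i) (mkform (ht i)))).
apply: (binary_factor c0 sc).
have h : M ((D + N)%N, binary D c * t0).
  have -> : binary D c * t0 = - \sum_(k < D.+1) c`_k *: (l ^+ (D - k) * (l ^+ k * t k - y ^+ k * t0)).
    rewrite -sumrN /binary mulr_suml.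
    under [RHS]eq_bigr => k _ do rewrite mulrBr scalerBr opprB.
    have E0 : \sum_(k < D.+1) c`_k *: (l ^+ (D - k) * (l ^+ k * t k)) = 0.
      transitivity (l ^+ D * \sum_(i < D.+1) c`_i *: t i); last by rewrite Ec mulr0.
      rewrite mulr_sumr; apply: eq_bigr => k _.
      by rewrite mulrA -exprD subnK -?scalerAr // -ltnS.
    rewrite sumrB E0 subr0.
    by apply: eq_bigr => k _; rewrite -scalerAl mulrA.
  apply: gi_opp => //; apply: gi_sum => // k _; apply: gi_scale => //.
  have kD : (k <= D)%N by rewrite -ltnS.
  have := gi_mul gM (tM k) (homog_pow (D - k) hl); by rewrite addnA subnK.
by case: (maximal_prime (binary_homog D c) ht0 h).
Qed.

End Maximal.

(** Otherwise J lies in a maximal graded ideal M containing no full degree. Every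
    coordinate is congruent modulo M to a multiple v_j of a fixed coordinate
    X_i outside M, so a form p of degree d is congruent to p(v) X_i^d. Thus v is a
    common zero of M. *)
Theorem projective_nullstellensatz J : graded_ideal J ->
  (forall v : 'I_w.+1 -> L, (exists i, v i != 0) ->
     exists d p, J (d, p) /\ p.@[v] != 0) ->
  exists N, full J N.
Proof.
move=> gJ zJ; apply: contrapT => H.
have nJ N : ~ full J N by move=> h; apply: H; exists N.
have [M [[gM nM JM] maxM]] := maximal_graded_ideal gJ nJ.
have [i ni] : exists i : 'I_w.+1, ~ M (1%N, 'X_i).
  apply: contrapT => K; apply: (nM 1%N); apply: full_monomials => // m /eqP/mdeg1P[i /eqP->].
  by apply: contrapT => k; apply: K; exists i.
have hX := homogX L.
have /choice[v hv] j := maximal_eigenvalue gM nM JM maxM (hX _ i) ni (hX _ j).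
have vi : v i != 0.
  apply/eqP => E; apply: ni; have := hv i; by rewrite E scale0r subr0.
have red d (p : S) : p \is d.-homog -> M (d, p - p.@[v] *: 'X_i ^+ d).
  have mon (m : 'X_{1..w.+1}) : mdeg m = d -> M (d, 'X_[m] - ('X_[m] : S).@[v] *: 'X_i ^+ d).
    elim: d m => [|d IH] m.
      move=> /eqP; rewrite mdeg_eq0 => /eqP->; rewrite mpolyX0 meval1 scale1r expr0 subrr.
      exact: gi_zero.
    move/(@mnm_split m 1 d) => [m1 [m2 [-> /eqP/mdeg1P[j /eqP->] /IH h]]].
    have -> : 'X_[U_(j) + m2] - ('X_[U_(j) + m2] : S).@[v] *: 'X_i ^+ (1 + d) =
       'X_j * ('X_[m2] - ('X_[m2] : S).@[v] *: 'X_i ^+ d) +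
       (('X_[m2] : S).@[v] *: 'X_i ^+ d) * ('X_j - v j *: 'X_i).
      rewrite mpolyXD mevalM mevalXU add1n exprS -!mul_mpolyC mpolyCM.
      move: ('X_i ^+ d) => Xd; by ring.
    apply: gi_add => //; first exact: (gi_mul (e := 1) gM).
    rewrite -(addn1 d); apply: gi_mul => //; apply: rpredZ; exact: homogXn.
  move=> /dhomogP hp; have -> : p - p.@[v] *: 'X_i ^+ d =
     \sum_(m <- msupp p) p@_m *: ('X_[m] - ('X_[m] : S).@[v] *: 'X_i ^+ d).
    rewrite {1 2}(mpolyE p) raddf_sum scaler_suml -sumrB; apply: eq_bigr => m _ /=.
    by rewrite scalerBr mevalZ scalerA.
  by apply: gi_sum => // m mp; apply: gi_scale => //; apply: mon; apply: hp.
have [d [p [Jp pv]]] := zJ v (ex_intro _ i vi).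
have h := gi_sub gM (JM _ Jp) (red _ _ (gi_homog gJ Jp)).
have {}h : M (d, 'X_i ^+ d).
  have := gi_scale (p.@[v])^-1 gM h; rewrite subKr scalerA mulVf // scale1r.
  by [].
exact: ni (maximal_exp gM nM JM maxM (hX _ i) h).
Qed.

End Nullstellensatz.

(** * The degree of the divisor of a form *)

Section Bezout.
Variables (L : closedFieldType) (w : nat) (C : curve L w).
Local Notation S := {mpoly L[w.+1]}.
Implicit Types (p r : S) (q a b : pt C) (X : S -> Prop).

(** Dimensions are measured modulo the forms vanishing on C by counting
    independent families, so that no quotient space is needed. *)
Definition indep X m : Prop :=
  exists2 f : 'I_m -> S, forall i, X (f i) &
    forall c : 'I_m -> L, vanish C (\sum_i c i *: f i) -> forall i, c i = 0.

Lemma indep0 X : indep X 0.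
Proof. by exists (fun=> 0) => [[]|c _ []]. Qed.

Lemma indep_sub X X' m : (forall p, X p -> X' p) -> indep X m -> indep X' m.
Proof. by move=> h [f Xf hf]; exists f => // i; apply: h. Qed.

Definition forms k p : Prop := p \is k.-homog.

Lemma indep_bound k m : indep (forms k) m -> (m <= \dim {:hform L w k})%N.
Proof.
move=> [f hf ind]; pose X := [tuple mkform (hf i) | i < m].
suff fX : free X.
  by have := dimvS (subvf <<X>>%VS); rewrite (eqP fX) size_tuple.
apply/freeP => c Ec i; apply: ind => a.
have E : \sum_i c i *: f i = 0.
  have E := congr1 (@mpoly_of_dhomog _ _ _) Ec; rewrite raddf_sum raddf0 in E.
  rewrite -[RHS]E; apply: eq_bigr => j _.
  rewrite -tnth_nth tnth_mktuple.
  exact: (esym (linearZ_LR (@mpoly_of_dhomog _ _ _) (c j) (mkform (hf j)))).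
by rewrite E ev0.
Qed.

Lemma indep_mul X X' p d k m : p \is d.-homog -> ~ vanish C p ->
  (forall r, X r -> r \is k.-homog) -> (forall r, X r -> X' (p * r)) ->
  indep X m -> indep X' m.
Proof.
move=> hp np hX hXX' [f Xf ind]; exists (fun i => p * f i) => [i|c hc]; first exact: hXX'.
apply: ind.
have hs : \sum_i c i *: f i \is k.-homog.
  by apply: rpred_sum => i _; apply: rpredZ; apply: hX.
have H (a : pt C) : ev p a * ev (\sum_i c i *: f i) a = 0.
  rewrite -evM mulr_sumr -(hc a).
  by congr ev; apply: eq_bigr => i _; rewrite scalerAr.
by case: (vanish_domain hp hs H).
Qed.

Lemma indep_cons X X' k (lam : S -> L) p m :
  (forall c p', lam (c *: p') = c * lam p') ->
  (forall p1 p2, lam (p1 + p2) = lam p1 + lam p2) ->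
  (forall p', p' \is k.-homog -> vanish C p' -> lam p' = 0) ->
  (forall r, X' r -> r \is k.-homog) ->
  (forall r, X r -> X' r /\ lam r = 0) -> X' p -> lam p != 0 ->
  indep X m -> indep X' m.+1.
Proof.
move=> lZ lD lV hX' hX Xp lp [f Xf ind].
have l0 : lam 0 = 0 by rewrite -(scale0r p) lZ mul0r.
exists (fun i => if unlift ord0 i is Some j then f j else p) => [i|c].
  by case: unliftP => [j _|_] //; have [] := hX _ (Xf j).
rewrite big_ord_recl unlift_none => hc.
have E : \sum_(i < m) c (lift ord0 i) *: (if unlift ord0 (lift ord0 i) is Some j then f j else p)
   = \sum_(i < m) c (lift ord0 i) *: f i.
  by apply: eq_bigr => i _; rewrite liftK.
rewrite {}E in hc.
have c0 : c ord0 = 0.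
  have hs : c ord0 *: p + \sum_(i < m) c (lift ord0 i) *: f i \is k.-homog.
    apply: rpredD; first by apply: rpredZ; apply: hX'.
    by apply: rpred_sum => i _; apply: rpredZ; apply: hX'; have [] := hX _ (Xf i).
  have := lV _ hs hc; rewrite lD lZ.
  have -> : lam (\sum_(i < m) c (lift ord0 i) *: f i) = 0.
    elim/big_ind: _ => // [x y hx hy|i _]; first by rewrite lD hx hy addr0.
    by rewrite lZ; have [_ ->] := hX _ (Xf i); rewrite mulr0.
  by rewrite addr0 => /eqP; rewrite mulf_eq0 (negbTE lp) orbF => /eqP.
move: hc; rewrite c0 scale0r add0r => /ind h i.
by case: (unliftP ord0 i) => [j ->|->].
Qed.

(** The elements are corrected by multiples of one on which the functional does
    not vanish. If there is none, the division by zero makes the corrections 0. *)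
Lemma indep_kernel X X' (lam : S -> L) m :
  (forall c p', lam (c *: p') = c * lam p') ->
  (forall p1 p2, lam (p1 - p2) = lam p1 - lam p2) ->
  (forall r r' c, X r -> X r' -> lam (r - c *: r') = 0 -> X' (r - c *: r')) ->
  indep X m.+1 -> indep X' m.
Proof.
move=> lZ lB hX [f Xf ind].
have [i0 hi0] : exists i0, forall i, lam (f i) - lam (f i) / lam (f i0) * lam (f i0) = 0.
  have [[i0 h]|H] := EM (exists i0, lam (f i0) != 0).
    by exists i0 => i; rewrite divfK // subrr.
  exists ord0 => i; have [->|h] := eqVneq (lam (f i)) 0; first by rewrite !mul0r subrr.
  by case: H; exists i.
exists (fun j => f (lift i0 j) - (lam (f (lift i0 j)) / lam (f i0)) *: f i0) => [j|c hc i].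
  by apply: hX => //; rewrite lB lZ hi0.
pose c' i := if unlift i0 i is Some j then c j
             else - \sum_j c j * (lam (f (lift i0 j)) / lam (f i0)).
have := ind c' _ (lift i0 i); rewrite {2}/c' liftK; apply => a.
have -> : \sum_i c' i *: f i =
    \sum_j c j *: (f (lift i0 j) - (lam (f (lift i0 j)) / lam (f i0)) *: f i0).
  rewrite (bigD1_ord i0) //= /c' unlift_none scaleNr scaler_suml addrC -sumrB.
  by apply: eq_bigr => j _; rewrite liftK scalerBr scalerA.
exact: hc.
Qed.

Hypothesis smooth : forall q : pt C, nonsingular_at q.

(** Unlike a lower bound on ord, this condition is linear, and it holds for the
    forms vanishing on C. *)
Definition vanishes_to q n p : Prop := forall x, parametrisation q x -> ps_ge (ps_eval p x) n.

Lemma vanishes_to_ord q n d p : p \is d.-homog -> ~ vanish C p -> vanishes_to q n p <-> (n <= ord q p)%N.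
Proof.
move=> hp np; split=> [h|h x hx]; last exact/(ps_ge_ord smooth n hp np hx).
have [x hx] := parametrisation_exists (smooth q).
by apply/(ps_ge_ord smooth n hp np hx)/h.
Qed.

Lemma vanishes_to_vanish q n d p : p \is d.-homog -> vanish C p -> vanishes_to q n p.
Proof. by move=> hp vp x hx k _; apply: (ps_eval_vanish hx hp vp). Qed.

(** The points of s are counted with their multiplicities. *)
Definition passing k (s : seq (pt C)) p : Prop :=
  p \is k.-homog /\ forall q, vanishes_to q (count_mem q s) p.

Lemma passing_nil k p : passing k [::] p <-> forms k p.
Proof. by split=> [[]|hp] //; split=> // q x _ i. Qed.

Lemma passing_ord k s p : p \is k.-homog -> ~ vanish C p ->
  passing k s p <-> forall q, (count_mem q s <= ord q p)%N.
Proof.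
move=> hp np; split=> [[_ h] q|h]; first exact/(vanishes_to_ord _ _ hp np).
by split=> // q; exact/(vanishes_to_ord _ _ hp np).
Qed.

(** Passing through q once more is the vanishing of the next coefficient along
    one parametrisation at q. *)
Lemma indep_passing_cons k q s m : indep (passing k s) m.+1 -> indep (passing k (q :: s)) m.
Proof.
have [x hx] := parametrisation_exists (smooth q).
pose n := count_mem q s.
apply: (indep_kernel (lam := fun p => ps_eval p x n)) => [c p|p1 p2|r r' c [hr h] [hr' h'] E].
- by rewrite ps_evalZ.
- by rewrite ps_evalB.
have hrr : r - c *: r' \is k.-homog by rewrite rpredB // rpredZ.
split=> // q'; have hv : vanishes_to q' (count_mem q' s) (r - c *: r').
  by move=> y hy i im; rewrite ps_evalB ps_evalZ (h q' y hy i im) (h' q' y hy i im) mulr0 subr0.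
rewrite /=; have [qq|_] := eqVneq q q'; last by rewrite add0n.
have [V|nV] := EM (vanish C (r - c *: r')); first exact: vanishes_to_vanish hrr V.
subst q'; apply/(vanishes_to_ord _ _ hrr nV)/(ps_ge_ord smooth _ hrr nV hx) => i.
rewrite add1n ltnS leq_eqVlt => /orP[/eqP->//|im]; exact: hv.
Qed.

Lemma indep_passing k s m : indep (forms k) m -> indep (passing k s) (m - size s).
Proof.
elim: s => [|q s IH] h.
  by rewrite subn0; apply: indep_sub h => p; case: (passing_nil k p).
rewrite /= subnS; have := IH h; case: (m - size s)%N => [_|n]; first exact: indep0.
exact: indep_passing_cons.
Qed.

(** Each point of s different from q contributes a linear form vanishing there
    and not at q, each occurrence of q a form of order one at q; powers of a
    coordinate that is nonzero at q raise the degree. *)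
Lemma interpolation s q : exists k0, forall k, (k0 <= k)%N ->
  exists p, passing k s p /\ ~ vanishes_to q (count_mem q s).+1 p.
Proof.
suff [d [p [hp np pq hs]]] : exists d p, [/\ p \is d.-homog, ~ vanish C p,
    ord q p = count_mem q s & forall q', (count_mem q' s <= ord q' p)%N].
  have [i xi] := coord_nz q; have hX k := homogXn L i k.
  have nX k : ~ vanish C ('X_i ^+ k) by apply: (@nvanish_at _ _ _ _ q); rewrite evX expf_neq0.
  exists d => k dk; exists (p * 'X_i ^+ (k - d)).
  have h : p * 'X_i ^+ (k - d) \is k.-homog by have := dhomogM hp (hX (k - d)%N); rewrite subnKC.
  have nv := nvanishM hp (hX (k - d)%N) np (nX _).
  split.
    apply/(passing_ord _ h nv) => q'; rewrite (ordM smooth q' hp (hX _) np (nX _)).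
    exact: leq_trans (hs q') (leq_addr _ _).
  move/(vanishes_to_ord _ _ h nv); rewrite (ordM smooth q hp (hX _) np (nX _)) pq.
  rewrite (ord_unit smooth (hX _)) ?addn0 ?ltnn //.
  by rewrite evX expf_neq0.
elim: s => [|q' s [d [p [hp np pq hs]]]].
  have n1 : ~ vanish C 1 by apply: (@nvanish_at _ _ _ _ q); rewrite ev1 oner_eq0.
  exists 0%N, 1; split=> //; [exact: dhomog1 | by rewrite (ord_one smooth)].
have [e [r [hr nr r1 rq]]] : exists e r, [/\ r \is e.-homog, ~ vanish C r,
     (1 <= ord q' r)%N & ord q r = (q' == q)].
  have [<-|qq'] := eqVneq q' q.
    by have [e [r [hr nr r1]]] := ord_one_form smooth q'; exists e, r; split=> //; rewrite r1.
  have [r [hr rq' rq]] := separating_form (elimN eqP qq').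
  exists 1%N, r; split=> //; first exact: nvanish_at rq.
    by rewrite lt0n (ord_eq0 smooth q' hr (nvanish_at rq)) rq' eqxx.
  exact: (ord_unit smooth hr rq).
exists (e + d)%N, (r * p); split; [exact: dhomogM | exact: nvanishM hr hp nr np | |].
  by rewrite (ordM smooth q hr hp nr np) rq pq.
move=> q2; rewrite /= (ordM smooth q2 hr hp nr np); apply: leq_add => //.
by have [<-|_] := eqVneq q' q2.
Qed.

(** In large degree the points of s impose independent conditions: the forms
    given by interpolation are added one by one. *)
Lemma passing_dimension s : exists k0, forall k m, (k0 <= k)%N ->
  indep (passing k s) m -> indep (forms k) (size s + m).
Proof.
elim: s => [|q s [k0 IH]].
  by exists 0%N => k m _; apply: indep_sub => p; case: (passing_nil k p).
have [k1 H] := interpolation s q.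
exists (maxn k0 k1) => k m; rewrite geq_max => /andP[h0 h1] ind.
rewrite /= addSnnS; apply: IH => //.
have [p [ps pq]] := H k h1.
have [x hx] := parametrisation_exists (smooth q).
pose n := count_mem q s.
apply: (indep_cons (lam := fun p => ps_eval p x n) (p := p) (k := k) _ _ _ _ _ ps _ ind).
- by move=> c p'; rewrite ps_evalZ.
- by move=> p1 p2; rewrite ps_evalD.
- by move=> p' hp' vp'; apply: (ps_eval_vanish hx hp' vp').
- by move=> r [].
- move=> r [hr hv]; split.
    split=> // q' y hy i im; apply: (hv q' y hy i); apply: (leq_trans im); exact: leq_addl.
  by apply: (hv q x hx); rewrite /= eqxx.
apply/eqP => E; apply: pq => y hy.
have hp : p \is k.-homog by case: ps.
have [V|nV] := EM (vanish C p); first exact: vanishes_to_vanish hp V _ hy.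
apply/(ps_ge_ord smooth _ hp nV hy)/(ps_ge_ord smooth _ hp nV hx) => i.
rewrite ltnS leq_eqVlt => /orP[/eqP->//|im]; have [_ h] := ps; exact: (h q x hx i im).
Qed.

(** The quotient P / Q would be regular everywhere, of negative degree. By the
    Nullstellensatz every form f of some large degree satisfies f P = A Q with A a
    form of smaller degree, and f |-> A is injective; but the dimension of the
    space of forms strictly increases with the degree. *)
Lemma ord_no_larger_degree k d0 (P Q : S) : P \is k.-homog -> Q \is d0.-homog ->
  ~ vanish C P -> ~ vanish C Q -> (k < d0)%N ->
  (forall q, (ord q Q <= ord q P)%N) -> False.
Proof.
move=> hP hQ nP nQ kb le.
(* The denominators of P / Q. The disjunct A = 0 covers the degrees in which
   the quotient has no room. *)
pose J (z : nat * S) : Prop := z.2 \is z.1.-homog /\ exists A,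
  (A = 0 \/ exists2 e, (e + d0 = z.1 + k)%N & (A \is e.-homog)) /\
  forall a : pt C, ev z.2 a * ev P a = ev A a * ev Q a.
have gJ : graded_ideal J.
  split.
  - by move=> d p [].
  - move=> d; split; first exact: dhomog0.
    by exists 0; split; [left | move=> a; rewrite !ev0 !mul0r].
  - move=> d p r [/= hp [A1 [h1 E1]]] [/= hr [A2 [h2 E2]]]; split; first exact: rpredD.
    exists (A1 + A2); split; last by move=> a; rewrite /= !evD !mulrDl E1 E2.
    case: h1 => [->|[e1 e1E h1]]; first by rewrite add0r.
    case: h2 => [->|[e2 e2E h2]]; first by rewrite addr0; right; exists e1.
    right; exists e1 => //; apply: rpredD => //.
    by have /eqP := e1E; rewrite -e2E eqn_add2r => /eqP->.
  - move=> d e p r [/= hp [A1 [h1 E1]]] hr; split; first exact: dhomogM.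
    exists (r * A1); split; last by move=> a; rewrite /= !evM -!mulrA E1.
    case: h1 => [->|[e1 e1E h1]]; first by left; rewrite mulr0.
    by right; exists (e + e1)%N; [rewrite -addnA e1E addnA | exact: dhomogM].
have zJ (v : 'I_w.+1 -> L) : (exists i, v i != 0) -> exists d p, J (d, p) /\ p.@[v] != 0.
  move=> vn; have [[d [p [hp [vp pv]]]]|H] := EM (exists d p, p \is d.-homog /\ vanish C p /\ p.@[v] != 0).
    exists d, p; split=> //; split=> //; exists 0; split; first by left.
    by move=> a /=; rewrite vp ev0 !mul0r.
  have [|q vq] := @pt_of_vector _ _ C v vn.
    move=> d p hp vp; apply/eqP; apply: contrapT => /negP K; apply: H.
    by exists d, p.
  have [c [u [v' [hu hv' vq' E]]]] := ord_quotient smooth hP hQ nP nQ (le q).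
  exists (c + d0)%N, v'; split; last by rewrite (same_point_homog hv' vq).
  split=> //; exists u; split; last by move=> a; rewrite mulrC E.
  by right; exists (c + k)%N => //; rewrite addnAC.
have [N fN] := projective_nullstellensatz gJ zJ.
have [m hm nm] : exists2 m, indep (forms N) m & ~ indep (forms N) m.+1.
  have big : ~ indep (forms N) (\dim {:hform L w N}).+1 by move/indep_bound; rewrite ltnn.
  apply: contrapT => H; apply: big.
  elim: (_.+1) => [|n IH]; first exact: indep0.
  by apply: contrapT => K; apply: H; exists n.
apply: nm.
have [q _] := pt_ex C; have [b] := curve_infinite [:: q]; rewrite inE => /eqP bq.
have [l [hl lq lb]] := separating_form (nesym bq).
have [i xi] := coord_nz q.
(* l has a zero q on C, so a power of a coordinate nonzero at q is independent of
   the multiples of l. *)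
have step j : indep (forms (N + j.+1)) m.+1.
  elim: j => [|j IH].
    have hx1 := homogXn L i (N + 1).
    have hl' : indep (fun p => p \is (N + 1).-homog /\ ev p q = 0) m.
      apply: (indep_mul (k := N) hl (nvanish_at lb) _ _ hm) => // r hr; split.
        by rewrite addnC; apply: dhomogM.
      by rewrite evM lq mul0r.
    apply: (indep_cons (lam := fun p => ev p q) (p := 'X_i ^+ (N + 1)) (k := (N + 1)%N) _ _ _ _ _ _ _ hl').
    + by move=> c p; rewrite evZ.
    + by move=> p1 p2; rewrite evD.
    + by move=> p _ vp.
    + by [].
    + by [].
    + exact: hx1.
    + by rewrite evX expf_neq0.
  apply: (indep_mul (k := (N + j.+1)%N) hl (nvanish_at lb) _ _ IH) => // r hr.
  by have := dhomogM hl hr; rewrite addnCA add1n.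
have := step (d0 - k).-1; rewrite prednK ?subn_gt0 // => -[f hf ind].
have fN' : full J (N + (d0 - k)) by apply: full_leq fN _; rewrite ?leq_addr.
have /choice[A hA] j : exists A, A \is N.-homog /\ forall a : pt C, ev (f j) a * ev P a = ev A a * ev Q a.
  have [_ [A [h E]]] := fN' _ (hf j); exists A; split=> //.
  case: h => [->|[e /= eE hAe]]; first exact: dhomog0.
  suff -> : N = e by [].
  by lia.
exists A => [j|c hc]; first by have [] := hA j.
apply: ind.
have hs : \sum_j c j *: f j \is (N + (d0 - k)).-homog.
  by apply: rpred_sum => j _; apply: rpredZ; apply: hf.
have H (a : pt C) : ev P a * ev (\sum_j c j *: f j) a = 0.
  rewrite ev_sum mulr_sumr.
  transitivity (ev (\sum_j c j *: A j) a * ev Q a); last by rewrite hc mul0r.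
  rewrite ev_sum mulr_suml; apply: eq_bigr => j _.
  by have [_ E] := hA j; rewrite !evZ mulrCA [ev P a * _]mulrC E mulrA.
by case: (vanish_domain hP hs H).
Qed.

(** Multiplying by G and interpolating at its zeros shows that the dimension
    grows by at least size sG when the degree grows by k. Imposing on forms of
    degree m0 + j k the zeros of F^(j + m0 + 1) costs at most (j + m0 + 1) size sF
    and leaves nothing. Letting j grow compares the two sizes. *)
Lemma divisor_size_leq k (F G : S) (sF sG : seq (pt C)) :
  (0 < k)%N -> F \is k.-homog -> G \is k.-homog -> ~ vanish C F -> ~ vanish C G ->
  (forall q, count_mem q sF = ord q F) -> (forall q, count_mem q sG = ord q G) ->
  (size sG <= size sF)%N.
Proof.
move=> k0 hF hG nF nG EF EG.
have [m0 H] := passing_dimension sG.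
have lower j : indep (forms (m0 + j * k)) (j * size sG).
  elim: j => [|j IH]; first by rewrite mul0n; apply: indep0.
  have := H (m0 + j.+1 * k)%N (j * size sG)%N; rewrite mulSn; apply.
    exact: leq_addr.
  apply: (indep_mul (k := (m0 + j * k)%N) hG nG _ _ IH) => // r hr.
  have hGr : G * r \is (m0 + j.+1 * k).-homog by have := dhomogM hG hr; rewrite addnCA -mulSn.
  split=> // q; have [V|nr] := EM (vanish C r).
    by apply: (vanishes_to_vanish hGr) => a; rewrite evM V mulr0.
  apply/(vanishes_to_ord _ _ hGr (nvanishM hG hr nG nr)).
  by rewrite (ordM smooth q hG hr nG nr) EG leq_addr.
have upper j : (j * size sG <= (j + m0.+1) * size sF)%N.
  pose n := (j + m0.+1)%N; pose s := flatten (nseq n sF).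
  have ss : size s = (n * size sF)%N by rewrite /s size_flatten /shape map_nseq sumn_nseq mulnC.
  have cs q : count_mem q s = (n * ord q F)%N.
    by rewrite /s count_flatten map_nseq sumn_nseq EF mulnC.
  rewrite -/n -ss -subn_eq0; case E: (_ - _)%N => [//|m].
  have := indep_passing s (lower j); rewrite E => -[f hf ind].
  have V : vanish C (f ord0).
    apply: contrapT => nV; have [hf0 _] := hf ord0.
    apply: (ord_no_larger_degree (Q := F ^+ n) hf0 (dhomogMn n hF) nV (nvanishX hF nF)).
      by rewrite /n; nia.
    move=> q; rewrite (ordX smooth q n hF nF) -cs; move: q.
    exact/(passing_ord _ hf0 nV).
  have := ind (fun i => (i == ord0)%:R) _ ord0; rewrite eqxx => K.
  have /eqP[] := oner_neq0 L; apply: K => a.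
  rewrite (bigD1 ord0) //= big1 ?addr0 ?scale1r ?V // => i /negbTE->.
  by rewrite scale0r.
rewrite leqNgt; apply/negP => lt.
have := upper (m0.+1 * size sF).+1; move: lt; nia.
Qed.

Lemma homog0_ev p a b : p \is 0.-homog -> ev p a = ev p b.
Proof.
move=> hp; have h (v : 'I_w.+1 -> L) : p.@[v] = p.@[fun=> 0].
  have := homog_meval_scale 0 v hp; rewrite expr0 mul1r => <-.
  by apply: meval_eq => i; rewrite mul0r.
by rewrite /ev h [RHS]h.
Qed.

Theorem divisor_size k (F G : S) (sF sG : seq (pt C)) :
  F \is k.-homog -> G \is k.-homog -> ~ vanish C F -> ~ vanish C G ->
  (forall q, count_mem q sF = ord q F) -> (forall q, count_mem q sG = ord q G) ->
  size sF = size sG.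
Proof.
case: k => [|k] hF hG nF nG EF EG; last first.
  apply/eqP; rewrite eqn_leq.
  by rewrite (divisor_size_leq _ hG hF nG nF EG EF) // (divisor_size_leq _ hF hG nF nG EF EG).
have Z p s : p \is 0.-homog -> ~ vanish C p -> (forall q, count_mem q s = ord q p) -> size s = 0%N.
  move=> hp np; case: s => [//|q s] /(_ q) /=; rewrite eqxx (ord_unit smooth hp) //.
  by have [b pb] := nvanish_ex np; rewrite (homog0_ev q b hp).
by rewrite (Z F) // (Z G).
Qed.

End Bezout.

(** * Maps between curves *)

Section Maps.
Variables (L : closedFieldType) (w1 w2 : nat) (C1 : curve L w1) (C2 : curve L w2).
Implicit Types (f g : pt C1 -> pt C2).

Definition image_coords w k (C : curve L w) (al : 'I_k -> {mpoly L[w.+1]}) (a : pt C) : 'I_k -> L :=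
  fun i => ev (al i) a.

Lemma ev_subst w k (C : curve L w) (p : {mpoly L[k]}) (al : 'I_k -> {mpoly L[w.+1]}) (a : pt C) :
  ev (subst p al) a = p.@[image_coords al a].
Proof. exact: substE. Qed.

Definition maps d (al : 'I_w2.+1 -> {mpoly L[w1.+1]}) f : Prop :=
  (forall i, al i \is d.-homog) /\
  generic (fun a => same_point (image_coords al a) (pcoords (f a))).

(** Regularity with forms describing f near q only, a condition stable under
    composition; by continuity such forms describe f wherever they do not vanish
    together. *)
Definition map_regular f (q : pt C1) : Prop :=
  exists d al, [/\ forall i, al i \is d.-homog, exists i, ev (al i) q != 0 &
     near q (fun a => same_point (image_coords al a) (pcoords (f a)))].

Definition dominant f : Prop :=
  forall S : pt C2 -> Prop, generic S -> generic (fun a => S (f a)).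

Lemma generic_cross w k (C : curve L w) d e (al be : 'I_k -> {mpoly L[w.+1]}) :
  (forall i, al i \is d.-homog) -> (forall i, be i \is e.-homog) ->
  generic (fun a : pt C => same_point (image_coords al a) (image_coords be a)) ->
  forall i j (a : pt C), ev (al i) a * ev (be j) a = ev (al j) a * ev (be i) a.
Proof.
move=> hal hbe h i j a; rewrite -!evM; move: a.
apply: (@generic_eq _ _ _ (d + e)%N); try exact: dhomogM.
apply: generic_sub h => a h; rewrite !evM; exact: cross_same_point h.
Qed.

Lemma maps_cross d e al be f i j (a : pt C1) : maps d al f -> maps e be f ->
  ev (al i) a * ev (be j) a = ev (al j) a * ev (be i) a.
Proof.
move=> [hal h] [hbe h']; move: i j a; apply: (generic_cross hal hbe).
apply: generic_sub (generic_and h h') => a [h1 h2].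
exact: same_point_trans h1 (same_point_sym h2).
Qed.

(** Where f is regular, forms describing it generically describe it as soon as
    they do not vanish together: proportionality is a closed condition. *)
Lemma maps_map_regular d al f (a : pt C1) : maps d al f -> map_regular f a -> (exists i, ev (al i) a != 0) ->
  same_point (image_coords al a) (pcoords (f a)).
Proof.
move=> hal [e [be [hbe nbe h]]] nal.
apply: same_point_trans (near_self h); apply: same_point_cross => // i j.
by apply: maps_cross hal _; split=> //; apply: near_generic h.
Qed.

Lemma map_regular_maps f q : map_regular f q -> exists d al, maps d al f /\ exists i, ev (al i) q != 0.
Proof.
by move=> [d [al [hal nal h]]]; exists d, al; split=> //; split=> //; apply: near_generic h.
Qed.

Lemma map_regular_eq f g q : map_regular f q -> map_regular g q -> generic (fun a => f a = g a) -> f q = g q.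
Proof.
move=> rf [d [be [hbe nbe h]]] fg; apply: pt_inj.
apply: same_point_trans (near_self h); apply: same_point_sym.
apply: (maps_map_regular _ rf nbe); split=> //.
by apply: generic_sub (generic_and fg (near_generic h)) => a [->].
Qed.

Lemma maps_form d al f a e p : (forall i, al i \is d.-homog) -> p \is e.-homog ->
  same_point (image_coords al a) (pcoords (f a)) -> (ev (subst p al) a == 0) = (ev p (f a) == 0).
Proof. by move=> hal hp h; rewrite ev_subst (same_point_homog hp h). Qed.

Lemma maps_vanish d al f e p : maps d al f -> p \is e.-homog -> vanish C2 p ->
  vanish C1 (subst p al).
Proof.
move=> [hal h] hp vp; apply: (generic_vanish (homog_subst hp hal)).
apply: generic_sub h => a h; apply/eqP; by rewrite (maps_form hal hp h) vp.
Qed.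

Lemma maps_nvanish d al f e p : maps d al f -> dominant f -> p \is e.-homog -> ~ vanish C2 p ->
  ~ vanish C1 (subst p al).
Proof.
move=> [hal h] df hp np.
have [a [h1 h2]] := generic_ex (generic_and h (df _ (generic_form hp np))).
by apply: (@nvanish_at _ _ _ _ a); rewrite (maps_form hal hp h1).
Qed.

Lemma maps_nz d al f : maps d al f -> exists i, ~ vanish C1 (al i).
Proof.
move=> [hal h]; have [a ha] := generic_ex h.
by have [i hi] := same_point_nz ha (pcoords_nz (f a)); exists i; apply: nvanish_at hi.
Qed.

Lemma map_regular_generic f q d p : map_regular f q -> p \is d.-homog -> ev p (f q) != 0 ->
  near q (fun a => ev p (f a) != 0).
Proof.
move=> [e [al [hal nal h]]] hp pq.
have hs := homog_subst hp hal.
have sq : ev (subst p al) q != 0 by rewrite (maps_form hal hp (near_self h)).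
apply: near_sub (near_and h (near_form hs sq)) => a [h1].
by rewrite (maps_form hal hp h1).
Qed.

Lemma map_regular_near f q S : map_regular f q -> near (f q) S -> near q (fun a => S (f a)).
Proof.
move=> rf [d [p [hp pq h]]]; apply: near_sub (map_regular_generic rf hp pq) => a; exact: h.
Qed.

Lemma dominant_generic f : (forall S : pt C2 -> Prop, generic S -> exists q, S (f q) /\ map_regular f q) ->
  dominant f.
Proof.
move=> h S [d [p [hp np hS]]].
have [q [pq rq]] := h _ (generic_form hp np).
by apply: generic_sub (near_generic (map_regular_generic rq hp pq)) => a; apply: hS.
Qed.

Lemma ratmap_of_map_regular f : (forall q, map_regular f q) ->
  exists T : ratmap C1 C2, everywhere_defined T /\ rfun T = f.
Proof.
move=> rf.
have hd : dense_open (fun _ : pt C1 => True).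
  have [q _] := pt_ex C1; split; first by exists q.
  exists (fun e F => True) => a; split=> // _; have [i xi] := coord_nz a.
  by exists 1%N, (mkform (homogX L i)); split=> //; apply/eqP.
have hr a : True -> regular_at (fun _ => True) f a.
  move=> _; have [d [al [hal nal h]]] := rf a.
  exists d, (fun i => mkform (hal i)); split=> // b _ nb.
  by apply: (@maps_map_regular d al f b _ (rf b) nb); split=> //; apply: near_generic h.
by exists (Ratmap hd hr).
Qed.

Lemma dense_open_near (w : nat) (C : curve L w) (U : pt C -> Prop) a : dense_open U -> U a -> near a U.
Proof.
move=> [_ [S hS]] /hS[e [F [SF Fa]]].
exists e, (mpoly_of_dhomog F); split; [exact: hform_homog | exact/eqP |].
by move=> b Fb; apply/hS; exists e, F; split=> //; apply/eqP.
Qed.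

Lemma dense_open_generic (w : nat) (C : curve L w) (U : pt C -> Prop) : dense_open U -> generic U.
Proof. by move=> h; have [[a Ua] _] := h; apply: near_generic (dense_open_near h Ua). Qed.

Lemma generic_dense_open (w : nat) (C : curve L w) (S : pt C -> Prop) : generic S ->
  exists U, dense_open U /\ forall a, U a -> S a.
Proof.
move=> [d [p [hp np h]]]; exists (fun a => ev p a != 0); split=> //; split.
  exact: nvanish_ex.
exists (fun e F => mpoly_of_dhomog F = p) => a; split=> [pa|[e [F [SF Fa]]]].
  by exists d, (mkform hp); split=> //; apply/eqP.
by rewrite -SF; apply/eqP.
Qed.

Lemma ratmap_map_regular (Phi : ratmap C1 C2) a : dom Phi a -> map_regular Phi a.
Proof.
move=> da; have [d [psi [npsi h]]] := dom_regular da.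
exists d, (fun i => mpoly_of_dhomog (psi i)); split=> //.
  by move=> i; apply: hform_homog.
have [i hi] := npsi.
apply: near_sub (near_and (dense_open_near (dom_open Phi) da) (near_form (hform_homog (psi i)) hi)).
by move=> b [db pb]; apply: h => //; exists i.
Qed.

Lemma ratmap_generic (Phi : ratmap C1 C2) : generic (dom Phi).
Proof. exact: dense_open_generic (dom_open Phi). Qed.

Lemma ratmap_maps (Phi : ratmap C1 C2) : exists d al, maps d al Phi.
Proof.
have [a da] := generic_ex (ratmap_generic Phi).
by have [d [al [h _]]] := map_regular_maps (ratmap_map_regular da); exists d, al.
Qed.

End Maps.

(** A generic point b of C2 is the image of Psi b, so a form that is nonzero at
    b is nonzero at the image of a point, hence generically. *)
Lemma ratmap_dominant (L : closedFieldType) w1 w2 (C1 : curve L w1) (C2 : curve L w2)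
  (Phi : ratmap C1 C2) (Psi : ratmap C2 C1) : Defs.left_inverse Psi Phi -> dominant Phi.
Proof.
move=> [U [/dense_open_generic gU h]]; apply: dominant_generic => S gS.
have [b [Sb /h[_ dPhi E]]] := generic_ex (generic_and gS gU).
by exists (Psi b); split; [rewrite E | exact: ratmap_map_regular].
Qed.

Section Composition.
Variables (L : closedFieldType) (w1 w2 w3 : nat).
Variables (C1 : curve L w1) (C2 : curve L w2) (C3 : curve L w3).
Variables (f : pt C1 -> pt C2) (g : pt C2 -> pt C3).

Lemma same_point_comp d e (al : 'I_w2.+1 -> {mpoly L[w1.+1]}) (be : 'I_w3.+1 -> {mpoly L[w2.+1]}) a :
  (forall i, al i \is d.-homog) -> (forall i, be i \is e.-homog) ->
  same_point (image_coords al a) (pcoords (f a)) ->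
  same_point (image_coords be (f a)) (pcoords (g (f a))) ->
  same_point (image_coords (fun i => subst (be i) al) a) (pcoords (g (f a))).
Proof.
move=> hal hbe [c [c0 h1]] h2; apply: same_point_trans h2.
exists (c ^+ e); split; first by rewrite expf_neq0.
move=> i; rewrite /image_coords ev_subst (meval_eq _ h1).
exact: homog_meval_scale (hbe i).
Qed.

Lemma maps_comp d e al be : maps d al f -> dominant f -> maps e be g ->
  maps (e * d) (fun i => subst (be i) al) (fun a => g (f a)).
Proof.
move=> [hal h] df [hbe h']; split; first by move=> i; apply: homog_subst.
apply: generic_sub (generic_and h (df _ h')) => a [h1 h2].
exact: (same_point_comp hal hbe h1 h2).
Qed.

Lemma map_regular_comp q : map_regular f q -> map_regular g (f q) -> map_regular (fun a => g (f a)) q.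
Proof.
move=> rf [e [be [hbe [j nbe] h']]]; have [d [al [hal nal h]]] := rf.
exists (e * d)%N, (fun i => subst (be i) al); split.
- by move=> i; apply: homog_subst.
- by exists j; rewrite (maps_form hal (hbe j) (near_self h)).
apply: near_sub (near_and h (map_regular_near rf h')) => a [h1 h2].
exact: (same_point_comp hal hbe h1 h2).
Qed.

Lemma dominant_comp : dominant f -> dominant g -> dominant (fun a => g (f a)).
Proof. by move=> hf hg S /hg/hf. Qed.

End Composition.

(** * Rational maps on non-singular curves *)

Section Extension.
Variables (L : closedFieldType) (w1 w2 : nat) (D : curve L w1) (C : curve L w2).
Hypothesis smooth : forall q : pt D, nonsingular_at q.

(** In the discrete valuation ring at q the coordinate of least order divides all
    the others; a common denominator turns the quotients back into forms. *)
Lemma cancel_common_zeros d k (al : 'I_k -> {mpoly L[w1.+1]}) (q : pt D) :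
  (forall i, al i \is d.-homog) -> (exists i, ~ vanish D (al i)) ->
  exists e be, [/\ forall i, be i \is e.-homog, exists i, ev (be i) q != 0 &
    forall i j (a : pt D), ev (be i) a * ev (al j) a = ev (be j) a * ev (al i) a].
Proof.
move=> hal [i0 n0].
(* The coordinates that vanish on D are left out of the minimum. *)
have [j nj hj] : exists2 j, ~ vanish D (al j) &
    forall i, ~ vanish D (al i) -> (ord q (al j) <= ord q (al i))%N.
  have P0 : `[< ~ vanish D (al i0) >] by apply/asboolP.
  case: (@arg_minnP _ i0 (fun i => `[< ~ vanish D (al i) >]) (fun i => ord q (al i)) P0).
  by move=> j /asboolP nj h; exists j => // i /asboolP/h.
have /choice[z hz] i : exists z : nat * {mpoly L[w1.+1]} * {mpoly L[w1.+1]},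
    [/\ z.1.2 \is (z.1.1 + d).-homog, z.2 \is (z.1.1 + d).-homog, ev z.2 q != 0 &
     forall a : pt D, ev (al i) a * ev z.2 a = ev z.1.2 a * ev (al j) a].
  have [V|nV] := EM (vanish D (al i)).
    have [i1 xi] := coord_nz q.
    exists (0%N, 0, 'X_i1 ^+ d); split=> //=; first exact: dhomog0.
    - exact: homogXn.
    - by rewrite evX expf_neq0.
    - by move=> a; rewrite V ev0 !mul0r.
  have [c [u [v [hu hv vq E]]]] := ord_quotient smooth (hal i) (hal j) nV nj (hj i nV).
  by exists (c, u, v).
pose e i := ((z i).1.1 + d)%N.
pose be i := (z i).1.2 * \prod_(l < k | l != i) (z l).2.
pose B := \prod_(l < k) (z l).2.
have hu i : (z i).1.2 \is (e i).-homog by have [] := hz i.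
have hv i : (z i).2 \is (e i).-homog by have [] := hz i.
have hbe i : be i \is (\sum_(l < k) e l)%N.-homog.
  by rewrite (bigD1 i) //=; apply: dhomogM => //; apply: homog_prod.
have key i (a : pt D) : ev (be i) a * ev (al j) a = ev (al i) a * ev B a.
  have [_ _ _ E] := hz i.
  have -> : B = (z i).2 * \prod_(l < k | l != i) (z l).2 by rewrite /B (bigD1 i).
  by rewrite !evM mulrAC -E -!mulrA.
have hB : B \is (\sum_(l < k) e l)%N.-homog by apply: homog_prod.
clearbody be.
exists (\sum_(l < k) e l)%N, be; split=> //.
- exists j.
  have -> : ev (be j) q = ev B q.
    move: q {hj hz}; apply: (ev_cancel (hal j) nj (hbe j) hB) => a.
    by rewrite mulrC key.
  rewrite ev_prod prodf_seq_neq0; apply/allP => l _ /=.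
  by have [_ _ h _] := hz l.
- move=> i l a; rewrite -!evM; move: a.
  have h1 := dhomogM (hbe i) (hal l); have h2 := dhomogM (hbe l) (hal i).
  apply: (ev_cancel (hal j) nj h1 h2) => a; rewrite !evM.
  transitivity ((ev (be i) a * ev (al j) a) * ev (al l) a); first by ring.
  transitivity ((ev (be l) a * ev (al j) a) * ev (al i) a); last by ring.
  by rewrite !key; ring.
Qed.

(** The value at q is read off after cancelling the common zeros at q. It lies on
    C because the equations of C hold generically along the map, hence everywhere. *)
Lemma extend_rational d al (f0 : pt D -> pt C) : maps d al f0 ->
  exists T : pt D -> pt C, (forall q, map_regular T q) /\ generic (fun a => T a = f0 a).
Proof.
move=> mal; have [hal gal] := mal.
have /choice[T hT] (q : pt D) : exists b : pt C, exists e be,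
    [/\ maps e be f0, exists i, ev (be i) q != 0 & same_point (image_coords be q) (pcoords b)].
  have [e [be [hbe nbe cross]]] := cancel_common_zeros q hal (maps_nz mal).
  have mbe : maps e be f0.
    split=> //; have [j hj] := nbe.
    apply: generic_sub (generic_and gal (generic_form (hbe j) (nvanish_at hj))) => a [ga ba].
    apply: same_point_trans (ga); apply: same_point_cross; first by exists j.
      exact: same_point_nz ga (pcoords_nz _).
    by move=> i l; apply: cross.
  have [|b hb] := @pt_of_vector _ _ C (image_coords be q) nbe.
    by move=> k p hp vp; rewrite -ev_subst; apply: (maps_vanish mbe hp vp).
  by exists b, e, be.
have hTa a e be : maps e be f0 -> (exists i, ev (be i) a != 0) ->
    same_point (image_coords be a) (pcoords (T a)).
  move=> mbe nbe; have [e' [be' [mbe' nbe' h]]] := hT a.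
  apply: same_point_trans h; apply: same_point_cross => // i j.
  exact: maps_cross mbe mbe'.
exists T; split=> [q|].
  have [e [be [mbe [i hi] h]]] := hT q; have [hbe _] := mbe.
  exists e, be; split=> //; first by exists i.
  by apply: near_sub (near_form (hbe i) hi) => a ba; apply: (hTa _ _ _ mbe); exists i.
apply: generic_sub gal => a h; apply: pt_inj.
apply: same_point_trans (h); apply: same_point_sym; apply: (hTa _ _ _ mal).
exact: same_point_nz h (pcoords_nz _).
Qed.

(** Dehomogenising with the coordinate of index j, the two systems give the same
    affine coordinates; the factor al_j contributes its order once for each degree
    of p. *)
Lemma ord_subst_cross d e k m (al be : 'I_k -> {mpoly L[w1.+1]}) (p : {mpoly L[k]}) (q : pt D) j :
  (forall i, al i \is d.-homog) -> (forall i, be i \is e.-homog) -> p \is m.-homog ->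
  (forall i j (a : pt D), ev (al i) a * ev (be j) a = ev (al j) a * ev (be i) a) ->
  ev (be j) q != 0 -> ~ vanish D (al j) -> ~ vanish D (subst p al) -> ~ vanish D (subst p be) ->
  ord q (subst p al) = (m * ord q (al j) + ord q (subst p be))%N.
Proof.
move=> hal hbe hp cross bq nal nsal nsbe.
have hsa := homog_subst hp hal; have hsb := homog_subst hp hbe.
have nbe := nvanish_at bq.
have E (a : pt D) : ev (subst p al * be j ^+ m) a = ev (al j ^+ m * subst p be) a.
  rewrite !evM !evX !ev_subst mulrC -(homog_meval_scale _ _ hp) -(homog_meval_scale _ _ hp).
  by apply: meval_eq => i; rewrite /image_coords mulrC cross.
have h1 := dhomogM hsa (dhomogMn m (hbe j)).
have h2 := dhomogM (dhomogMn m (hal j)) hsb.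
have := @eq_ord _ _ _ smooth q _ _ _ h1 _ (nvanishM hsa (dhomogMn m (hbe j)) nsal (nvanishX (hbe j) nbe)) E.
rewrite (ordM smooth q hsa (dhomogMn m (hbe j)) nsal (nvanishX (hbe j) nbe)).
rewrite (ordM smooth q (dhomogMn m (hal j)) hsb (nvanishX (hal j) nal) nsbe).
rewrite (ordX smooth q m (hbe j) nbe) (ordX smooth q m (hal j) nal) (ord_unit smooth (hbe j) bq) muln0 addn0; apply.
by move: h2; have -> : (d * m + m * e)%N = (m * d + e * m)%N by nia.
Qed.

End Extension.

(** * Isomorphisms of non-singular curves *)

Section OrdRegular.
Variables (L : closedFieldType) (w1 w2 : nat) (D1 : curve L w1) (D2 : curve L w2).
Hypothesis smooth1 : forall q : pt D1, nonsingular_at q.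
Hypothesis smooth2 : forall q : pt D2, nonsingular_at q.

(** Every form p is, up to local units, the (ord p)-th power of a form F of
    order one, so the single number ord (F o f) determines the effect of f. *)
Lemma ord_ramification d al (f : pt D1 -> pt D2) q k F e p :
  maps d al f -> dominant f -> map_regular f q -> (exists i, ev (al i) q != 0) ->
  F \is k.-homog -> ~ vanish D2 F -> ord (f q) F = 1%N ->
  p \is e.-homog -> ~ vanish D2 p ->
  ord q (subst p al) = (ord (f q) p * ord q (subst F al))%N.
Proof.
move=> mal df rf nal hF nF F1 hp np; set m := ord (f q) p.
have hFm := dhomogMn m hF; have nFm := nvanishX (k := m) hF nF.
have oFm : ord (f q) (F ^+ m) = m by rewrite (ordX smooth2 _ m hF nF) F1 muln1.
have [|c [u [v [hu hv vq E]]]] := ord_quotient smooth2 hp hFm np nFm (q := f q).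
  by rewrite oFm.
have nv := nvanish_at vq.
have nu : ~ vanish D2 u.
  move=> V; apply: (nvanishM hp hv np nv) => a; by rewrite evM E V mul0r.
have hpv := dhomogM hp hv.
have huF : u * F ^+ m \is (e + (c + k * m)).-homog by rewrite addnCA addnA; apply: dhomogM.
have uq : ord (f q) u = 0%N.
  have := eq_ord smooth2 (f q) hpv huF (nvanishM hp hv np nv).
  rewrite (ordM smooth2 _ hp hv np nv) (ordM smooth2 _ hu hFm nu nFm) oFm.
  rewrite (ord_unit smooth2 hv vq) -/m addn0 => H.
  have : m = (ord (f q) u + m)%N by apply: H => a; rewrite !evM E.
  by lia.
have [hal _] := mal.
have sp := maps_map_regular mal rf nal.
have unit_sub s l : s \is l.-homog -> ~ vanish D2 s -> ord (f q) s = 0%N -> ord q (subst s al) = 0%N.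
  move=> hs ns /eqP; rewrite (ord_eq0 smooth2 _ hs ns) => sq.
  by apply: (ord_unit smooth1 (homog_subst hs hal)); rewrite (maps_form hal hs sp).
have Z : vanish D1 (subst (p * v - u * F ^+ m) al).
  apply: (maps_vanish mal (e := (e + (c + k * m))%N)); first by rewrite rpredB.
  by move=> a; rewrite evB !evM E subrr.
have [[[sp' sv] su] sF] := (homog_subst hp hal, homog_subst hv hal, homog_subst hu hal, homog_subst hF hal).
have nn := fun s l (hs : s \is l.-homog) ns => maps_nvanish mal df hs ns.
have n1 := nn _ _ hp np; have n2 := nn _ _ hv nv; have n3 := nn _ _ hu nu; have n4 := nn _ _ hF nF.
have h1 := dhomogM sp' sv; have h2 := dhomogM su (dhomogMn m sF).
have EE (a : pt D1) : ev (subst p al * subst v al) a = ev (subst u al * subst F al ^+ m) a.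
  have /eqP := Z a; rewrite ev_subst mevalB !mevalM rmorphXn /= subr_eq0 => /eqP.
  by rewrite !evM evX !ev_subst.
have dE : ((c + e) * d + k * d * m)%N = (e * d + (c + k * m) * d)%N by ring.
rewrite dE in h2.
have := eq_ord smooth1 q h1 h2 (nvanishM sp' sv n1 n2) EE.
rewrite (ordM smooth1 q sp' sv n1 n2) (ordM smooth1 q su (dhomogMn m sF) n3 (nvanishX sF n4)).
have vq0 : ord (f q) v = 0%N by apply: ord_unit hv vq.
by rewrite (ordX smooth1 q m sF n4) (unit_sub _ _ hu nu uq) (unit_sub _ _ hv nv vq0) addn0 add0n.
Qed.

End OrdRegular.

(** The ramification indices of T and of its inverse multiply to that of the
    identity, so both are 1. *)
Lemma ord_iso (L : closedFieldType) w1 w2 (D1 : curve L w1) (D2 : curve L w2)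
    (T : pt D1 -> pt D2) (T' : pt D2 -> pt D1) :
  (forall q : pt D1, nonsingular_at q) -> (forall q : pt D2, nonsingular_at q) ->
  (forall q, map_regular T q) -> (forall q, map_regular T' q) -> cancel T T' -> cancel T' T ->
  forall d al q e p, maps d al T -> (exists i, ev (al i) q != 0) ->
    p \is e.-homog -> ~ vanish D2 p -> ord q (subst p al) = ord (T q) p.
Proof.
move=> s1 s2 rT rT' TK T'K d al q e p mal nal hp np.
have dT : dominant T.
  by apply: dominant_generic => S /generic_ex[b Sb]; exists (T' b); rewrite T'K.
have dT' : dominant T'.
  by apply: dominant_generic => S /generic_ex[b Sb]; exists (T b); rewrite TK.
have [k [F [hF nF F1]]] := ord_one_form s2 (T q).
have [l [G [hG nG G1]]] := ord_one_form s1 q.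
rewrite (ord_ramification s1 s2 mal dT (rT q) nal hF nF F1 hp np).
have [d' [be [mbe nbe]]] := map_regular_maps (rT' (T q)).
have [hal _] := mal; have [hbe _] := mbe.
have E1 := ord_ramification s2 s1 mbe dT' (rT' (T q)) nbe hG nG.
rewrite TK in E1; have {}E1 := E1 _ _ G1 hG nG.
have hGb := homog_subst hG hbe; have nGb := maps_nvanish mbe dT' hG nG.
have E2 := ord_ramification s1 s2 mal dT (rT q) nal hF nF F1 hGb nGb.
rewrite E1 G1 mul1n in E2.
pose ga i := subst (be i) al.
have mga : maps (d' * d) ga (fun a : pt D1 => a).
  have [h1 h2] := maps_comp mal dT mbe; split; first exact: h1.
  by apply: generic_sub h2 => a; rewrite TK.
have [hga gga] := mga.
have spT := maps_map_regular mal (rT q) nal.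
have [j gj] : exists j, ev (ga j) q != 0.
  by have [j bj] := nbe; exists j; rewrite (maps_form hal (hbe j) spT).
pose X (i : 'I_w1.+1) : {mpoly L[w1.+1]} := 'X_i.
have hX i : X i \is 1.-homog by apply: homogX.
have cross : forall i j (a : pt D1), ev (ga i) a * ev (X j) a = ev (ga j) a * ev (X i) a.
  apply: (generic_cross hga hX).
  by apply: generic_sub gga => a [c [c0 h]]; exists c; split=> // i; rewrite h /image_coords evXU.
have xj : ev (X j) q != 0.
  have [i xi] := coord_nz q; apply/eqP => x0.
  have /eqP := cross j i q; rewrite x0 mulr0 => /esym/eqP; rewrite mulf_eq0 (negbTE gj) /= => h.
  by rewrite (negbTE xi) in h.
have GX (a : pt D1) : ev (subst G X) a = ev G a.
  by rewrite ev_subst; apply: meval_eq => i; rewrite /image_coords evXU.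
have nGX : ~ vanish D1 (subst G X) by move=> V; apply: nG => a; rewrite -GX.
have ngG : ~ vanish D1 (subst G ga) by apply: (maps_nvanish mga _ hG nG) => S.
have := ord_subst_cross s1 hga hX hG cross xj (nvanish_at gj) ngG nGX.
rewrite (ord_unit s1 (hga j) gj) muln0 add0n.
have hGX := homog_subst hG hX; rewrite muln1 in hGX.
rewrite (eq_ord s1 q hGX hG nGX GX) G1 => E3.
have E4 : ord q (subst G ga) = ord q (subst (subst G be) al).
  have hh := homog_subst hGb hal.
  apply: (eq_ord s1 q (homog_subst hG hga) _ ngG); first by rewrite mulnA.
  move=> a; rewrite !ev_subst substE; apply: meval_eq => i.
  by rewrite /image_coords /ga ev_subst.
rewrite E4 E2 in E3.
suff -> : ord q (subst F al) = 1%N by rewrite muln1.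
by apply/eqP; have /eqP := E3; rewrite muln_eq1 => /andP[].
Qed.

(** * Intersection multiplicities at branches *)

Section Models.
Variables (L : closedFieldType) (w : nat) (C : curve L w) (M : ns_model C).
Local Notation D := (ns_curve M).
Local Notation nu := (ns_map M).

Lemma model_map_regular (q : pt D) : map_regular nu q.
Proof. exact/ratmap_map_regular/ns_everywhere. Qed.

Lemma model_dominant : dominant nu.
Proof. by have [mu [_ h]] := ns_birational M; apply: ratmap_dominant h. Qed.

Lemma local_coords_exist (g : branch M) : exists al : 'I_w.+1 -> {mpoly L[(ns_dim M).+1]},
  exists d, maps d al nu /\ exists i, ev (al i) g != 0.
Proof. by have [d [al h]] := map_regular_maps (model_map_regular g); exists al, d. Qed.

Definition local_coords (g : branch M) := projT1 (cid (local_coords_exist g)).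

Lemma local_coordsP g : exists d, maps d (local_coords g) nu /\ exists i, ev (local_coords g i) g != 0.
Proof. exact: projT2 (cid (local_coords_exist g)). Qed.

Definition branch_mult (g : branch M) (p : {mpoly L[w.+1]}) : nat := ord g (subst p (local_coords g)).

Lemma ord_local d be g e p : maps d be nu -> (exists i, ev (be i) g != 0) ->
  p \is e.-homog -> ~ vanish C p -> ord g (subst p be) = branch_mult g p.
Proof.
move=> mbe nbe hp np; have [d' [mal nal]] := local_coordsP g.
have [hbe _] := mbe; have [hal _] := mal.
have [j aj] := nal.
have s := same_point_trans (maps_map_regular mbe (model_map_regular g) nbe)
            (same_point_sym (maps_map_regular mal (model_map_regular g) nal)).
have bj : ev (be j) g != 0 by have [c [c0 h]] := s; have := h j; rewrite /image_coords => ->; rewrite mulf_neq0.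
rewrite (ord_subst_cross (@ns_nonsingular _ _ _ M) hbe hal hp _ aj (nvanish_at bj)).
- by rewrite (ord_unit (@ns_nonsingular _ _ _ M) (hbe j) bj) muln0.
- by move=> i l a; apply: maps_cross mbe mal.
- exact: maps_nvanish mbe model_dominant hp np.
- exact: maps_nvanish mal model_dominant hp np.
Qed.

(** Every choice made in the definition of the intersection multiplicity, of the
    parametrisation and of the forms describing the map of the model, leads to the
    same order. *)
Lemma int_multE (g : branch M) e (phi : hform L w e) m :
  ~ vanish C (mpoly_of_dhomog phi) -> int_mult g phi m <-> m = branch_mult g (mpoly_of_dhomog phi).
Proof.
move=> np; have hp := hform_homog phi; set p := mpoly_of_dhomog phi in np hp *.
split=> [[y [[x [d [psi [hx npsi hd yE]]]] hy]]|->].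
  pose be i := mpoly_of_dhomog (psi i).
  have mbe : maps d be nu.
    split; first by move=> i; apply: hform_homog.
    have [j hj] := npsi.
    apply: generic_sub (generic_form (hform_homog (psi j)) (nvanish_at hj)) => a pa.
    by apply: hd; [exact: ns_everywhere | exists j].
  rewrite -(ord_local mbe npsi hp np).
  have yE' : y = fun i => ps_eval (be i) x by apply: funext => i; apply: funext => k; rewrite yE.
  have [hbe _] := mbe.
  apply: (ps_order_uniq (a := ps_eval (subst p be) x)).
    apply: ps_order_ext hy => k; rewrite ps_eval_subst -yE' //.
  exact: (ord_spec (@ns_nonsingular _ _ _ M) (homog_subst hp hbe) (maps_nvanish mbe model_dominant hp np) hx).
have [d [mal nal]] := local_coordsP g; have [hal _] := mal.
have [x hx] := parametrisation_exists (ns_nonsingular g).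
exists (fun i => ps_eval (local_coords g i) x); split.
  exists x, d, (fun i => mkform (hal i)); split=> // a _ na.
  exact: maps_map_regular mal (model_map_regular a) na.
apply: (ps_order_ext (a := ps_eval (subst p (local_coords g)) x)); first exact: ps_eval_subst.
exact: (ord_spec (@ns_nonsingular _ _ _ M) (homog_subst hp hal) (maps_nvanish mal model_dominant hp np) hx).
Qed.

Lemma cross_nvanish d e k (al be : 'I_k -> {mpoly L[(ns_dim M).+1]}) j :
  (forall i, al i \is d.-homog) -> (forall i, be i \is e.-homog) ->
  (forall i j (a : pt D), ev (al i) a * ev (be j) a = ev (al j) a * ev (be i) a) ->
  ~ vanish D (be j) -> (exists i, ~ vanish D (al i)) -> ~ vanish D (al j).
Proof.
move=> hal hbe cross nbe [i nai] V; apply: (nvanishM (hal i) (hbe j) nai nbe) => a.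
by rewrite evM cross V mul0r.
Qed.

(** A single system of forms describing the map of the model may vanish at some
    branches; the order gained there is proportional to the degree of p
    and otherwise independent of p. *)
Lemma mult_global d al : maps d al nu -> exists b0 : branch M -> nat,
  forall g e p, p \is e.-homog -> ~ vanish C p -> ord g (subst p al) = (e * b0 g + branch_mult g p)%N.
Proof.
move=> mal; have [hal _] := mal.
suff /choice[b0 hb0] (g : branch M) : exists n, forall e p,
    p \is e.-homog -> ~ vanish C p -> ord g (subst p al) = (e * n + branch_mult g p)%N.
  by exists b0.
have [d' [mbe [j bj]]] := local_coordsP g; have [hbe _] := mbe.
have cross := fun i j a => @maps_cross _ _ _ _ _ _ _ _ _ _ i j a mal mbe.
have nj := cross_nvanish hal hbe cross (nvanish_at bj) (maps_nz mal).
exists (ord g (al j)) => e p hp np.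
rewrite (ord_subst_cross (@ns_nonsingular _ _ _ M) hal hbe hp cross bj nj) //.
- exact: maps_nvanish mal model_dominant hp np.
- exact: maps_nvanish mbe model_dominant hp np.
Qed.

End Models.

Lemma seq_of_multiplicities (T : eqType) (h : T -> nat) (z : seq T) :
  (forall x, h x != 0%N -> x \in z) -> exists s, forall x, count_mem x s = h x.
Proof.
move=> hz; exists (flatten [seq nseq (h x) x | x <- undup z]) => x.
have [xz|xz] := boolP (x \in undup z); last first.
  rewrite (count_memPn _).
    by apply/esym/eqP; apply: contraNT xz => /hz; rewrite mem_undup.
  apply/negP => /flatten_mapP[y yz]; rewrite mem_nseq => /andP[_ /eqP E].
  by rewrite E yz in xz.
elim: (undup z) (undup_uniq z) xz => [//|y s IH] /= /andP[ys us].
rewrite inE count_cat count_nseq /= => /orP[/eqP E|xs].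
  subst y; rewrite eqxx mul1n (count_memPn _) ?addn0 //.
  apply/negP => /flatten_mapP[y ys']; rewrite mem_nseq => /andP[_ /eqP E].
  by rewrite E ys' in ys.
rewrite IH //; case: eqP => [E|_]; last by rewrite mul0n.
by rewrite E xs in ys.
Qed.

Section Cuts.
Variables (L : closedFieldType) (w : nat) (C : curve L w) (M : ns_model C).
Local Notation D := (ns_curve M).

Lemma ord_seq p d : p \is d.-homog -> ~ vanish D p ->
  exists s : seq (pt D), forall q, count_mem q s = ord q p.
Proof.
move=> hp np; have [z hz] := finite_zeros hp np.
apply: (seq_of_multiplicities (z := z)) => q.
by rewrite (ord_eq0 (@ns_nonsingular _ _ _ M) q hp np) negbK => /eqP/hz.
Qed.

Lemma finite_intersection_nvanish e (phi : hform L w e) :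
  finite_intersection C phi <-> ~ vanish C (mpoly_of_dhomog phi).
Proof.
split=> [[s hs] V|np]; last exact: finite_zeros (hform_homog phi) np.
by have [a] := curve_infinite s; rewrite hs //; apply: V.
Qed.

Lemma global_coords : exists d al, maps d al (ns_map M).
Proof. exact: ratmap_maps. Qed.

Lemma coordinate_nvanish : exists i, ~ vanish C ('X_i : {mpoly L[w.+1]}).
Proof. by have [a _] := pt_ex C; have [i h] := coord_nz a; exists i; apply: nvanish_at h. Qed.

Lemma mult_seq d p : p \is d.-homog -> ~ vanish C p ->
  exists s : seq (branch M), forall g, count_mem g s = branch_mult g p.
Proof.
move=> hp np; have [e [al mal]] := global_coords; have [hal _] := mal.
have [b0 hb] := mult_global mal.
have [s hs] := ord_seq (homog_subst hp hal) (maps_nvanish mal (@model_dominant _ _ _ M) hp np).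
apply: (seq_of_multiplicities (z := s)) => g hg.
rewrite -has_pred1 has_count hs (hb g _ _ hp np) addn_gt0; apply/orP; right.
by rewrite lt0n.
Qed.

Lemma cut_byE e (phi : hform L w e) (W : wset M) :
  cut_by phi W <-> ~ vanish C (mpoly_of_dhomog phi) /\
                   forall g, W g = branch_mult g (mpoly_of_dhomog phi).
Proof.
split=> [[/finite_intersection_nvanish np h]|[np h]].
  by split=> // g; apply/(int_multE _ _ np).
by split=> [|g]; [exact/finite_intersection_nvanish | apply/(int_multE _ _ np)].
Qed.

Lemma cut_by_exists e (phi : hform L w e) : ~ vanish C (mpoly_of_dhomog phi) ->
  exists W : wset M, cut_by phi W.
Proof.
move=> np; have [s hs] := mult_seq (hform_homog phi) np.
by exists (seq_mset s); apply/cut_byE; split=> // g; rewrite mset_seqE.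
Qed.

Lemma count_flatten_nseq (T : eqType) (s : seq T) k x :
  count_mem x (flatten (nseq k s)) = (k * count_mem x s)%N.
Proof. by rewrite count_flatten map_nseq sumn_nseq mulnC. Qed.

(** Pulled back to the model along globally defined coordinates, the two forms
    have divisors of equal size, and both divisors contain the base points of the
    coordinates e times. *)
Lemma cut_by_total e (phi phi' : hform L w e) (W W' : wset M) :
  cut_by phi W -> cut_by phi' W' -> total_mult W = total_mult W'.
Proof.
move=> /cut_byE[np hW] /cut_byE[np' hW'].
have [d [al mal]] := global_coords; have [hal _] := mal.
have [b0 hb] := mult_global mal.
have [i nXi] := coordinate_nvanish; have hXi := homogX L i.
have [z hz] := ord_seq (homog_subst hXi hal) (maps_nvanish mal (@model_dominant _ _ _ M) hXi nXi).
have [sb hsb] : exists s : seq (branch M), forall g, count_mem g s = b0 g.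
  apply: (seq_of_multiplicities (z := z)) => g hg.
  by rewrite -has_pred1 has_count hz (hb g _ _ hXi nXi) mul1n addn_gt0 lt0n hg.
have K (psi : hform L w e) (X : wset M) : ~ vanish C (mpoly_of_dhomog psi) ->
    (forall g, X g = branch_mult g (mpoly_of_dhomog psi)) ->
    forall g, count_mem g (flatten (nseq e sb) ++ enum_mset X) = ord g (subst (mpoly_of_dhomog psi) al).
  move=> nps hX g; rewrite count_cat count_flatten_nseq hsb (hb g _ _ (hform_homog psi) nps).
  by rewrite count_mem_mset hX.
have := divisor_size (@ns_nonsingular _ _ _ M)
  (homog_subst (hform_homog phi) hal) (homog_subst (hform_homog phi') hal)
  (maps_nvanish mal (@model_dominant _ _ _ M) (hform_homog phi) np)
  (maps_nvanish mal (@model_dominant _ _ _ M) (hform_homog phi') np') (K _ _ np hW) (K _ _ np' hW').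
by rewrite !size_cat => /addnI.
Qed.

End Cuts.

(** * Transport of linear systems *)

Section PullForm.
Variables (L : closedFieldType) (w1 w2 m : nat) (P : 'I_w2.+1 -> {mpoly L[w1.+1]}).
Hypothesis hP : forall i, P i \is m.-homog.
Variable e : nat.

Definition pull_form (phi : hform L w2 e) : hform L w1 (e * m) :=
  mkform (homog_subst (hform_homog phi) hP).

Lemma pull_form_is_linear : linear pull_form.
Proof.
move=> c u v; apply: val_inj.
have E (w d : nat) x (u1 v1 : hform L w d) : mpoly_of_dhomog (x *: u1 + v1) =
   x *: mpoly_of_dhomog u1 + mpoly_of_dhomog v1 by exact: (@mpoly_of_dhomog_is_linear w.+1 L d).
transitivity (subst (c *: mpoly_of_dhomog u + mpoly_of_dhomog v) P).
  by have Ee := E _ _ c u v; rewrite [LHS]/= -Ee.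
rewrite /subst comp_mpolyD comp_mpolyZ.
exact: esym (E _ _ c (pull_form u) (pull_form v)).
Qed.

HB.instance Definition _ := GRing.isLinear.Build L (hform L w2 e) (hform L w1 (e * m)) _
  pull_form pull_form_is_linear.

Definition pull : 'Hom(hform L w2 e, hform L w1 (e * m)) := linfun pull_form.

Lemma pullE phi : mpoly_of_dhomog (pull phi) = subst (mpoly_of_dhomog phi) P.
Proof. by rewrite lfunE. Qed.

End PullForm.

Arguments pull {L w1 w2 m P} hP {e}.

Section Transport.
Variables (L : closedFieldType) (w1 w2 : nat) (C1 : curve L w1) (C2 : curve L w2).
Variables (M1 : ns_model C1) (M2 : ns_model C2).
Local Notation D1 := (ns_curve M1).
Local Notation D2 := (ns_curve M2).
Variables (f : pt C1 -> pt C2) (T : pt D1 -> pt D2) (T' : pt D2 -> pt D1).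
Hypotheses (rT : forall q, map_regular T q) (rT' : forall q, map_regular T' q).
Hypotheses (TK : cancel T T') (T'K : cancel T' T).
Hypothesis liftT : generic (fun q => ns_map M2 (T q) = f (ns_map M1 q)).
Hypothesis df : dominant f.
Variables (m : nat) (P : 'I_w2.+1 -> {mpoly L[w1.+1]}) (mP : maps m P f).

Let hP : forall i, P i \is m.-homog. Proof. by case: mP. Qed.

Lemma iso_dominant : dominant T.
Proof. by apply: dominant_generic => S /generic_ex[b Sb]; exists (T' b); rewrite T'K. Qed.

Lemma pull_nvanish e p : p \is e.-homog -> ~ vanish C2 p <-> ~ vanish C1 (subst p P).
Proof.
move=> hp; split=> [np|h V]; first exact: maps_nvanish mP df hp np.
by apply: h; apply: maps_vanish mP hp V.
Qed.

(** At the branch g, the map Phi o nu_1 is described by the forms P(nu_1), which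
    may vanish together, and by the coordinates of nu_2 o Theta, which do not. The
    first system exceeds the second by a common factor of order B g. *)
Lemma transport_mult : exists B : branch M1 -> nat, forall g e p,
  p \is e.-homog -> ~ vanish C2 p ->
  branch_mult (M := M1) g (subst p P) = (e * B g + branch_mult (M := M2) (T g) p)%N.
Proof.
suff /choice[B hB] (g : branch M1) : exists n, forall e p, p \is e.-homog -> ~ vanish C2 p ->
    branch_mult (M := M1) g (subst p P) = (e * n + branch_mult (M := M2) (T g) p)%N.
  by exists B.
have [d1 [mbe [i1 be1]]] := local_coordsP (M := M1) g; set be := local_coords _ in mbe be1.
have [d2 [mbe2 [j2 be2n]]] := local_coordsP (M := M2) (T g); set be2 := local_coords _ in mbe2 be2n.
have [d3 [th [mth nth]]] := map_regular_maps (rT g).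
have [hbe _] := mbe; have [hbe2 _] := mbe2; have [hth _] := mth.
pose al i := subst (P i) be; pose ga i := subst (be2 i) th.
have mal : maps (m * d1) al (fun a => f (ns_map M1 a)) by apply: maps_comp mbe (@model_dominant _ _ _ M1) mP.
have mga : maps (d2 * d3) ga (fun a => f (ns_map M1 a)).
  have [h1 h2] := maps_comp mth iso_dominant mbe2; split; first exact: h1.
  by apply: generic_sub (generic_and h2 liftT) => a [h <-].
have [hal _] := mal; have [hga _] := mga.
have gj : ev (ga j2) g != 0.
  by rewrite (maps_form hth (hbe2 j2) (maps_map_regular mth (rT g) nth)).
have cross i j (a : pt D1) : ev (al i) a * ev (ga j) a = ev (al j) a * ev (ga i) a.
  exact: maps_cross mal mga.
have nj := cross_nvanish hal hga cross (nvanish_at gj) (maps_nz mal).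
have s1 := @ns_nonsingular _ _ _ M1; have s2 := @ns_nonsingular _ _ _ M2.
have dfn : dominant (fun a => f (ns_map M1 a)) by apply: dominant_comp df; apply: model_dominant.
exists (ord g (al j2)) => e p hp np.
have hpP := homog_subst hp hP.
have nal := maps_nvanish mal dfn hp np; have nga := maps_nvanish mga dfn hp np.
have E1 : branch_mult (M := M1) g (subst p P) = ord g (subst p al).
  apply: (eq_ord s1 g (homog_subst hpP hbe)).
  - by rewrite -mulnA; apply: homog_subst hp hal.
  - exact: maps_nvanish mbe (@model_dominant _ _ _ M1) hpP (maps_nvanish mP df hp np).
  - by move=> a; rewrite !ev_subst substE; apply: meval_eq => i; rewrite /image_coords /al ev_subst.
have hp2 := homog_subst hp hbe2; have np2 := maps_nvanish mbe2 (@model_dominant _ _ _ M2) hp np.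
have E2 : ord g (subst p ga) = branch_mult (M := M2) (T g) p.
  rewrite /branch_mult -(ord_iso s1 s2 rT rT' TK T'K mth nth hp2 np2).
  apply: (eq_ord s1 g (homog_subst hp hga) _ nga).
    by rewrite mulnA; apply: homog_subst hp2 hth.
  by move=> a; rewrite !ev_subst substE; apply: meval_eq => i; rewrite /image_coords /ga ev_subst.
by rewrite E1 (ord_subst_cross s1 hal hga hp cross gj nj nal nga) E2.
Qed.

Definition transport_wset (W : wset M2) : wset M1 := seq_mset (map T' (enum_mset W)).

Lemma transport_wsetE W g : transport_wset W g = W (T g).
Proof.
rewrite mset_seqE count_map -count_mem_mset; apply: eq_count => b /=.
by apply/eqP/eqP => [<-|->]; [rewrite T'K | rewrite TK].
Qed.

Lemma transport_wset_total W : total_mult (transport_wset W) = total_mult W.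
Proof.
by rewrite /total_mult (perm_size (perm_eq_seq_mset _)) size_map.
Qed.

(** The new linear system is the image of V under phi |-> phi(P), the new fixed
    part is e times the base contribution plus the pullback of W0. The subsystems spanning them
    correspond to each other after replacing a subspace by a complement of the
    kernel of the pullback, so the dimension r is the same. *)
Lemma is_gnr_transport n r (G : wset M2 -> Prop) (G1 : wset M1 -> Prop) :
  (forall W1, G1 W1 <-> exists2 W2, G W2 & forall g, W1 g = W2 (T g)) ->
  is_gnr n r G -> is_gnr n r G1.
Proof.
move=> hG1 [e [V [W0 [d [[phi0 phi0V fin0] [[V' sV'] minr] hW0 [[h [Wh [hWh dWh]]] hn] hG]]]]].
have [B hB] := transport_mult.
have [i0 nXi0] := coordinate_nvanish C2; have hXi0 := homogX L i0.
(* B has finite support: it is bounded by the multiplicity of a pulled back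
   coordinate. *)
have [sB hsB] : exists s : seq (branch M1), forall g, count_mem g s = B g.
  have [z hz] := mult_seq M1 (homog_subst hXi0 hP) (maps_nvanish mP df hXi0 nXi0).
  apply: (seq_of_multiplicities (z := z)) => g hg.
  by rewrite -has_pred1 has_count hz (hB g _ _ hXi0 nXi0) mul1n addn_gt0 lt0n hg.
pose base k : wset M1 := seq_mset (flatten (nseq k sB)).
have baseE k g : base k g = (k * B g)%N by rewrite mset_seqE count_flatten_nseq hsB.
pose lft k (W : wset M2) : wset M1 := (base k `+` transport_wset W)%mset.
have lftE k W g : lft k W g = (k * B g + W (T g))%N by rewrite msetE2 baseE transport_wsetE.
have total_lft k W : total_mult (lft k W) = (k * size sB + total_mult W)%N.
  have pe : perm_eq (enum_mset (lft k W)) (flatten (nseq k sB) ++ enum_mset (transport_wset W)).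
    apply/allP => g _ /=; rewrite count_cat !count_mem_mset lftE transport_wsetE.
    by rewrite count_flatten_nseq hsB.
  have := transport_wset_total W; rewrite /total_mult => tW.
  by rewrite (perm_size pe) size_cat tW size_flatten /shape map_nseq sumn_nseq mulnC.
have cut_lft k (phi : hform L w2 k) (W : wset M2) :
    cut_by phi W <-> cut_by (pull hP phi) (lft k W).
  have hp := hform_homog phi; split=> /cut_byE[np hW]; apply/cut_byE.
    rewrite pullE; split; first by apply/(pull_nvanish hp).
    by move=> g; rewrite (hB g _ _ hp np) lftE hW.
  rewrite pullE in np hW; have {}np : ~ vanish C2 (mpoly_of_dhomog phi) by apply/(pull_nvanish hp).
  split=> // g; have := hW (T' g); rewrite lftE (hB _ _ _ hp np) T'K.
  by move/addnI.
have cut_lift_ex k (phi : hform L w2 k) (W1 : wset M1) : cut_by (pull hP phi) W1 ->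
    exists2 W, cut_by phi W & W1 = lft k W.
  move=> cW1; have /cut_byE[np hW1] := cW1; have hp := hform_homog phi.
  rewrite pullE in np hW1; have {}np : ~ vanish C2 (mpoly_of_dhomog phi) by apply/(pull_nvanish hp).
  have [W cW] := cut_by_exists M2 np; exists W => //.
  apply/msetP => g; have /cut_byE[_ hW] := cW.
  by rewrite hW1 lftE hW (hB g _ _ hp np).
have series_lft k (U : {vspace hform L w2 k}) W1 :
    series (pull hP @: U)%VS W1 <-> exists2 W, series U W & W1 = lft k W.
  split=> [[psi /memv_imgP[phi phiU ->] /cut_lift_ex[W cW ->]]|[W [phi phiU cW] ->]].
    by exists W => //; exists phi.
  by exists (pull hP phi); [exact: memv_img | apply/cut_lft].
(* If the pullback shrank V', a complement of its kernel would span the series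
   with fewer dimensions, against the minimality of r. *)
have [s1 s2 s3] := sV'.
have rdim : \dim (pull hP @: V')%VS = r.+1.
  rewrite -s2; apply/eqP; rewrite eqn_leq; apply/andP; split.
    by have := limg_ker_dim (pull hP) V'; lia.
  pose K := (V' :&: lker (pull hP))%VS; pose U := (V' :\: K)%VS.
  have dU : \dim U = \dim (pull hP @: V')%VS.
    have := limg_ker_dim (pull hP) V'; have := dimv_cap_compl V' K.
    by rewrite -/U (capv_idPr (capvSl _ _)) /K; lia.
  have UV' : (U <= V')%VS by apply: diffvSl.
  have spanU (W : wset M2) : series V' W -> series U W.
    move=> [phi phiV' cW].
    have : phi \in (U + K)%VS.
      by rewrite addv_diff (addv_idPl (capvSl _ _)).
    case/memv_addP => phi1 h1 [phi2 h2 E]; exists phi1 => //.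
    move: h2; rewrite memv_cap memv_ker => /andP[_ /eqP k2].
    have pE : pull hP phi = pull hP phi1 by rewrite E linearD /= k2 addr0.
    by apply/cut_lft; rewrite -pE; apply/cut_lft.
  have [r' dU'] : exists r', \dim U = r'.+1.
    have [W0' cW0] := cut_by_exists M2 (proj1 (finite_intersection_nvanish _ _) fin0).
    have sW0 : series V W0' by exists phi0.
    have [phi1 h1 /cut_byE[nphi1 _]] := spanU _ (s3 _ sW0).
    exists (\dim U).-1; rewrite prednK // lt0n dimv_eq0; apply/eqP => U0.
    by move: h1; rewrite U0 memv0 => /eqP E; apply: nphi1 => a; rewrite E; apply: ev0.
  rewrite s2 -dU dU' ltnS; apply: (minr _ U); split=> //; first exact: subv_trans UV' s1.
  by move=> W /s3/spanU.
have [j0 nYj0] := coordinate_nvanish C1; have hYj0 := homogX L j0.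
pose h1 := mkform hYj0.
have [Wh1 cWh1] : exists W : wset M1, cut_by h1 W by apply: cut_by_exists.
pose W0' := lft e W0.
exists (e * m)%N, (pull hP @: V)%VS, W0', (total_mult Wh1); split.
- exists (pull hP phi0); first exact: memv_img.
  apply/finite_intersection_nvanish; rewrite pullE.
  by apply/(pull_nvanish (hform_homog phi0)); apply/finite_intersection_nvanish.
- split.
    exists (pull hP @: V')%VS; split=> //; first exact: limgS.
    by move=> W1 /series_lft[W /s3 sW ->]; apply/series_lft; exists W.
  move=> r' V1 [v1 v2 v3].
  pose U := (V :&: (pull hP @^-1: V1))%VS; pose K := (U :&: lker (pull hP))%VS.
  pose U' := (U :\: K)%VS.
  have imU : (pull hP @: U)%VS = V1.
    apply/eqP; rewrite eqEsubv; apply/andP; split; apply/subvP => x.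
      case/memv_imgP => u; rewrite memv_cap => /andP[_ hu] ->.
      by move: hu; rewrite -memv_preim.
    move=> xV1; have /memv_imgP[u uV E] := subvP v1 _ xV1.
    by rewrite E memv_img // memv_cap uV -memv_preim -E.
  have dU' : \dim U' = r'.+1.
    have := limg_ker_dim (pull hP) U; have := dimv_cap_compl U K.
    by rewrite -/U' (capv_idPr (capvSl _ _)) imU v2 /K; lia.
  apply: (minr r' U'); split=> //.
    by apply: subv_trans (diffvSl _ _) (capvSl _ _).
  move=> W sW.
  have [|psi psiV1 cpsi] := v3 (lft e W); first by apply/series_lft; exists W.
  move: psiV1; rewrite -imU => /memv_imgP[phi phiU E].
  have : phi \in (U' + K)%VS by rewrite addv_diff (addv_idPl (capvSl _ _)).
  case/memv_addP => phi1 hh1 [phi2 hh2 E2]; exists phi1 => //.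
  move: hh2; rewrite memv_cap memv_ker => /andP[_ /eqP k2].
  by apply/cut_lft; move: cpsi; rewrite E E2 linearD /= k2 addr0.
- move=> W1 /series_lft[W /hW0 /msubsetP sub ->]; apply/msubsetP => g.
  by rewrite !lftE leq_add2l.
- split; first by exists h1, Wh1.
  (* The pullback of the hyperplane h and the m-th power of the hyperplane h1
     have the same degree m. *)
  have hYm := homogXn L j0 m.
  have nYm := nvanishX (k := m) hYj0 nYj0.
  have cutm : exists2 W : wset M1, cut_by (mkform hYm) W & total_mult W = (m * total_mult Wh1)%N.
    exists (seq_mset (flatten (nseq m (enum_mset Wh1)))).
      apply/cut_byE; split=> // g; rewrite mset_seqE count_flatten_nseq count_mem_mset.
      have /cut_byE[_ ->] := cWh1; rewrite /=.
      have [d' [mbe nbe]] := local_coordsP (M := M1) g; have [hbe _] := mbe.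
      have s11 := @ns_nonsingular _ _ _ M1.
      have nsub := maps_nvanish mbe (@model_dominant _ _ _ M1) hYj0 nYj0.
      rewrite /branch_mult -(ordX s11 g m (homog_subst hYj0 hbe) nsub).
      apply: (eq_ord s11 g (dhomogMn m (homog_subst hYj0 hbe)) _ (nvanishX (homog_subst hYj0 hbe) nsub)).
        by rewrite mul1n mulnC; apply: homog_subst hYm hbe.
      by move=> a; rewrite evX !ev_subst rmorphXn.
    rewrite /total_mult (perm_size (perm_eq_seq_mset _)).
    by rewrite size_flatten /shape map_nseq sumn_nseq mulnC.
  have [Wm cWm tWm] := cutm.
  have cWh := proj1 (cut_lft _ _ _) hWh.
  have key : total_mult (lft 1 Wh) = total_mult Wm.
    move: cWh; move: (pull hP h); rewrite mul1n => psi cpsi.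
    exact: cut_by_total cpsi cWm.
  rewrite total_lft mul1n dWh tWm in key.
  rewrite total_lft; nia.
- move=> W1; split.
    move=> /hG1[W2 /hG[W [sW ->]] E]; exists (lft e W); split; first by apply/series_lft; exists W.
    by apply/msetP => g; rewrite E !msetE2 !baseE !transport_wsetE subnDl.
  move=> [W1' [/series_lft[W sW ->] ->]]; apply/hG1; exists (W `\` W0)%mset.
    by apply/hG; exists W.
  by move=> g; rewrite !msetE2 !baseE !transport_wsetE subnDl.
Qed.

End Transport.

(** * Lifting a birational map to the non-singular models *)

Lemma map_regular_id (L : closedFieldType) w (C : curve L w) (q : pt C) : map_regular (fun a : pt C => a) q.
Proof.
exists 1%N, (fun i => 'X_i); split; [exact: homogX | exact: coord_nz |].
apply: near_all => a; exists 1; split; first exact: oner_neq0.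
by move=> i; rewrite mul1r /image_coords evXU.
Qed.

Section Lifting.
Variables (L : closedFieldType) (w1 w2 : nat) (C1 : curve L w1) (C2 : curve L w2).
Variables (M1 : ns_model C1) (M2 : ns_model C2).
Local Notation D1 := (ns_curve M1).
Local Notation D2 := (ns_curve M2).

Definition generic_lift (Phi : ratmap C1 C2) (T : pt D1 -> pt D2) : Prop :=
  [/\ forall q, map_regular T q, dominant T &
      generic (fun q => ns_map M2 (T q) = Phi (ns_map M1 q))].

Lemma model_injective : exists mu : pt C2 -> pt D2, generic (fun q => mu (ns_map M2 q) = q).
Proof.
have [mu [[U [/dense_open_generic gU h]] _]] := ns_birational M2.
by exists mu; apply: generic_sub gU => q /h[].
Qed.

(** The composite of nu_1, Phi and the inverse of nu_2 is a rational map from a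
    non-singular curve. *)
Lemma generic_lift_exists (Phi : ratmap C1 C2) : dominant Phi -> exists T, generic_lift Phi T.
Proof.
move=> dPhi; have [mu [lnu lmu]] := ns_birational M2.
have dnu := @model_dominant _ _ _ M1.
have dmu := ratmap_dominant lnu.
have [d1 [al mal]] := ratmap_maps (ns_map M1).
have [d2 [be mbe]] := ratmap_maps Phi.
have [d3 [ga mga]] := ratmap_maps mu.
have dPnu := dominant_comp dnu dPhi.
have [T [rT gT]] := extend_rational (@ns_nonsingular _ _ _ M1)
                      (maps_comp (maps_comp mal dnu mbe) dPnu mga).
exists T; split=> //.
  move=> S /(dominant_comp dPnu dmu) gS.
  by apply: generic_sub (generic_and gT gS) => a [->].
have [U [/dense_open_generic gU hU]] := lmu.
by apply: generic_sub (generic_and gT (dPnu _ gU)) => a [-> /hU[]].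
Qed.

(** Two lifts agree generically because nu_2 is generically injective, and
    regular maps that agree generically agree. *)
Lemma generic_lift_unique (Phi : ratmap C1 C2) T1 T2 :
  generic_lift Phi T1 -> generic_lift Phi T2 -> T1 =1 T2.
Proof.
move=> [r1 d1 g1] [r2 d2 g2] q; apply: (map_regular_eq (r1 q) (r2 q)).
have [mu gmu] := model_injective.
apply: generic_sub (generic_and (generic_and g1 g2) (generic_and (d1 _ gmu) (d2 _ gmu))).
by move=> a [[E1 E2] [<- <-]]; rewrite E1 E2.
Qed.

Lemma lifts_generic_lift Phi (Theta : ratmap D1 D2) : lifts Phi Theta -> generic_lift Phi Theta.
Proof.
move=> [eT [Theta' [eT' TK T'K]] [U [/dense_open_generic gU hU]]].
have rT q : map_regular Theta q by apply/ratmap_map_regular/eT.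
split=> //; first exact: iso_dominant rT T'K.
by apply: generic_sub gU => q /hU[].
Qed.

Lemma lifts_of_generic_lift (Phi : ratmap C1 C2) (T : pt D1 -> pt D2) (T' : pt D2 -> pt D1) :
  generic_lift Phi T -> (forall q, map_regular T' q) -> cancel T T' -> cancel T' T ->
  exists Theta : ratmap D1 D2, lifts Phi Theta /\ rfun Theta = T.
Proof.
move=> [rT dT gT] rT' TK T'K.
have [Theta [eT ET]] := ratmap_of_map_regular rT.
have [Theta' [eT' ET']] := ratmap_of_map_regular rT'.
exists Theta; split=> //; split=> //; first by exists Theta'; rewrite ET ET'; split.
have gdom := @model_dominant _ _ _ M1 _ (ratmap_generic Phi).
have [U [oU hU]] := generic_dense_open (generic_and gdom gT).
by exists U; split=> // q /hU; rewrite ET.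
Qed.

Lemma lifts_equiv Phi Phi' (Theta : ratmap D1 D2) :
  rat_equiv Phi Phi' -> lifts Phi Theta -> lifts Phi' Theta.
Proof.
move=> [V [/dense_open_generic gV hV]] [eT eT' [U [/dense_open_generic gU hU]]]; split=> //.
have [W [oW hW]] := generic_dense_open (generic_and gU (@model_dominant _ _ _ M1 _ gV)).
by exists W; split=> // q /hW[/hU[_ ->] /hV[_ h ->]].
Qed.

Lemma rat_equiv_sym (Phi Phi' : ratmap C1 C2) : rat_equiv Phi Phi' -> rat_equiv Phi' Phi.
Proof. by move=> [U [oU h]]; exists U; split=> // a /h[? ? ->]. Qed.

Lemma pullback_equiv (Phi Phi' : ratmap C1 C2) : rat_equiv Phi Phi' ->
  forall (G : wset M2 -> Prop) (W : wset M1), pullback Phi G W <-> pullback Phi' G W.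
Proof.
move=> h G W; have h' := rat_equiv_sym h.
by split=> -[W2 GW [Theta [lT E]]]; exists W2 => //; exists Theta; split=> //;
  [apply: lifts_equiv h lT | apply: lifts_equiv h' lT].
Qed.

End Lifting.

(** The composite of the two lifts is a regular map that is generically the
    identity. *)
Lemma generic_lift_cancel (L : closedFieldType) w1 w2 (C1 : curve L w1) (C2 : curve L w2)
    (M1 : ns_model C1) (M2 : ns_model C2) (Phi : ratmap C1 C2) (Psi : ratmap C2 C1) T T' :
  Defs.left_inverse Phi Psi -> generic_lift (M1 := M1) (M2 := M2) Phi T ->
  generic_lift (M1 := M2) (M2 := M1) Psi T' -> cancel T T'.
Proof.
move=> [U [/dense_open_generic gU hU]] [rT dT gT] [rT' dT' gT'] q.
have rc := map_regular_comp (rT q) (rT' (T q)).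
apply: (map_regular_eq rc (map_regular_id q)).
have [mu gmu] := model_injective M1.
apply: generic_sub (generic_and (generic_and gT (dT _ gT'))
  (generic_and (generic_and gmu (dominant_comp dT dT' gmu)) (@model_dominant _ _ _ M1 _ gU))).
move=> a [[E1 E2] [[Ea EE] /hU[_ _ Ua]]].
by rewrite -EE E2 E1 Ua.
Qed.

Section Correspondence.
Variables (L : closedFieldType) (w1 w2 : nat) (C1 : curve L w1) (C2 : curve L w2).
Variables (M1 : ns_model C1) (M2 : ns_model C2).
Variables (Phi : ratmap C1 C2) (Psi : ratmap C2 C1).
Hypothesis hPhi : birational_inverse Phi Psi.

Lemma lift_pair : exists T T', [/\ generic_lift (M1 := M1) (M2 := M2) Phi T,
  generic_lift (M1 := M2) (M2 := M1) Psi T', cancel T T' & cancel T' T].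
Proof.
have [l1 l2] := hPhi.
have [T hT] := generic_lift_exists M1 M2 (ratmap_dominant l2).
have [T' hT'] := generic_lift_exists M2 M1 (ratmap_dominant l1).
by exists T, T'; split=> //; [exact: generic_lift_cancel l1 hT hT' | exact: generic_lift_cancel l2 hT' hT].
Qed.

End Correspondence.

(** The existential quantifier over lifts in the definition of the pullback is
    harmless, the lift being unique. *)
Lemma pullbackE (L : closedFieldType) w1 w2 (C1 : curve L w1) (C2 : curve L w2)
    (M1 : ns_model C1) (M2 : ns_model C2) (Phi : ratmap C1 C2)
    (T : pt (ns_curve M1) -> pt (ns_curve M2)) (T' : pt (ns_curve M2) -> pt (ns_curve M1)) :
  generic_lift Phi T -> (forall q, map_regular T' q) -> cancel T T' -> cancel T' T ->
  forall (G : wset M2 -> Prop) (W1 : wset M1),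
    pullback Phi G W1 <-> exists2 W2, G W2 & forall g, W1 g = W2 (T g).
Proof.
move=> lT rT' TK T'K G W1; split=> [[W2 GW [Theta [/lifts_generic_lift lTh E]]]|[W2 GW E]].
  by exists W2 => // g; rewrite E (generic_lift_unique lTh lT).
have [Theta [lTh ET]] := lifts_of_generic_lift lT rT' TK T'K.
by exists W2 => //; exists Theta; split=> // g; rewrite ET.
Qed.

Lemma pullback_gnr (L : closedFieldType) w1 w2 (C1 : curve L w1) (C2 : curve L w2)
    (M1 : ns_model C1) (M2 : ns_model C2) (Phi : ratmap C1 C2) (Psi : ratmap C2 C1) :
  birational_inverse Phi Psi -> forall n r (G : wset M2 -> Prop),
  is_gnr n r G -> is_gnr n r (pullback (M1 := M1) Phi G).
Proof.
move=> hPhi n r G hG; have [T [T' [lT lT' TK T'K]]] := lift_pair M1 M2 hPhi.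
have [rT _ gT] := lT; have [rT' _ _] := lT'.
have [m [P mP]] := ratmap_maps Phi; have [_ l2] := hPhi.
apply: (is_gnr_transport rT rT' TK T'K gT (ratmap_dominant l2) mP _ hG).
by move=> W1; apply: (pullbackE lT rT' TK T'K).
Qed.

Lemma pullbackK (L : closedFieldType) w1 w2 (C1 : curve L w1) (C2 : curve L w2)
    (M1 : ns_model C1) (M2 : ns_model C2) (Phi : ratmap C1 C2) (Psi : ratmap C2 C1) :
  birational_inverse Phi Psi -> forall (G : wset M2 -> Prop) W,
  pullback Psi (pullback (M1 := M1) Phi G) W <-> G W.
Proof.
move=> hPhi G W; have [T [T' [lT lT' TK T'K]]] := lift_pair M1 M2 hPhi.
have [rT _ _] := lT; have [rT' _ _] := lT'.
have E1 := pullbackE lT rT' TK T'K; have E2 := pullbackE lT' rT T'K TK.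
split=> [/E2[W1 /E1[W2 GW h1] h2]|GW].
  by suff -> : W = W2 by []; apply/msetP => g; rewrite h2 h1 T'K.
apply/E2; exists (transport_wset T' W); last by move=> g; rewrite (transport_wsetE TK T'K) T'K.
by apply/E1; exists W => // g; rewrite (transport_wsetE TK T'K).
Qed.

Lemma birational_inverse_sym (L : closedFieldType) w1 w2 (C1 : curve L w1) (C2 : curve L w2)
  (Phi : ratmap C1 C2) (Psi : ratmap C2 C1) : birational_inverse Phi Psi -> birational_inverse Psi Phi.
Proof. by case. Qed.

Theorem theorem3p14 (L : closedFieldType) (w1 w2 : nat)
    (C1 : curve L w1) (C2 : curve L w2)
    (M1 : ns_model C1) (M2 : ns_model C2)
    (Phi : ratmap C1 C2) (Psi : ratmap C2 C1)
    (hPhi : birational_inverse Phi Psi) :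
  (* a g_n^r on C2 induces one on C1, depending only on [Phi] *)
  [/\ forall (n r : nat) (G : wset M2 -> Prop),
        is_gnr n r G -> is_gnr n r (pullback (M1 := M1) Phi G)
    & forall (Phi' : ratmap C1 C2), rat_equiv Phi Phi' ->
        forall (G : wset M2 -> Prop) (W : wset M1),
          pullback Phi G W <-> pullback Phi' G W] /\
  (* a g_n^r on C1 induces one on C2, depending only on [Phi^-1] *)
  [/\ forall (n r : nat) (G : wset M1 -> Prop),
        is_gnr n r G -> is_gnr n r (pullback (M1 := M2) Psi G)
    & forall (Psi' : ratmap C2 C1), rat_equiv Psi Psi' ->
        forall (G : wset M1 -> Prop) (W : wset M2),
          pullback Psi G W <-> pullback Psi' G W] /\
  (* the two correspondences are inverse *)
  [/\ forall (n r : nat) (G : wset M2 -> Prop), is_gnr n r G ->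
        forall W, pullback Psi (pullback (M1 := M1) Phi G) W <-> G W
    & forall (n r : nat) (G : wset M1 -> Prop), is_gnr n r G ->
        forall W, pullback Phi (pullback (M1 := M2) Psi G) W <-> G W].
Proof.
have hPsi := birational_inverse_sym hPhi.
split; [split | split; split].
- by move=> n r G; apply: pullback_gnr hPhi _ _ _.
- by move=> Phi' h; apply: pullback_equiv.
- by move=> n r G; apply: pullback_gnr hPsi _ _ _.
- by move=> Psi' h; apply: pullback_equiv.
- by move=> n r G _ W; apply: pullbackK hPhi G W.
- by move=> n r G _ W; apply: pullbackK hPsi G W.
Qed.
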